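(* Let $(f,g,h)\in\mathcal N^m$, $\varphi\in\mathcal G$, $y_{\mathrm{ref}}\in W^{1,\infty}(\mathbb R_{\ge 0},\mathbb R^m)$, $\lambda_u\ge 0$, $t^0\ge 0$, and let $B\subset\mathcal D^\varphi_{t^0}$ be a bounded set. Then there exists $M>0$ such that the Funnel MPC (FMPC) algorithm with bound $M$, time shift $\delta>0$ and prediction horizon $T\ge\delta$ is initially and recursively feasible for every $x^0\in B$, i.e. at time $\hat t=t^0$ and at each successor time $\hat t\in t^0+\delta\mathbb N$ the optimal control problem $$\text{minimize } J^\varphi_T(u;\hat t,\hat x)\quad\text{over } u\in L^\infty([\hat t,\hat t+T],\mathbb R^m),\ \|u\|_\infty\le M,\qquad \hat x=x(\hat t),$$ has a solution (a minimizer), whichever minimizers were selected in the previous steps. In particular, the closed-loop system consisting of the control system and the FMPC feedback has a (not necessarily unique) global solution $x:[t^0,\infty)\to\mathbb R^n$, with corresponding input $u_{\mathrm{FMPC}}(t)=\mu(t,x(\hat t))$ for $t\in[\hat t,\hat t+\delta)$, $\hat t\in t^0+\delta\mathbb N_0$. Furthermore, each such global solution $x$ with corresponding input $u_{\mathrm{FMPC}}$ satisfies: (i) $\|u_{\mathrm{FMPC}}(t)\|\le M$ for (almost) all $t\ge t^0$; (ii) the error $e(t)=h(x(t))-y_{\mathrm{ref}}(t)$ evolves within the funnel $\mathcal F_\varphi=\{(t,e)\in\mathbb R_{\ge0}\times\mathbb R^m : \varphi(t)\|e\|<1\}$, i.e. $(t,e(t))\in\mathcal F_\varphi$ for all $t\ge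 t^0$; in particular $\|e(t)\|\le\varphi(t)^{-1}$ for all $t\ge t^0$.
   Context: **System.** $\|\cdot\|$ denotes a norm on $\mathbb R^n$ (resp. $\mathbb R^m$, etc.), and $\|\cdot\|_\infty$ the essential supremum norm. Consider $$\dot x(t)=f(x(t))+g(x(t))u(t),\quad x(t^0)=x^0,\qquad y(t)=h(x(t)),$$ with $f\in C^1(\mathbb R^n,\mathbb R^n)$, $g\in C^1(\mathbb R^n,\mathbb R^{n\times m})$, $h\in C^2(\mathbb R^n,\mathbb R^m)$, and input $u$ locally essentially bounded and measurable. Solutions are Carathéodory solutions (absolutely continuous, ODE holds a.e.); $x(\cdot;t^0,x^0,u)$ denotes the unique maximal solution. **System class $\mathcal N^m$.** $(f,g,h)\in\mathcal N^m$ means: (1) (relative degree one) $\Gamma(x):=h'(x)g(x)\in\mathrm{GL}_m(\mathbb R)$ for all $x\in\mathbb R^n$; (2) $h^{-1}(0)$ is diffeomorphic to $\mathbb R^{n-m}$, and the distribution $x\mapsto \operatorname{im} g(x)$ is involutive (Lie brackets of smooth vector fields with values in $\operatorname{im} g(x)$ again have values in $\operatorname{im} g(x)$); there is then a diffeomorphism $\Phi:\mathbb R^n\to\mathbb R^n$ such that $(y(t),\eta(t))=\Phi(x(t))\in\mathbb R^m\times\mathbb R^{n-m}$ (with $y=h(x)$) transforms the system into Byrnes–Isidori form $$\dot y=p(y,\eta)+\Gamma(\Phi^{-1}(y,\eta))u,\qquad \dot\eta=q(y,\eta),\qquad (y(t^0),\eta(t^0))=(y^0,\eta^0)=\Phi(x^0),$$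 with $p\in C^1(\mathbb R^m\times\mathbb R^{n-m},\mathbb R^m)$, $q\in C^1(\mathbb R^m\times\mathbb R^{n-m},\mathbb R^{n-m})$; (3) (BIBS condition) for every $c_0>0$ there is $c_1>0$ such that for all $t^0\ge0$, $\eta^0\in\mathbb R^{n-m}$ and $y\in L^\infty_{\mathrm{loc}}([t^0,\infty),\mathbb R^m)$: $\|\eta^0\|+\|y\|_\infty\le c_0$ implies $\|\eta(\cdot;t^0,\eta^0,y)\|_\infty\le c_1$, where $\eta(\cdot;t^0,\eta^0,y)$ is the solution of $\dot\eta=q(y,\eta)$, $\eta(t^0)=\eta^0$ (which is then global). **Funnel.** $\mathcal G:=\{\varphi\in W^{1,\infty}(\mathbb R_{\ge0},\mathbb R): \inf_{t\ge0}\varphi(t)>0\}$, and for $t\ge 0$, $\mathcal D^\varphi_t:=\{x\in\mathbb R^n:\varphi(t)\|h(x)-y_{\mathrm{ref}}(t)\|<1\}$. ($W^{1,\infty}$ functions are identified with their Lipschitz continuous representatives.) **Stage cost and cost functional.** For a design parameter $\lambda_u\ge0$, $$\ell_\varphi(t,x,u)=\frac{1}{1-\varphi(t)^2\|h(x)-y_{\mathrm{ref}}(t)\|^2}-1+\lambda_u\|u\|^2\ \text{ if }\varphi(t)\|h(x)-y_{\mathrm{ref}}(t)\|\ne1,\qquad \ell_\varphi(t,x,u)=\infty\text{ otherwise.}$$ A measurable function $\zeta$ is quasi-integrable if at least one of $\int\zeta^+$, $\int\zeta^-$ is finite, $\zeta^+=\max\{\zeta,0\}$, $\zeta^-=\max\{-\zeta,0\}$.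 For $u\in L^\infty([\hat t,\hat t+T],\mathbb R^m)$ put $J^\varphi_T(u;\hat t,\hat x)=\int_{\hat t}^{\hat t+T}\ell_\varphi(t,x(t;\hat t,\hat x,u),u(t))\,dt$ if $x(\cdot;\hat t,\hat x,u)$ exists on all of $[\hat t,\hat t+T]$ and the integrand is quasi-integrable there, and $J^\varphi_T(u;\hat t,\hat x)=\infty$ otherwise. **FMPC algorithm.** Given the system, $y_{\mathrm{ref}}$, $\varphi$, $M>0$, $t^0\ge0$, $x^0\in\mathcal D^\varphi_{t^0}$, $\delta>0$, $T\ge\delta$; start with $\hat t:=t^0$. Repeat: (a) set $\hat x:=x(\hat t)$; (b) compute a minimizer $u^\star\in L^\infty([\hat t,\hat t+T],\mathbb R^m)$ of $J^\varphi_T(u;\hat t,\hat x)$ over all $u$ with $\|u\|_\infty\le M$; (c) apply the feedback $\mu(t,\hat x):=u^\star(t)$, $t\in[\hat t,\hat t+\delta)$, to the system, increase $\hat t$ by $\delta$ and go to (a). The minimizer need not be unique; any may be chosen. *)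

(* Defs.v *)
From HB Require Import structures.
From mathcomp Require Import all_boot all_order all_algebra.
From mathcomp Require Import all_classical all_reals all_analysis.
From mathcomp Require Import measurable_realfun ess_sup_inf.

Set Implicit Arguments.
Unset Strict Implicit.
Unset Printing Implicit Defensive.

Import Order.TTheory GRing.Theory Num.Theory.
Import numFieldNormedType.Exports.

Local Open Scope classical_set_scope.
Local Open Scope ring_scope.

(* Vectors of R^d are column vectors 'cV[R]_d.  The topology and the
   differential calculus are those of MathComp-Analysis (sup norm); the norm
   of the mathematical statement is an arbitrary one, see [is_norm]. *)

Definition is_norm (R : realType) (d : nat) (N : 'cV[R]_d -> R) : Prop :=
  [/\ forall x, N x = 0 -> x = 0,
      forall a x, N (a *: x) = `|a| * N x
    & forall x y, N (x + y) <= N x + N y].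

(* Only used between finite-dimensional spaces, where C^k is equivalent to
   the directional derivatives being C^(k-1). *)
Fixpoint Ck (R : realType) (V W : normedModType R) (k : nat) (F : V -> W)
    : Prop :=
  if k is k'.+1 then
    (forall x, differentiable F x) /\ (forall v, Ck k' (fun x => 'd F x v))
  else continuous F.

Definition smooth (R : realType) (V W : normedModType R) (F : V -> W) : Prop :=
  forall k, Ck k F.

Definition jac (R : realType) (n m : nat) (h : 'cV[R]_n -> 'cV[R]_m)
    (x : 'cV[R]_n) : 'M[R]_(m, n) :=
  \matrix_(i < m, j < n) ('d h x (delta_mx j 0 : 'cV[R]_n)) i 0.

Definition diffeomorphism (R : realType) (V W : normedModType R)
    (Phi : V -> W) (Psi : W -> V) : Prop :=
  [/\ Ck 1 Phi, Ck 1 Psi, cancel Phi Psi & cancel Psi Phi].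

(* C^1 maps on the subset S are those which extend locally to C^1 maps; the
   local extension may be taken defined on all of V, after shrinking U. *)
Definition set_diffeomorphic (R : realType) (V W : normedModType R)
    (S : set V) : Prop :=
  exists (a : W -> V) (b : V -> W),
    [/\ Ck 1 a, forall w, S (a w), cancel a b, (forall x, S x -> a (b x) = x)
      & forall x, S x -> exists (U : set V) (c : V -> W),
          [/\ open_nbhs x U, Ck 1 c & forall z, U z -> S z -> c z = b z]].

Section measure_notions.
Context {R : realType}.
Local Notation mu := (@lebesgue_measure R).

(* The L^oo norm on I of t |-> N (w t).  Measurability below is Borel
   measurability; every Lebesgue measurable function has a Borel
   representative, so the L^oo classes are the usual ones. *)
Definition normoo (W : Type) (N : W -> R) (I : set R) (w : R -> W) : \bar R :=
  ess_sup mu ((fun t => (N (w t))%:E) \_ I).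

Definition Loo (d : nat) (N : 'cV[R]_d -> R) (I : set R) (w : R -> 'cV[R]_d)
    : Prop :=
  (forall i, measurable_fun I (fun t => w t i 0)) /\ (normoo N I w < +oo)%E.

Definition Loo_loc (d : nat) (N : 'cV[R]_d -> R) (t0 : R)
    (w : R -> 'cV[R]_d) : Prop :=
  forall b, Loo N `[t0, b] w.

Definition Loo_scalar (I : set R) (w : R -> R) : Prop :=
  measurable_fun I w /\ (normoo (fun s : R => `|s|%R) I w < +oo)%E.

Definition test_function (theta : R -> R) : Prop :=
  @smooth R R^o R^o theta /\
  exists a b, [/\ 0 < a, a < b & forall t, theta t != 0 -> a <= t <= b].

(* W^{1,oo}([0,oo), R): bounded functions with bounded weak derivative,
   represented by their Lipschitz continuous representative. *)
Definition W1oo (z : R -> R) : Prop :=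
  [/\ Loo_scalar `[0, +oo[ z,
      exists dz : R -> R, Loo_scalar `[0, +oo[ dz /\
        forall theta, test_function theta ->
          \int[mu]_(t in `[0, +oo[) (z t * (derive1 (theta : R -> R^o) t : R)) =
          - \int[mu]_(t in `[0, +oo[) (dz t * theta t)
    & exists L, forall s t, 0 <= s -> 0 <= t -> `|z s - z t| <= L * `|s - t|].

Definition W1oo_vec (m : nat) (z : R -> 'cV[R]_m) : Prop :=
  forall i, W1oo (fun t => z t i 0).

Definition abs_continuous (V : normedModType R) (a b : R) (z : R -> V)
    : Prop :=
  forall e, 0 < e -> exists2 d, 0 < d &
    forall (N : nat) (p q : 'I_N -> R),
      (forall i, [/\ a <= p i, p i <= q i & q i <= b]) ->
      trivIset setT (fun i => `]p i, q i[%classic) ->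
      \sum_(i < N) (q i - p i) < d ->
      \sum_(i < N) `|z (q i) - z (p i)| < e.

(* Solutions of z' = F(t, z), z(t0) = v0 on the interval I; the values of z
   outside I are irrelevant. *)
Definition caratheodory (V : normedModType R) (F : R -> V -> V)
    (t0 : R) (v0 : V) (I : set R) (z : R -> V) : Prop :=
  [/\ I t0, z t0 = v0,
      forall a b, `[a, b] `<=` I -> abs_continuous a b z
    & {ae mu, forall t, I t ->
         is_derive (t : R^o) (1 : R^o) (z : R^o -> V) (F t (z t))}].

Definition quasi_integrable (D : set R) (zeta : R -> \bar R) : Prop :=
  measurable_fun D zeta /\
  ((\int[mu]_(t in D) (zeta ^\+ t) < +oo)%E \/
   (\int[mu]_(t in D) (zeta ^\- t) < +oo)%E).

End measure_notions.

Section system.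
Context {R : realType} {n m : nat}.
Variables (f : 'cV[R]_n -> 'cV[R]_n) (g : 'cV[R]_n -> 'M[R]_(n, m))
  (h : 'cV[R]_n -> 'cV[R]_m).

Definition trajectory (u : R -> 'cV[R]_m) (t0 : R) (x0 : 'cV[R]_n)
    : set R -> set (R -> 'cV[R]_n) :=
  caratheodory (fun t x => f x + g x *m u t) t0 x0.

Definition Gamma (x : 'cV[R]_n) : 'M[R]_m := jac h x *m g x.

Definition lie_bracket (X Y : 'cV[R]_n -> 'cV[R]_n) (x : 'cV[R]_n)
    : 'cV[R]_n :=
  'd Y x (X x) - 'd X x (Y x).

Definition im_section (X : 'cV[R]_n -> 'cV[R]_n) : Prop :=
  forall x, exists w : 'cV[R]_m, X x = g x *m w.

Definition involutive_im : Prop :=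
  forall X Y, smooth X -> smooth Y -> im_section X -> im_section Y ->
    im_section (lie_bracket X Y).

(* Phi (with inverse Psi) pushes the controlled vector field f + g u forward
   to the Byrnes-Isidori form. *)
Definition byrnes_isidori
    (Phi : 'cV[R]_n -> 'cV[R]_m * 'cV[R]_(n - m))
    (Psi : 'cV[R]_m * 'cV[R]_(n - m) -> 'cV[R]_n)
    (p : 'cV[R]_m * 'cV[R]_(n - m) -> 'cV[R]_m)
    (q : 'cV[R]_m * 'cV[R]_(n - m) -> 'cV[R]_(n - m)) : Prop :=
  [/\ diffeomorphism Phi Psi, Ck 1 p, Ck 1 q,
      forall x, (Phi x).1 = h x
    & forall y eta (u : 'cV[R]_m),
        'd Phi (Psi (y, eta)) (f (Psi (y, eta)) + g (Psi (y, eta)) *m u) =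
        (p (y, eta) + Gamma (Psi (y, eta)) *m u, q (y, eta))].

(* The global solution of the internal dynamics is unique because q is C^1;
   hence the one asserted to exist is the maximal solution. *)
Definition bibs (nrm : forall d, 'cV[R]_d -> R)
    (q : 'cV[R]_m * 'cV[R]_(n - m) -> 'cV[R]_(n - m)) : Prop :=
  forall c0, 0 < c0 -> exists2 c1, 0 < c1 &
    forall (t0 : R) (eta0 : 'cV[R]_(n - m)) (y : R -> 'cV[R]_m),
      0 <= t0 -> Loo_loc (nrm m) t0 y ->
      ((nrm (n - m)%N eta0)%:E + normoo (nrm m) `[t0, +oo[ y <= c0%:E)%E ->
      exists2 eta : R -> 'cV[R]_(n - m),
        caratheodory (fun t z => q (y t, z)) t0 eta0 `[t0, +oo[ eta
        & (normoo (nrm (n - m)%N) `[t0, +oo[ eta <= c1%:E)%E.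

(* The class N^m; the existence of the global coordinate change Phi is part
   of the class, and the BIBS condition is imposed on the resulting q.  It
   does not depend on Phi: two admissible choices differ by a diffeomorphism
   of the variable eta.  Invertibility of Gamma forces m <= n, so that the
   truncated difference n - m is the actual one. *)
Record system_class (nrm : forall d, 'cV[R]_d -> R) : Prop := SystemClass {
  f_C1 : Ck 1 f;
  g_C1 : Ck 1 g;
  h_C2 : Ck 2 h;
  relative_degree_one : forall x, Gamma x \in unitmx;
  zero_set_diffeo : set_diffeomorphic 'cV[R]_(n - m) [set x | h x = 0];
  involutive_g : involutive_im;
  bi_form_bibs : exists Phi Psi p q, byrnes_isidori Phi Psi p q /\ bibs nrm q
}.

End system.

Definition funnel_function (R : realType) (phi : R -> R) : Prop :=
  W1oo phi /\ 0 < inf (phi @` `[0, +oo[).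

Definition funnel (R : realType) (m : nat) (N : 'cV[R]_m -> R) (phi : R -> R)
    : set (R * 'cV[R]_m) :=
  [set te | 0 <= te.1 /\ phi te.1 * N te.2 < 1].

Section fmpc.
Context {R : realType} {n m : nat}.
Variables (N : 'cV[R]_m -> R).
Variables (f : 'cV[R]_n -> 'cV[R]_n) (g : 'cV[R]_n -> 'M[R]_(n, m))
  (h : 'cV[R]_n -> 'cV[R]_m).
Variables (phi : R -> R) (yref : R -> 'cV[R]_m) (lambda : R).
Local Notation mu := (@lebesgue_measure R).

Definition funnel_domain (t : R) : set 'cV[R]_n :=
  [set x | phi t * N (h x - yref t) < 1].

Definition stage_cost (t : R) (x : 'cV[R]_n) (u : 'cV[R]_m) : \bar R :=
  if phi t * N (h x - yref t) != 1 then
    ((1 - phi t ^+ 2 * N (h x - yref t) ^+ 2)^-1 - 1 + lambda * N u ^+ 2)%:E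
  else +oo%E.

(* The maximal solution exists on [th, th + T] iff there is a solution on
   that interval, and [get] then returns a representative of it (solutions
   are unique on the interval, the vector fields being C^1). *)
Definition cost (T : R) (u : R -> 'cV[R]_m) (th : R) (xh : 'cV[R]_n)
    : \bar R :=
  let I := `[th, th + T]%classic in
  let sols := trajectory f g u th xh I in
  let zeta := fun t => stage_cost t (get sols t) (u t) in
  if `[< sols !=set0 /\ quasi_integrable I zeta >]
  then (\int[mu]_(t in I) zeta t)%E else +oo%E.

Variables (M delta T : R).

Definition admissible (th : R) : set (R -> 'cV[R]_m) :=
  let I := `[th, th + T]%classic in
  [set u | Loo N I u /\ (normoo N I u <= M%:E)%E].

Definition ocp_solution (th : R) (xh : 'cV[R]_n) (u : R -> 'cV[R]_m) : Prop :=
  admissible th u /\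
  forall v, admissible th v -> (cost T u th xh <= cost T v th xh)%E.

Variables (t0 : R) (x0 : 'cV[R]_n).

Definition sample (k : nat) : R := t0 + k%:R * delta.

(* us k is the minimizer selected at the sampling time [sample k]. *)
Definition u_fmpc (us : nat -> R -> 'cV[R]_m) (t : R) : 'cV[R]_m :=
  us (Num.truncn ((t - t0) / delta)) t.

(* A run of the algorithm on I, where I is [t0, sample k] or [t0, oo): x is
   generated by the FMPC input, and each input applied on I was selected
   among the minimizers. *)
Definition closed_loop (I : set R) (us : nat -> R -> 'cV[R]_m)
    (x : R -> 'cV[R]_n) : Prop :=
  trajectory f g (u_fmpc us) t0 x0 I x /\
  forall k, I (sample k.+1) -> ocp_solution (sample k) (x (sample k)) (us k).

(* After any k steps, with any choice of minimizers, the next optimal control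
   problem is solvable, and any of its solutions can be applied to the system
   on the next sampling interval, so that the algorithm never stops. *)
Definition feasible : Prop :=
  forall k us x, closed_loop `[t0, sample k] us x ->
    (exists v, ocp_solution (sample k) (x (sample k)) v) /\
    (forall v, ocp_solution (sample k) (x (sample k)) v ->
       exists2 x' : R -> 'cV[R]_n,
         closed_loop `[t0, sample k.+1]
           (fun j => if j == k then v else us j) x'
         & forall t, t0 <= t <= sample k -> x' t = x t).

End fmpc.

(* Main.v *)
Require Import Defs.
From HB Require Import structures.
From mathcomp Require Import all_boot all_order all_algebra.
From mathcomp Require Import all_classical all_reals all_analysis.
From mathcomp Require Import measurable_realfun ess_sup_inf.
From mathcomp Require Import ring lra.

Set Implicit Arguments.
Unset Strict Implicit.
Unset Printing Implicit Defensive.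

Import Order.TTheory GRing.Theory Num.Theory.
Import numFieldNormedType.Exports.

Local Open Scope classical_set_scope.
Local Open Scope ring_scope.

(* Feasibility: choosing y with phi (y - yref) constant keeps the weighted error
   at its initial value, so such a control has finite cost; relative degree one
   yields the input, which is bounded on every bounded set of (y, eta), and the
   BIBS condition bounds eta.  Since the output stays in the funnel, the BIBS
   bound from t0 on confines the internal state at all sampling times, whatever
   minimizers were selected, so that one M serves every step.

   Funnel: the weighted error w is Lipschitz along a trajectory, so if it reached
   1 at time s the cost density 1 / (1 - w^2) would dominate c / (s - t), which is
   not integrable; finite cost thus means staying strictly inside the funnel.

   Minimizers: along a minimizing sequence the states, the primitives of the
   inputs and the primitives of the input costs are equi-Lipschitz, and
   Arzela-Ascoli gives a uniform limit.  The limit input is the almost everywhere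
   derivative of the limit primitive; first-order expansions, affine in the input,
   pass to the limit and show that it generates the limit state at no larger cost.
   The barrier term is handled by Fatou's lemma. *)

(** * Linear combinations in a module *)

(** Curves are never compared through integrals of their derivatives. [ac_dominated] bounds an
    increment by that of a scalar curve, using only almost everywhere first-order expansions;
    Lipschitz bounds, uniqueness of solutions and the inequalities surviving the uniform limit all
    come from it. As inputs are essentially bounded, solutions on compact intervals are Lipschitz,
    and Lipschitz curves with a fixed constant are closed under uniform limits. Order of the
    constants: [B] and the funnel give a BIBS bound [c1] for the whole run; restarting BIBS at each
    sample would let the bound grow. A second application, started from [c1], covers any later
    horizon, and [M] is read off it. BIBS bounds do not see the length of the horizon, so [M]
    precedes [delta] and [T]. Outside the funnel the stage cost can be negative, so the cost has no
    obvious lower bound. Finite cost is first shown to keep the trajectory inside, through the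
    positive part of the integrand; only then is the infimum known to be nonnegative. *)

Section lmod_equation.
Context {R : comPzRingType} {V : lmodType R}.

Inductive lterm : Type :=
| LVar of nat | LZero | LAdd of lterm & lterm | LOpp of lterm
| LScale of R & lterm.

Fixpoint leval (env : seq V) (e : lterm) : V :=
  match e with
  | LVar i => nth 0 env i
  | LZero => 0
  | LAdd e1 e2 => leval env e1 + leval env e2
  | LOpp e1 => - leval env e1
  | LScale k e1 => k *: leval env e1
  end.

(** [Nat.eqb] computes on closed indices, so [simpl] turns a coefficient into a plain ring
    expression. *)
Fixpoint lcoef (e : lterm) (i : nat) : R :=
  match e with
  | LVar j => if Nat.eqb i j then 1 else 0
  | LZero => 0
  | LAdd e1 e2 => lcoef e1 i + lcoef e2 i
  | LOpp e1 => - lcoef e1 i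
  | LScale k e1 => k * lcoef e1 i
  end.

Lemma levalE env e : leval env e = \sum_(i < size env) lcoef e i *: nth 0 env i.
Proof.
elim: e => /= [j||e1 -> e2 ->|e1 ->|k e1 ->].
- have [jlt|jge] := ltnP j (size env).
    rewrite (bigD1 (Ordinal jlt))//= PeanoNat.Nat.eqb_refl scale1r big1 ?addr0//.
    move=> i /eqP ij; case: PeanoNat.Nat.eqb_spec => [E|]; last by rewrite scale0r.
    by case: ij; apply: val_inj.
  rewrite nth_default// big1// => i _; case: PeanoNat.Nat.eqb_spec => [E|]; last by rewrite scale0r.
  by move: (ltn_ord i); rewrite E ltnNge jge.
- by rewrite big1// => i _; rewrite scale0r.
- by rewrite -big_split/=; apply: eq_bigr => i _; rewrite scalerDl.
- by rewrite -sumrN; apply: eq_bigr => i _; rewrite scaleNr.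
- by rewrite scaler_sumr; apply: eq_bigr => i _; rewrite scalerA.
Qed.

Fixpoint lcoef_eq (e1 e2 : lterm) (n : nat) : Prop :=
  if n is n'.+1 then lcoef e1 n' = lcoef e2 n' /\ lcoef_eq e1 e2 n' else True.

(** The atoms are treated as independent vectors: equal coefficients are sufficient. On a concrete
    environment [lcoef_eq] unfolds into a conjunction of scalar identities. *)
Lemma leval_eq env e1 e2 : lcoef_eq e1 e2 (size env) -> leval env e1 = leval env e2.
Proof.
move=> H; rewrite !levalE; apply: eq_bigr => -[i /=]; move: H.
elim: (size env) => // n IH /= [h hn]; rewrite ltnS leq_eqVlt => /predU1P[->|].
  by rewrite h.
exact: IH.
Qed.

End lmod_equation.

Ltac lmod_find x env :=
  lazymatch env with
  | cons x _ => constr:(O)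
  | cons _ ?l => let n := lmod_find x l in constr:(S n)
  end.

Ltac lmod_atoms env t :=
  lazymatch t with
  | ?a + ?b => let env := lmod_atoms env a in lmod_atoms env b
  | - ?a => lmod_atoms env a
  | ?k *: ?a => lmod_atoms env a
  | 0 => env
  | _ => match env with
         | _ => let _ := lmod_find t env in env
         | _ => constr:(cons t env)
         end
  end.

Ltac lmod_reify R env t :=
  lazymatch t with
  | ?a + ?b => let a := lmod_reify R env a in let b := lmod_reify R env b in
               constr:(@LAdd R a b)
  | - ?a => let a := lmod_reify R env a in constr:(@LOpp R a)
  | ?k *: ?a => let a := lmod_reify R env a in constr:(@LScale R k a)
  | 0 => constr:(@LZero R)
  | _ => let n := lmod_find t env in constr:(@LVar R n)
  end.

(* Decides equalities of linear combinations in a module, the scalar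
   identities being left to the ring tactic. *)
Ltac lmod R :=
  lazymatch goal with
  | |- @eq ?T ?a ?b =>
    let env := lmod_atoms (@nil T) a in
    let env := lmod_atoms env b in
    let ea := lmod_reify R env a in
    let eb := lmod_reify R env b in
    apply: (@leval_eq R _ env ea eb); simpl; do ![split | ring]
  end.

(** * Absolutely continuous and Lipschitz curves *)

(** The derivative as a two-sided first-order expansion, equivalent to [is_derive] by
    [is_derive_hder]. Having no quotient, it feeds directly into estimates of increments. *)
Definition hder (R : realType) (V : normedModType R) (z : R -> V) (t : R)
    (v : V) : Prop :=
  forall e, 0 < e -> exists2 d, 0 < d & forall s, `|s - t| < d ->
    `|z s - z t - (s - t) *: v| <= e * `|s - t|.

(** Definiteness is left out because multiples [k * N] with [k] possibly zero occur as well as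
    norms; [C] records continuity with respect to the ambient norm. *)
Definition seminorm (R : realType) (V : normedModType R) (N : V -> R) (C : R)
    : Prop :=
  [/\ 0 <= C, forall x y, N (x + y) <= N x + N y,
      forall (k : R) x, N (k *: x) = `|k| * N x & forall x, N x <= C * `|x| ].

Lemma is_derive_hder (R : realType) (V : normedModType R) (z : R -> V)
    (t : R) (v : V) :
  is_derive (t : R^o) (1 : R^o) (z : R^o -> V) v <-> hder z t v.
Proof.
split.
- move=> [dz <-] e e0.
  have /cvgrPdist_le /(_ e e0) := dz.
  rewrite -/(derive _ _ _) => /nbhs_ballP[d /= d0 H].
  exists d => // s; have [->|st] := eqVneq s t.
    by move=> _; rewrite !subrr scale0r subr0 !normr0 mulr0.
  move=> sd; have := H (s - t); rewrite /ball /= sub0r normrN => /(_ sd).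
  rewrite subr_eq0 => /(_ st); rewrite [_%:A]mulr1 addrC subrK addrC.
  set D := 'D_1 z t; rewrite addrC => h.
  have -> : z s - z t - (s - t) *: D =
    - ((s - t) *: (D - (s - t)^-1 *: (z s - z t))).
    by rewrite scalerBr scalerA mulfV ?subr_eq0// scale1r opprB.
  rewrite normrN normrZ mulrC ler_pM2r ?normr_gt0 ?subr_eq0//.
  by rewrite addrC.
- move=> H.
  have C : h^-1 *: ((z \o shift t) (h *: 1) - z t) @[h --> 0^'] --> v.
    apply/cvgrPdist_le => e e0; have [d d0 D] := H e e0.
    apply/nbhs_ballP; exists d => // s; rewrite /ball /= sub0r normrN => sd s0.
    rewrite [_%:A]mulr1; have := D (s + t); rewrite addrK => /(_ sd).
    move: (z _ - _) => w h.
    have -> : v - s^-1 *: w = - (s^-1 *: (w - s *: v)).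
      by rewrite scalerBr scalerA mulVf// scale1r opprB.
    by rewrite normrN normrZ normfV mulrC ler_pdivrMr// normr_gt0.
  split; first by apply/cvg_ex; exists v.
  exact: cvg_lim C.
Qed.

(** Cousin's lemma as an induction principle: a property that is additive over adjacent intervals,
    and true on all short intervals around each tag, holds on [[a, b]]. It replaces the choice of a
    tagged partition subordinate to a gauge. *)
Lemma cousin (R : realType) (Q : R -> R -> Prop) (a b : R) : a <= b ->
  (forall r t s, a <= r -> r <= t -> t <= s -> s <= b ->
     Q r t -> Q t s -> Q r s) ->
  (forall t, a <= t -> t <= b -> exists2 d, 0 < d & forall r s,
     a <= r -> r <= t -> t <= s -> s <= b -> s - r < d -> Q r s) ->
  Q a b.
Proof.
move=> ab Qcat Qloc.
pose S := [set x | a <= x <= b /\ Q a x].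
have Sa : S a.
  split; first by rewrite lexx.
  by have [d d0] := Qloc a (lexx a) ab; apply => //; rewrite subrr.
have hS : has_sup S.
  by split; [exists a | exists b => x [/andP[]]].
set c := sup S.
have ac : a <= c by apply: sup_upper_bound.
have cb : c <= b by apply: sup_le_ub; [exists a|move=> x [/andP[]]].
have [d d0 D] := Qloc c ac cb.
have d2 : 0 < d / 2 by rewrite divr_gt0.
have [x [/andP[ax xb] Qax] cx] := sup_adherent d2 hS.
have xc : x <= c by apply: sup_upper_bound => //; split => //; rewrite ax.
(* Since [x] lies within [d / 2] of the supremum [c], the interval [[x, c']] is shorter than [d] and
   contains the tag [c]. So [c'] is reached too, which contradicts the supremum unless [c' = b]. *)
pose c' := Num.min b (c + d / 3).
have cc' : c <= c' by rewrite le_min cb lerDl divr_ge0// ltW.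
have c'b : c' <= b by rewrite ge_min lexx.
have Qc' : Q a c'.
  apply: (Qcat _ x) => //; first exact: (le_trans xc).
  apply: D => //.
  have : c' <= c + d / 3 by rewrite ge_min lexx orbT.
  by rewrite -/c in cx; lra.
have c'c : c' <= c.
  by apply: sup_upper_bound => //; split => //; rewrite c'b (le_trans ac).
suff <- : c' = b by [].
apply/eqP; rewrite eq_le c'b/= leNgt; apply/negP => c'b'.
have : c' = c + d / 3.
  by rewrite /c' minElt; case: ifP => // h; move: c'b'; rewrite /c' minElt h ltxx.
lra.
Qed.

Section ac_dominated.
Context {R : realType} {V : normedModType R}.
Local Notation mu := (@lebesgue_measure R).

(* The intervals ]p i, q i[ are those whose tag lies in the exceptional null
   set, O being an open cover of it. *)
Definition interval_sum (O : set R) (N : V -> R) (C e : R) (z : R -> V)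
    (beta : R -> R) (r s : R) : Prop :=
  exists (n : nat) (p q : 'I_n -> R),
  [/\ forall i, [/\ r <= p i, p i <= q i & q i <= s],
      trivIset setT (fun i => `]p i, q i[%classic),
      ((\sum_(i < n) (q i - p i))%:E <= mu (O `&` `]r, s[))%E &
      N (z s - z r) <= beta s - beta r +
        \sum_(i < n) (C * `|z (q i) - z (p i)| + `|beta (q i) - beta (p i)|) +
        e * (s - r)].

(** The length budget is the measure of the part of [O] inside []r, s[], not of [O] itself: budgets
    of adjacent intervals then add up, as these parts are disjoint. *)
Lemma interval_sum_cat O N C e z beta a b : open O -> seminorm N C ->
  forall r t s, a <= r -> r <= t -> t <= s -> s <= b ->
  interval_sum O N C e z beta r t -> interval_sum O N C e z beta t s ->
  interval_sum O N C e z beta r s.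
Proof.
move=> oO [C0 ND NZ NC] r t s _ rt ts _ [n1 [p1 [q1 [b1 t1 l1 e1]]]]
  [n2 [p2 [q2 [b2 t2 l2 e2]]]].
exists (n1 + n2)%N.
pose P i := match fintype.split i with inl j => p1 j | inr j => p2 j end.
pose Q i := match fintype.split i with inl j => q1 j | inr j => q2 j end.
exists P, Q; split.
- move=> i; rewrite /P /Q; case: splitP => j _.
    by have [? ? ?] := b1 j; split => //; apply: le_trans ts.
  by have [? ? ?] := b2 j; split => //; apply: le_trans rt _.
- apply/trivIsetP => i j _ _ ij; rewrite /P /Q.
  case: splitP => i' ii; case: splitP => j' jj.
  + move/trivIsetP: (t1); apply => //; apply: contra ij => /eqP h.
    by apply/eqP/val_inj; rewrite /= ii jj h.
  + rewrite -subset0 => x /=; rewrite !in_itv/= => -[/andP[_ h1] /andP[h2 _]].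
    by have [_ _ ?] := b1 i'; have [? _ _] := b2 j'; lra.
  + rewrite -subset0 => x /=; rewrite !in_itv/= => -[/andP[h2 _] /andP[_ h1]].
    by have [_ _ ?] := b1 j'; have [? _ _] := b2 i'; lra.
  + move/trivIsetP: (t2); apply => //; apply: contra ij => /eqP h.
    by apply/eqP/val_inj; rewrite /= ii jj h.
- rewrite big_split_ord/= EFinD.
  rewrite (eq_bigr (fun i => q1 i - p1 i)); last first.
    by move=> i _; rewrite /P /Q (unsplitK (inl i)).
  rewrite [X in (_ + X%:E)%E](eq_bigr (fun i => q2 i - p2 i)); last first.
    by move=> i _; rewrite /P /Q (unsplitK (inr i)).
  apply: (le_trans (leeD l1 l2)).
  rewrite -measureU; [|apply: measurableI => //; exact: open_measurable|
    apply: measurableI => //; exact: open_measurable|]; last first.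
    rewrite -subset0 => x /=; rewrite !in_itv/=.
    by move=> -[[_ /andP[? ?]] [_ /andP[? ?]]]; lra.
  apply: le_measure.
  + rewrite inE; apply: measurableU; apply: measurableI => //; exact: open_measurable.
  + rewrite inE; apply: measurableI => //; exact: open_measurable.
  + by move=> x /=; rewrite !in_itv/= => -[] [? /andP[? ?]]; split => //;
      apply/andP; split; lra.
- rewrite big_split_ord/=.
  rewrite (eq_bigr (fun i => C * `|z (q1 i) - z (p1 i)| + `|beta (q1 i) - beta (p1 i)|)); last first.
    by move=> i _; rewrite /P /Q (unsplitK (inl i)).
  rewrite [X in (_ + (_ + X) + _)](eq_bigr (fun i => C * `|z (q2 i) - z (p2 i)| + `|beta (q2 i) - beta (p2 i)|)); last first.
    by move=> i _; rewrite /P /Q (unsplitK (inr i)).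
  have := NZ; have := ND (z s - z t) (z t - z r); rewrite addrA subrK; lra.
Qed.

(* A dominated-increment principle: every tag outside the exceptional null set
   carries a first-order estimate, and the tags inside it are absorbed by
   absolute continuity since the null set has an open cover of small measure. *)
Lemma ac_dominated (N : V -> R) (C : R) (z : R -> V) (beta : R -> R^o)
    (a b : R) : seminorm N C -> a <= b ->
  abs_continuous a b z -> abs_continuous a b beta ->
  {ae mu, forall t, a <= t <= b -> exists v c,
     [/\ hder z t v, hder beta t c & N v <= c]} ->
  N (z b - z a) <= beta b - beta a.
Proof.
move=> sN ab acz acb [A [mA A0 Asub]].
have [C0 ND NZ NC] := sN.
suff H : forall e, 0 < e -> N (z b - z a) <= beta b - beta a + e.
  by apply/ler_addgt0Pr => e e0; exact: H.
move=> e e0.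
(* The error budget: intervals tagged in the null set cost at most [e1 * (C + 1) = e / 4], the
   others [e2 * (b - a) <= e / 2]. The expansion accuracy [e3] satisfies [e3 * (C + 1) = e2], as it
   is paid once through [N] and once for [beta]. *)
pose e1 := e / (4 * (C + 1)).
have e10 : 0 < e1 by rewrite divr_gt0// mulr_gt0//; lra.
pose e2 := e / (2 * (b - a + 1)).
have e20 : 0 < e2 by rewrite divr_gt0// mulr_gt0//; lra.
pose e3 := e2 / (C + 1).
have e30 : 0 < e3 by rewrite divr_gt0//; lra.
have [d1 d10 D1] := acz _ e10.
have [d2 d20 D2] := acb _ e10.
have [U [oO AO muO]] : exists U : set R,
    [/\ open U, A `<=` U & (mu U < (Num.min d1 d2)%:E)%E].
  have d0 : 0 < Num.min d1 d2 by rewrite lt_min d10 d20.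
  have muA : (mu A < +oo)%E by rewrite A0 ltry.
  have [U [oO AO muO]] := lebesgue_regularity_outer mA muA d0.
  exists U; split => //; apply: le_lt_trans muO.
  have mO : measurable U by exact: open_measurable.
  have := measureU2 mu mA (measurableD mO mA); rewrite setDUK//.
  by rewrite [X in (_ <= X + _)%E]A0 add0e.
have [n [p [q [bpq tpq lpq Npq]]]] : interval_sum U N C e2 z beta a b.
  apply: cousin => //; first exact: interval_sum_cat.
  move=> t at' tb; have [At|At] := pselect (A t).
  - have /nbhs_ballP[d /= d0 dO] : nbhs t U.
      by move: oO; rewrite openE; apply; exact: AO.
    exists d => // r s ar rt ts sb srd.
    exists 1%N, (fun=> r), (fun=> s); split.
    + by move=> i; split => //; exact: le_trans ts.
    + by apply/trivIsetP => i j _ _; rewrite !ord1 eqxx.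
    + rewrite big_ord_recl big_ord0 addr0.
      have -> : U `&` `]r, s[ = `]r, s[%classic.
        apply/setIidr => x /=; rewrite in_itv/= => /andP[rx xs].
        apply: dO; rewrite /ball/= ltr_norml; apply/andP; split; lra.
      rewrite lebesgue_measure_itv/= lte_fin; case: ltP => // sr.
      by rewrite lee_fin; lra.
    + rewrite big_ord_recl big_ord0 addr0.
      have := NC (z s - z r); have := ler_norm (beta r - beta s).
      rewrite distrC => h1 h2.
      have := mulr_ge0 (ltW e20) (_ : 0 <= s - r); rewrite subr_ge0.
      by rewrite (le_trans rt ts) => /(_ isT); lra.
  - have [v [c [dz db Nv]]] : exists v c,
        [/\ hder z t v, hder beta t c & N v <= c].
      apply: contrapT => h; apply: At; apply: Asub => /=.
      by move/(_ (introT andP (conj at' tb))).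
    have [d1' d1'0 E1] := dz _ e30.
    have [d2' d2'0 E2] := db _ e30.
    exists (Num.min d1' d2'); first by rewrite lt_min d1'0.
    move=> r s ar rt ts sb; rewrite lt_min => /andP[sr1 sr2].
    exists 0%N, (fun=> r), (fun=> s); split.
    + by case.
    + by apply/trivIsetP => -[].
    + by rewrite big_ord0.
    + rewrite big_ord0 addr0.
      have E1s : `|z s - z t - (s - t) *: v| <= e3 * (s - t).
        have := E1 s; rewrite ger0_norm ?subr_ge0//; apply; lra.
      have E1r : `|z r - z t - (r - t) *: v| <= e3 * (t - r).
        have := E1 r; rewrite ler0_norm ?subr_le0// opprB; apply; lra.
      have E2s : `|beta s - beta t - (s - t) * c| <= e3 * (s - t).
        have := E2 s; rewrite ger0_norm ?subr_ge0//; apply; lra.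
      have E2r : `|beta r - beta t - (r - t) * c| <= e3 * (t - r).
        have := E2 r; rewrite ler0_norm ?subr_le0// opprB; apply; lra.
      have -> : z s - z r = (z s - z t - (s - t) *: v)
          + (- (z r - z t - (r - t) *: v) + (s - r) *: v).
        by lmod R.
      have h1 := ND (z s - z t - (s - t) *: v)
        (- (z r - z t - (r - t) *: v) + (s - r) *: v).
      have h2 := ND (- (z r - z t - (r - t) *: v)) ((s - r) *: v).
      have h3 := le_trans (NC _) (ler_wpM2l C0 E1s).
      have h4 : N (- (z r - z t - (r - t) *: v)) <= C * (e3 * (t - r)).
        by rewrite (le_trans (NC _))// normrN ler_wpM2l.
      have h5 : N ((s - r) *: v) <= (s - r) * c.
        rewrite NZ ger0_norm; last by rewrite subr_ge0; lra.
        by rewrite ler_wpM2l// subr_ge0; lra.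
      move: E2s E2r; rewrite !ler_norml => /andP[h6 _] /andP[_ h7].
      have h8 : e3 * (C + 1) = e2 by rewrite /e3; field; lra.
      by nra.
have D1' : \sum_(i < n) `|z (q i) - z (p i)| < e1.
  apply: D1 => //; rewrite -lte_fin; apply: le_lt_trans lpq _.
  apply: le_lt_trans (lt_le_trans muO _); last by rewrite lee_fin ge_min lexx.
  by apply: le_measure; rewrite ?inE//; [apply: measurableI => //|]; exact: open_measurable.
have D2' : \sum_(i < n) `|beta (q i) - beta (p i)| < e1.
  apply: D2 => //; rewrite -lte_fin; apply: le_lt_trans lpq _.
  apply: le_lt_trans (lt_le_trans muO _); last by rewrite lee_fin ge_min lexx orbT.
  by apply: le_measure; rewrite ?inE//; [apply: measurableI => //|]; exact: open_measurable.
rewrite (le_trans Npq)// -addrA lerD2l big_split/= -mulr_sumr.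
have h1 : e1 * (C + 1) = e / 4.
  by rewrite /e1; field; lra.
have h2 : e2 * (b - a + 1) = e / 2.
  by rewrite /e2; field; lra.
have := ler_wpM2l C0 (ltW D1'); nra.
Qed.

End ac_dominated.

Section ae_lebesgue.
Context {R : realType}.
Local Notation mu := (@lebesgue_measure R).
Implicit Types P Q : R -> Prop.

Lemma aeS P Q : (forall t, P t -> Q t) ->
  {ae mu, forall t, P t} -> {ae mu, forall t, Q t}.
Proof. by move=> PQ; apply: (@filterS _ _ (ae_filter_ringOfSetsType mu)). Qed.

Lemma aeI P Q : {ae mu, forall t, P t} -> {ae mu, forall t, Q t} ->
  {ae mu, forall t, P t /\ Q t}.
Proof. exact: (@filterI _ _ (ae_filter_ringOfSetsType mu)). Qed.

Lemma aeT P : (forall t, P t) -> {ae mu, forall t, P t}.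
Proof. by move=> H; apply: (@filterE _ _ (ae_filter_ringOfSetsType mu)). Qed.

Lemma ae_bigI (P : nat -> R -> Prop) : (forall n, {ae mu, forall t, P n t}) ->
  {ae mu, forall t, forall n, P n t}.
Proof. by move=> H; apply/ae_foralln. Qed.

Lemma ae_neq (c : R) : {ae mu, forall t, t != c}.
Proof.
exists [set c]; split; [exact: measurable_set1|exact: lebesgue_measure_set1|].
by move=> t /= /negP; rewrite negbK => /eqP.
Qed.

End ae_lebesgue.

Definition lip (R : realType) (V : normedModType R) (L a b : R) (z : R -> V)
    : Prop :=
  forall r s, a <= r -> r <= s -> s <= b -> `|z s - z r| <= L * (s - r).

Section hder_theory.
Context {R : realType} {V : normedModType R}.
Implicit Types (z w : R -> V) (t : R).

Lemma hderD z w t v v' :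
  hder z t v -> hder w t v' -> hder (fun s => z s + w s) t (v + v').
Proof.
move=> hz hw e e0.
have e2 : 0 < e / 2 by rewrite divr_gt0.
have [d d0 D] := hz _ e2; have [d' d'0 D'] := hw _ e2.
exists (Num.min d d'); first by rewrite lt_min d0.
move=> s; rewrite lt_min => /andP[/D h /D' h'].
have -> : z s + w s - (z t + w t) - (s - t) *: (v + v') =
  (z s - z t - (s - t) *: v) + (w s - w t - (s - t) *: v') by lmod R.
by apply: (le_trans (ler_normD _ _)); lra.
Qed.

Lemma hderZ (k : R) z t v : hder z t v -> hder (fun s => k *: z s) t (k *: v).
Proof.
move=> hz e e0.
have k0 : 0 < `|k| + 1 by rewrite ltr_pwDr.
have [d d0 D] := hz _ (divr_gt0 e0 k0); exists d => // s /D h.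
have -> : k *: z s - k *: z t - (s - t) *: (k *: v) =
  k *: (z s - z t - (s - t) *: v) by lmod R.
rewrite normrZ (le_trans (ler_wpM2l (normr_ge0 k) h))// mulrA ler_wpM2r//.
by rewrite mulrCA ler_piMr ?ltW// ltr_pdivrMr// mul1r ltrDl.
Qed.

Lemma hder_cst (c : V) t : hder (fun=> c) t 0.
Proof.
move=> e e0; exists 1 => // s _.
by rewrite subrr scaler0 subr0 normr0 mulr_ge0// ltW.
Qed.

Lemma hder_scale (c : V) t : hder (fun s => s *: c) t c.
Proof.
move=> e e0; exists 1 => // s _.
by rewrite scalerBl subrr normr0 mulr_ge0// ltW.
Qed.

Lemma hder_eq z w t v a b : a < t -> t < b ->
  (forall s, a < s -> s < b -> z s = w s) -> hder z t v -> hder w t v.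
Proof.
move=> lt_at lt_tb zw hz e e0; have [d d0 D] := hz e e0.
exists (Num.min d (Num.min (t - a) (b - t))).
  by rewrite !lt_min d0/= !subr_gt0 lt_at.
move=> s; rewrite !lt_min => /andP[/D h]; rewrite !ltr_norml => /andP[h1 h2].
rewrite -!zw//; lra.
Qed.

Lemma hder_bound (N : V -> R) (C : R) z t v (L a b : R) : seminorm N C ->
  a < t -> t < b ->
  (forall r s, a <= r -> r <= s -> s <= b -> N (z s - z r) <= L * (s - r)) ->
  hder z t v -> N v <= L.
Proof.
move=> [C0 ND NZ NC] lt_at lt_tb Nz hz; apply/ler_addgt0Pr => e e0.
have C1 : 0 < C + 1 by lra.
have [d d0 D] := hz _ (divr_gt0 e0 C1).
pose s := t + Num.min (d / 2) (b - t).
have h0 : 0 < Num.min (d / 2) (b - t) by rewrite lt_min divr_gt0//= subr_gt0.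
have hd : Num.min (d / 2) (b - t) <= d / 2 by rewrite ge_min lexx.
have hb : Num.min (d / 2) (b - t) <= b - t by rewrite ge_min lexx orbT.
have st : 0 < s - t by rewrite /s addrAC subrr add0r.
have := D s; rewrite gtr0_norm// => /(_ _)/wrap[]; first by rewrite /s; lra.
move=> h; have h2 : N (z s - z t) <= L * (s - t) by apply: Nz; rewrite /s; lra.
have : N ((s - t) *: v) <= (L + e) * (s - t).
  have -> : (s - t) *: v = (z s - z t) + - (z s - z t - (s - t) *: v) by lmod R.
  apply: (le_trans (ND _ _)); rewrite mulrDl lerD//.
  rewrite (le_trans (NC _))// normrN (le_trans (ler_wpM2l C0 h))// mulrA.
  rewrite ler_pM2r// mulrCA ler_piMr ?ltW// ltr_pdivrMr// mul1r ltrDl//.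
by rewrite NZ gtr0_norm// mulrC ler_pM2r.
Qed.

Lemma normr_seminorm : seminorm (fun x : V => `|x|) 1.
Proof.
by split => // [x y|k x|x]; rewrite ?ler_normD ?normrZ ?mul1r.
Qed.

End hder_theory.

Lemma hder_comp (R : realType) (V W : normedModType R) (F : V -> W)
    (z : R -> V) t v :
  differentiable F (z t) -> hder z t v -> hder (F \o z) t ('d F (z t) v).
Proof.
move=> dF hz; apply/is_derive_hder.
have {}hz : is_derive (t : R^o) (1 : R^o) (z : R^o -> V) v by apply/is_derive_hder.
have dz : differentiable (z : R^o -> V) t.
  by apply/derivable1_diffP; case: hz.
have dFz : differentiable (F \o z : R^o -> W) t by exact: differentiable_comp.
split; first exact/derivable1_diffP.
rewrite deriveE// diff_comp//=; congr ('d F _ _).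
by rewrite -deriveE//; case: hz.
Qed.

Section lipschitz_curves.
Context {R : realType} {V : normedModType R}.
Implicit Types (z w : R -> V).

Lemma lip_abs_continuous L a b z : 0 <= L -> lip L a b z -> abs_continuous a b z.
Proof.
move=> L0 zL e e0; have L1 : 0 < L + 1 by lra.
exists (e / (L + 1)); first by rewrite divr_gt0.
move=> n p q pq _ spq.
apply: (@le_lt_trans _ _ (L * \sum_(i < n) (q i - p i))).
  by rewrite mulr_sumr; apply: ler_sum => i _; have [? ? ?] := pq i; apply: zL.
have : 0 <= \sum_(i < n) (q i - p i).
  by apply: sumr_ge0 => i _; have [] := pq i; rewrite subr_ge0.
by move: spq; rewrite ltr_pdivlMr//; nra.
Qed.

Lemma lipW L a b a' b' z : a <= a' -> b' <= b -> lip L a b z -> lip L a' b' z.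
Proof.
by move=> aa bb zL r s ar rs sb; apply: zL => //;
   [exact: (le_trans aa)|exact: (le_trans sb)].
Qed.

Lemma lip_le L L' a b z : L <= L' -> lip L a b z -> lip L' a b z.
Proof.
move=> LL zL r s ar rs sb; rewrite (le_trans (zL _ _ ar rs sb))//.
by rewrite ler_wpM2r// subr_ge0.
Qed.

Lemma lip_eq L a b z w : (forall t, a <= t -> t <= b -> z t = w t) ->
  lip L a b z -> lip L a b w.
Proof.
move=> zw zL r s ar rs sb; rewrite -!zw; [exact: zL|..] => //.
- exact: (le_trans rs).
- exact: (le_trans ar).
Qed.

Lemma lip_glue L a b c z : lip L a b z -> lip L b c z -> lip L a c z.
Proof.
move=> z1 z2 r s ar rs sc.
have [sb|bs] := leP s b; first exact: z1.
have [br|rb] := leP b r; first exact: z2.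
have -> : z s - z r = (z s - z b) + (z b - z r) by rewrite addrA subrK.
have h1 := z1 r b ar (ltW rb) (lexx _); have h2 := z2 b s (lexx _) (ltW bs) sc.
by apply: (le_trans (ler_normD _ _)); lra.
Qed.

Lemma abs_continuousW a b a' b' z :
  a <= a' -> b' <= b -> abs_continuous a b z -> abs_continuous a' b' z.
Proof.
move=> aa bb zc e e0; have [d d0 D] := zc e e0.
exists d => // n p q pq; apply: D => i; have [h1 h2 h3] := pq i.
by split => //; [exact: le_trans h1|exact: le_trans bb].
Qed.

Lemma abs_continuous_bounded a b z : a <= b -> abs_continuous a b z ->
  exists M, forall t, a <= t -> t <= b -> `|z t| <= M.
Proof.
move=> ab zc; have [d d0 D] := zc 1 ltr01.
have near1 r s : a <= r -> r <= s -> s <= b -> s - r < d -> `|z s - z r| < 1.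
  move=> ar rs sb srd.
  have := D 1%N (fun=> r) (fun=> s); rewrite !big_ord_recl !big_ord0 !addr0.
  by apply => //; apply/trivIsetP => i j _ _; rewrite !ord1 eqxx.
apply: (@cousin R (fun r s => exists M, forall t, r <= t -> t <= s -> `|z t| <= M)) => //.
  move=> r t s _ _ _ _ [M1 h1] [M2 h2]; exists (Num.max M1 M2) => u ru us.
  by rewrite le_max; case: (leP u t) => ut; [rewrite h1|rewrite h2 ?orbT// ltW].
move=> t at_ tb; exists d => // r s ar rt ts sb sr; exists (`|z r| + 1) => u ru us.
have := near1 r u ar ru; rewrite (le_trans us sb) => /(_ isT) h.
rewrite -[z u](subrK (z r)) addrC (le_trans (ler_normD _ _))// lerD2l ltW// h//; lra.
Qed.

End lipschitz_curves.

(** The mean value inequality with an exceptional null set: [ac_dominated] against the line of slope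
    [C]. *)
Lemma ac_lip (R : realType) (V : normedModType R) a b (z : R -> V) C :
  0 <= C -> abs_continuous a b z ->
  {ae (@lebesgue_measure R), forall t, a <= t <= b -> exists2 v, hder z t v & `|v| <= C} ->
  lip C a b z.
Proof.
move=> C0 zc zd r s ar rs sb.
have h : lip C r s (fun t => C * t : R^o).
  by move=> u v _ uv _; rewrite -mulrBr ger0_norm// mulr_ge0// subr_ge0.
have -> : C * (s - r) = C * s - C * r by rewrite mulrBr.
apply: (ac_dominated normr_seminorm rs (beta := fun t => C * t : R^o)).
- exact: abs_continuousW zc.
- exact: lip_abs_continuous h.
- apply: aeS zd => t h1 /andP[rt ts].
  have [|v zv vC] := h1; first by rewrite (le_trans ar rt) (le_trans ts sb).
  exists v, C; split => //.
  move=> e e0; exists 1 => // u _.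
  have -> : C * u - C * t - (u - t) *: (C : R^o) = 0.
    by rewrite [(u - t) *: _]mulrC mulrBr subrr.
  by rewrite normr0 mulr_ge0// ltW.
Qed.

(** Without an exceptional set no continuity hypothesis is needed: around each tag the slope is at
    most [C + e], and these local estimates add up by [cousin]. *)
Lemma hder_lip (R : realType) (V : normedModType R) (z : R -> V) (a b C : R) :
  (forall t, a <= t -> t <= b -> exists2 v, hder z t v & `|v| <= C) ->
  lip C a b z.
Proof.
move=> zd r s ar rs sb; apply/ler_addgt0Pr => e e0.
have e1 : 0 < e / (s - r + 1) by rewrite divr_gt0//; lra.
suff : `|z s - z r| <= (C + e / (s - r + 1)) * (s - r).
  move=> h; apply: (le_trans h); rewrite mulrDl lerD2l.
  by rewrite -mulrA ler_piMr ?ltW// mulrC ltr_pdivrMr; lra.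
move: (e / _) e1 => {e0}e e0.
apply: (@cousin R (fun r s => `|z s - z r| <= (C + e) * (s - r))) => //.
  move=> u v w _ uv vw _ h1 h2.
  have -> : z w - z u = (z w - z v) + (z v - z u) by rewrite addrA subrK.
  by apply: (le_trans (ler_normD _ _)); lra.
move=> t rt ts; have [||v zv vC] := zd t; [lra|lra|].
have [d d0 D] := zv e e0; exists d => // u w ru ut tw ws wu.
have h1 := D u; have h2 := D w.
have {h1} h1 : `|z u - z t - (u - t) *: v| <= e * (t - u).
  by move: h1; rewrite ler0_norm ?subr_le0// opprB; apply; lra.
have {h2} h2 : `|z w - z t - (w - t) *: v| <= e * (w - t).
  by move: h2; rewrite ger0_norm ?subr_ge0//; apply; lra.
have -> : z w - z u = (z w - z t - (w - t) *: v)
   + (- (z u - z t - (u - t) *: v) + (w - u) *: v) by lmod R.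
rewrite (le_trans (ler_normD _ _))//.
have := ler_normD (- (z u - z t - (u - t) *: v)) ((w - u) *: v).
rewrite normrN normrZ ger0_norm; last by rewrite subr_ge0; lra.
have : (w - u) * `|v| <= (w - u) * C by rewrite ler_wpM2l// subr_ge0; lra.
lra.
Qed.

(** * Compactness and norms in finite dimension *)

Section compactness.
Context {R : realType}.

Lemma lipschitz_continuous (V W : normedModType R) (C : R) (F : V -> W) :
  0 <= C -> (forall x y, `|F x - F y| <= C * `|x - y|) -> continuous F.
Proof.
move=> C0 FC x; have C1 : 0 < C + 1 by lra.
apply/cvgrPdist_le => e e0; apply/nbhs_ballP.
exists (e / (C + 1)); first exact: divr_gt0.
move=> y; rewrite -ball_normE/= ltr_pdivlMr// => h; apply: (le_trans (FC _ _)).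
have := normr_ge0 (x - y); nra.
Qed.

Lemma mx_coord_le (n m : nat) (x : 'M[R]_(n, m)) i j : `|x i j| <= `|x|.
Proof.
rewrite -[leRHS]/(mx_norm x) mx_normrE.
exact: (@le_bigmax _ _ _ 0 (fun ij : 'I_n * 'I_m => `|x ij.1 ij.2|) (i, j)).
Qed.

Lemma mx_norm_le (n m : nat) (x : 'M[R]_(n, m)) r :
  0 <= r -> (forall i j, `|x i j| <= r) -> `|x| <= r.
Proof.
move=> r0 H; rewrite -[leLHS]/(mx_norm x) mx_normrE.
by apply/bigmax_leP; split => // -[i j] _ /=.
Qed.

Lemma norm_trmx_le (n m : nat) (x : 'M[R]_(n, m)) : `|x^T| <= `|x|.
Proof. by apply: mx_norm_le => // i j; rewrite mxE mx_coord_le. Qed.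

Lemma cV_ball_compact (d : nat) (r : R) : compact [set x : 'cV[R]_d | `|x| <= r].
Proof.
have -> : [set x : 'cV[R]_d | `|x| <= r] =
    trmx @` [set v : 'rV[R]_d | `|v| <= r].
  apply/seteqP; split => [x /= xr|_ [v /= vr <-]].
    by exists x^T; rewrite ?trmxK//= (le_trans (norm_trmx_le _)).
  exact: (le_trans (norm_trmx_le _)).
apply: continuous_compact.
  apply: continuous_subspaceT; apply: (@lipschitz_continuous _ _ 1) => // x y.
  by rewrite mul1r -linearB/= norm_trmx_le.
apply: bounded_closed_compact.
  by exists r; split => //; [exact: num_real|move=> y ry v /= /le_trans; apply; exact: ltW].
have -> : [set v : 'rV[R]_d | `|v| <= r] = (fun v : 'rV[R]_d => `|v|) @^-1` [set y | y <= r] by [].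
apply: closed_comp => [x _|]; [exact: norm_continuous|exact: closed_le].
Qed.

Lemma continuous_bounded (T : topologicalType) (W : normedModType R) (F : T -> W)
    (K : set T) : compact K -> continuous F ->
  exists2 M, 0 <= M & forall x, K x -> `|F x| <= M.
Proof.
move=> cK cF; have cFK : compact (F @` K).
  by apply: continuous_compact => //; exact: continuous_subspaceT.
have [M [Mreal H]] := compact_bounded cFK.
exists (Num.max (M + 1) 0); first by rewrite le_max lexx orbT.
move=> x Kx; rewrite le_max (H (M + 1)) ?ltrDl//.
Qed.

(** The Heine-Borel property together with a finite spanning family whose coordinates are controlled
    by the norm. Being stable under products, it also serves spaces such as that of the pairs
    [(y, eta)], which are not matrix spaces. *)
Definition proper_space (V : normedModType R) : Prop :=
  (forall r, compact [set x : V | `|x| <= r]) /\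
  exists (k : nat) (b : 'I_k -> V) (c : 'I_k -> V -> R),
    (forall v, v = \sum_i c i v *: b i) /\ forall i v, `|c i v| <= `|v|.

Lemma proper_cV d : proper_space 'cV[R]_d.
Proof.
split; first exact: cV_ball_compact.
exists d, (fun i => delta_mx i 0), (fun i (v : 'cV[R]_d) => v i 0); split.
- move=> v; rewrite {1}(matrix_sum_delta v); apply: eq_bigr => i _.
  by rewrite big_ord1.
- move=> i v; exact: mx_coord_le.
Qed.

Lemma proper_prod (V W : normedModType R) :
  proper_space V -> proper_space W -> proper_space (V * W)%type.
Proof.
move=> [cV [k [b [c [bE bC]]]]] [cW [k' [b' [c' [bE' bC']]]]]; split.
  move=> r; have -> : [set x : V * W | `|x| <= r] =
    [set x : V | `|x| <= r] `*` [set x : W | `|x| <= r].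
    apply/seteqP; split => -[x y] /=; rewrite prod_normE/= ge_max.
      by move=> /andP[].
    by move=> [-> ->].
  exact: compact_setX.
exists (k + k')%N,
  (fun i => match fintype.split i with inl j => (b j, 0) | inr j => (0, b' j) end),
  (fun i v => match fintype.split i with inl j => c j v.1 | inr j => c' j v.2 end).
split.
- move=> [v w]; rewrite big_split_ord/=.
  under eq_bigr do rewrite (unsplitK (inl _)).
  under [X in _ + X]eq_bigr do rewrite (unsplitK (inr _)).
  rewrite {1}(bE v) {1}(bE' w).
  have E1 : \sum_(i < k) c i v *: (b i, 0 : W) = (\sum_(i < k) c i v *: b i, 0).
    elim/big_ind2 : _ => // [x1 x2 y1 y2 -> ->|i _].
      by congr pair; rewrite /= addr0.
    by congr pair; rewrite /= scaler0.
  have E2 : \sum_(i < k') c' i w *: (0 : V, b' i) = (0, \sum_(i < k') c' i w *: b' i).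
    elim/big_ind2 : _ => // [x1 x2 y1 y2 -> ->|i _].
      by congr pair; rewrite /= addr0.
    by congr pair; rewrite /= scaler0.
  by rewrite E1 E2; congr pair; rewrite /= ?addr0 ?add0r.
- move=> i [v w]; rewrite prod_normE/= le_max.
  by case: fintype.split => j; rewrite ?bC// bC' orbT.
Qed.

Lemma Ck1_continuous (V W : normedModType R) (F : V -> W) : Ck 1 F -> continuous F.
Proof. by move=> [dF _] x; exact: differentiable_continuous. Qed.

(** [Ck 1] only provides continuity of each directional derivative. Bounding those along the
    spanning family bounds the differential on the ball, and the ball is convex, so the mean value
    inequality applies on segments. *)
Lemma Ck1_lip (V W : normedModType R) (F : V -> W) (r : R) :
  proper_space V -> Ck 1 F ->
  exists2 L, 0 <= L & forall x y, `|x| <= r -> `|y| <= r ->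
    `|F y - F x| <= L * `|y - x|.
Proof.
move=> [cV [k [b [c [bE bC]]]]] [dF cF].
have bnd i := continuous_bounded (cV r) (cF (b i)).
have /boolp.choice[M HM] i : exists m, 0 <= m /\
    forall x, `|x| <= r -> `|'d F x (b i)| <= m.
  by have [m m0 H] := bnd i; exists m.
have key u w : `|u| <= r -> `|'d F u w| <= (\sum_i M i) * `|w|.
  move=> ur; rewrite {1}(bE w) linear_sum/= mulr_suml.
  rewrite (le_trans (ler_norm_sum _ _ _))//.
  apply: ler_sum => i _; rewrite linearZ normrZ mulrC.
  by have [_ h] := HM i; apply: ler_pM => //; exact: h.
exists (\sum_i M i); first by apply: sumr_ge0 => i _; have [] := HM i.
move=> x y xr yr.
pose z s := F (x + s *: (y - x)).
have -> : F y - F x = z 1 - z 0.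
  by rewrite /z scale1r scale0r addr0 (addrC x) subrK.
rewrite -[leRHS]mulr1 -[X in _ * X]subr0.
apply: (@hder_lip R W z 0 1) => // t t0 t1.
exists ('d F (x + t *: (y - x)) (y - x)).
  apply: (@hder_comp R V W F (fun s => x + s *: (y - x))) => //.
  rewrite -[X in hder _ _ X]add0r; apply: hderD; first exact: hder_cst.
  exact: hder_scale.
have ball_t : `|x + t *: (y - x)| <= r.
  have -> : x + t *: (y - x) = (1 - t) *: x + t *: y by lmod R.
  rewrite (le_trans (ler_normD _ _))// !normrZ !ger0_norm//; last lra.
  have : (1 - t) * `|x| <= (1 - t) * r by rewrite ler_wpM2l//; lra.
  have : t * `|y| <= t * r by rewrite ler_wpM2l//; lra.
  lra.
exact: key.
Qed.

Lemma Ck2_Ck1 (V W : normedModType R) (F : V -> W) : Ck 2 F -> Ck 1 F.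
Proof.
by move=> [dF ddF]; split => // v; exact: Ck1_continuous (ddF v).
Qed.

End compactness.

Section norms.
Context {R : realType}.

Lemma is_norm_ge0 (d : nat) (N : 'cV[R]_d -> R) x : is_norm N -> 0 <= N x.
Proof.
move=> [_ NZ ND]; have := ND x (- x).
have N0 : N 0 = 0 by rewrite -(scale0r x) NZ normr0 mul0r.
have -> : N (- x) = N x by rewrite -scaleN1r NZ normrN normr1 mul1r.
rewrite subrr N0; lra.
Qed.

Lemma is_norm_seminorm (d : nat) (N : 'cV[R]_d -> R) : is_norm N ->
  exists C, seminorm N C.
Proof.
move=> /[dup] nN [_ NZ ND]; exists (\sum_i N (delta_mx i 0)).
split => //; first by apply: sumr_ge0 => i _; exact: is_norm_ge0.
move=> x; rewrite {1}(matrix_sum_delta x).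
have -> : \sum_(i < d) \sum_(j < 1) x i j *: delta_mx i j =
    \sum_(i < d) x i 0 *: delta_mx i 0.
  by apply: eq_bigr => i _; rewrite big_ord1.
have N0 : N 0 = 0 by rewrite -(scale0r x) NZ normr0 mul0r.
apply: (@le_trans _ _ (\sum_(i < d) N (x i 0 *: delta_mx i 0))).
  elim/big_ind2 : _ => //; first by rewrite N0.
  by move=> x1 x2 y1 y2 h1 h2; rewrite (le_trans (ND _ _))// lerD.
rewrite mulr_suml; apply: ler_sum => i _; rewrite NZ mulrC ler_wpM2l//.
  exact: is_norm_ge0.
exact: mx_coord_le.
Qed.

Lemma seminorm_sub (V : normedModType R) (N : V -> R) C : seminorm N C ->
  forall x y, `|N x - N y| <= C * `|x - y|.
Proof.
move=> [C0 ND NZ NC] x y.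
have h1 := ND (x - y) y; have h2 := ND (y - x) x.
rewrite subrK in h1; rewrite subrK in h2.
rewrite ler_norml; have := NC (x - y); have := NC (y - x).
rewrite (distrC y x); lra.
Qed.

Lemma seminorm_continuous (V : normedModType R) (N : V -> R) C :
  seminorm N C -> continuous N.
Proof.
by move=> sN; have [C0 _ _ _] := sN; apply: (lipschitz_continuous C0); exact: seminorm_sub.
Qed.

(** The minimum of [N] on the unit sphere of the sup norm is positive by definiteness; homogeneity
    does the rest. *)
Lemma is_norm_bound (d : nat) (N : 'cV[R]_d -> R) : is_norm N ->
  exists2 c, 0 < c & forall x, `|x| <= c * N x.
Proof.
move=> nN; have [N0 NZ ND] := nN.
have [C sN] := is_norm_seminorm nN.
pose S := [set x : 'cV[R]_d | `|x| = 1].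
(* The sphere is empty in dimension zero, where every vector vanishes and any constant works. *)
have [S0|S0] := pselect (S !=set0); last first.
  exists 1 => // x; have [->|x0] := eqVneq x 0.
    by rewrite normr0 mul1r is_norm_ge0.
  case: S0; exists (`|x|^-1 *: x); rewrite /S/= normrZ normfV normr_id mulVf//.
  by rewrite normr_eq0.
have cS : compact S.
  apply: (@subclosed_compact _ S [set x : 'cV[R]_d | `|x| <= 1]).
  - have -> : S = (fun x : 'cV[R]_d => `|x|) @^-1` [set 1] by [].
    apply: closed_comp => [x _|]; [exact: norm_continuous|exact: closed_eq].
  - exact: cV_ball_compact.
  - by move=> x /= ->.
have [x0 Sx0 x0min] := compact_EVT_min S0 cS
  (continuous_subspaceT (seminorm_continuous sN)).
have Nx0 : 0 < N x0.
  rewrite lt_neqAle is_norm_ge0// andbT eq_sym; apply/eqP => /N0 x00.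
  by move: Sx0; rewrite inE /S/= x00 normr0 => /esym/eqP; rewrite oner_eq0.
exists (N x0)^-1; first by rewrite invr_gt0.
move=> x; rewrite mulrC ler_pdivlMr//.
have [->|xn0] := eqVneq x 0; first by rewrite normr0 mul0r is_norm_ge0.
have xp : 0 < `|x| by rewrite normr_gt0.
have : N x0 <= N (`|x|^-1 *: x).
  by apply: x0min; rewrite inE /S/= normrZ normfV normr_id mulVf// gt_eqF.
by rewrite NZ normfV normr_id mulrC ler_pdivlMr// mulrC.
Qed.

End norms.

(** * Caratheodory solutions with bounded right-hand side *)

Section ode.
Context {R : realType} {V : normedModType R}.
Local Notation mu := (@lebesgue_measure R).
Implicit Types (F : R -> V -> V) (z w : R -> V).

(** The null set of times is chosen before [x], so that it can be used along a whole trajectory. *)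
Definition field_bounded F a b : Prop :=
  forall r, exists2 C, 0 <= C & {ae mu, forall t, a <= t <= b ->
    forall x, `|x| <= r -> `|F t x| <= C}.

Definition field_lip F a b : Prop :=
  forall r, exists2 L, 0 <= L & {ae mu, forall t, a <= t <= b ->
    forall x y, `|x| <= r -> `|y| <= r -> `|F t x - F t y| <= L * `|x - y|}.

(** The working notion of solution: the initial value is kept apart, and absolute continuity is
    strengthened to a Lipschitz bound, which costs nothing when the field is bounded on bounded
    sets. *)
Definition lip_solution F a b z : Prop :=
  (exists2 L, 0 <= L & lip L a b z) /\
  {ae mu, forall t, a <= t <= b -> hder z t (F t (z t))}.

(** An absolutely continuous curve on a compact interval is bounded, so its derivative is
    essentially bounded, and [ac_lip] gives the Lipschitz constant. *)
Lemma caratheodory_lip_solution F t0 v0 I z a b : a <= b ->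
  `[a, b]%classic `<=` I -> field_bounded F a b ->
  caratheodory F t0 v0 I z -> lip_solution F a b z.
Proof.
move=> ab abI bF [_ _ zc zd].
have zac := zc _ _ abI.
have [M zM] := abs_continuous_bounded ab zac.
have [C C0 FC] := bF M.
have zd' : {ae mu, forall t, a <= t <= b -> hder z t (F t (z t))}.
  apply: aeS zd => t H tab; apply/is_derive_hder; apply: H.
  by apply: abI; rewrite /= in_itv.
split => //; exists C => //; apply: ac_lip => //.
apply: aeS (aeI zd' FC) => t [zt Ft] tab; exists (F t (z t)); first exact: zt.
by apply: Ft => //; move/andP: tab => [? ?]; exact: zM.
Qed.

Lemma lip_solution_caratheodory F a b z : a <= b ->
  lip_solution F a b z -> caratheodory F a (z a) `[a, b] z.
Proof.
move=> ab [[L L0 zL] zd]; split => //.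
- by rewrite /= in_itv/= lexx ab.
- move=> a' b' sub; have [ab'|ba'] := leP a' b'; last first.
    move=> e e0; exists 1 => // n p q pq _ _.
    rewrite big1// => i _; have [h1 h2 h3] := pq i; lra.
  have := sub a'; rewrite /= !in_itv/= lexx ab' => /(_ isT)/andP[h1 _].
  have := sub b'; rewrite /= !in_itv/= lexx ab' => /(_ isT)/andP[_ h2].
  by apply: (@lip_abs_continuous _ _ L) => //; exact: lipW zL.
- apply: aeS zd => t H; rewrite /= in_itv/= => tab.
  by apply/is_derive_hder; exact: H.
Qed.

Lemma lip_solutionW F a b a' b' z : a <= a' -> b' <= b ->
  lip_solution F a b z -> lip_solution F a' b' z.
Proof.
move=> aa bb [[L L0 zL] zd]; split; first by exists L => //; exact: lipW zL.
apply: aeS zd => t H /andP[h1 h2]; apply: H.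
by rewrite (le_trans aa)// (le_trans h2).
Qed.

(** Changing a curve outside [[a, b]] may destroy its two-sided derivative at [a] and [b]; these two
    points form a null set. *)
Lemma lip_solution_eq F G a b z w :
  (forall t, a <= t -> t <= b -> z t = w t) ->
  {ae mu, forall t, a <= t <= b -> F t = G t} ->
  lip_solution F a b z -> lip_solution G a b w.
Proof.
move=> zw FG [[L L0 zL] zd]; split; first by exists L => //; exact: lip_eq zL.
apply: aeS (aeI (aeI zd FG) (aeI (ae_neq a) (ae_neq b))).
move=> t [[zt Ft] [ta tb]] /andP[h1 h2].
have at_ : a < t by rewrite lt_neqAle eq_sym ta.
have tb_ : t < b by rewrite lt_neqAle tb.
rewrite -Ft ?h1// -zw//; apply: (hder_eq at_ tb_); last by apply: zt; rewrite h1.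
by move=> s /ltW ? /ltW ?; exact: zw.
Qed.

Lemma lip_solution_glue F a b c z : a <= b -> b <= c ->
  lip_solution F a b z -> lip_solution F b c z -> lip_solution F a c z.
Proof.
move=> ab bc [[L L0 zL] zd] [[K K0 zK] zd']; split.
  exists (Num.max L K); first by rewrite le_max L0.
  apply: (@lip_glue _ _ _ _ b).
    by apply: lip_le zL; rewrite le_max lexx.
  by apply: lip_le zK; rewrite le_max lexx orbT.
apply: aeS (aeI zd zd') => t [H H'] /andP[h1 h2].
by have [tb|/ltW bt] := leP t b; [apply: H; rewrite h1|apply: H'; rewrite bt].
Qed.

Lemma lip_bounded L a b z : 0 <= L -> lip L a b z ->
  forall t, a <= t -> t <= b -> `|z t| <= `|z a| + L * (b - a).
Proof.
move=> L0 zL t at_ tb; rewrite -[z t](subrK (z a)) addrC.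
rewrite (le_trans (ler_normD _ _))// lerD2l (le_trans (zL _ _ (lexx _) at_ tb))//.
by rewrite ler_wpM2l// lerB.
Qed.

(** In place of Gronwall's inequality: on a short interval starting at a zero of the difference [d],
    the supremum of [|d|] is at most half of itself, hence zero. [cousin] chains the short
    intervals. *)
Lemma lip_solution_unique F a b z w : field_lip F a b ->
  lip_solution F a b z -> lip_solution F a b w -> z a = w a ->
  forall t, a <= t -> t <= b -> z t = w t.
Proof.
move=> lF [[L L0 zL] zd] [[K K0 wK] wd] zwa t at_ tb.
pose r := Num.max (`|z a| + L * (b - a)) (`|w a| + K * (b - a)).
have [C C0 FC] := lF r.
have zr s : a <= s -> s <= b -> `|z s| <= r.
  by move=> h1 h2; rewrite le_max (lip_bounded L0 zL).
have wr s : a <= s -> s <= b -> `|w s| <= r.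
  by move=> h1 h2; rewrite le_max (lip_bounded K0 wK)// orbT.
pose d s := z s - w s.
have dL : lip (L + K) a b d.
  move=> u v h1 h2 h3; rewrite /d.
  have -> : z v - w v - (z u - w u) = (z v - z u) + - (w v - w u) by lmod R.
  rewrite (le_trans (ler_normD _ _))// normrN mulrDl lerD//; [exact: zL|exact: wK].
have dd : {ae mu, forall s, a <= s <= b ->
    exists2 v, hder d s v & `|v| <= C * `|d s| }.
  apply: aeS (aeI (aeI zd wd) FC) => s [[zs ws] H] sab.
  exists (F s (z s) - F s (w s)); last first.
    by move/andP: (sab) => [h1 h2]; apply: H => //; [exact: zr|exact: wr].
  have := hderD (zs sab) (hderZ (-1) (ws sab)).
  rewrite scaleN1r; congr hder; apply/funext => x.
  by rewrite scaleN1r.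
suff step u v : a <= u -> u <= v -> v <= b -> d u = 0 ->
    forall s, u <= s -> s <= v -> d s = 0.
  have da : d a = 0 by rewrite /d zwa subrr.
  by apply/eqP; rewrite -subr_eq0; apply/eqP;
     apply: (step a b) => //; exact: (le_trans at_).
move=> au uv vb.
have C1 : 0 < C + 1 by lra.
apply: (@cousin R (fun u v => d u = 0 -> forall s, u <= s -> s <= v -> d s = 0)) => //.
  move=> x y s _ xy ys _ H1 H2 dx q xq qs; have [qy|/ltW yq] := leP q y; first exact: H1.
  by apply: H2 => //; apply: H1.
(* With this length, the Lipschitz constant [C * sup S] of [d] moves it by at most [sup S / 2]. *)
move=> x ux xv; exists (2 * (C + 1))^-1; first by rewrite invr_gt0 mulr_gt0.
move=> p q up px xq qv pq dp.
pose S := [set `|d s| | s in `[p, q]%classic].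
have pq' : p <= q by exact: le_trans xq.
have Sp : S `|d p| by exists p => //=; rewrite in_itv/= lexx pq'.
have hS : has_sup S.
  split; first by exists `|d p|.
  exists (`|d p| + (L + K) * (q - p)) => _ [s /= + <-]; rewrite in_itv/= => /andP[h1 h2].
  apply: (lip_bounded _ _ h1 h2); first lra.
  by apply: lipW dL; lra.
have sup_ge s : p <= s -> s <= q -> `|d s| <= sup S.
  by move=> h1 h2; apply: sup_upper_bound => //; exists s => //=; rewrite in_itv/= h1.
have sup0 : 0 <= sup S by apply: le_trans (sup_ge p (lexx _) pq').
have dl : lip (C * sup S) p q d.
  apply: ac_lip; first by rewrite mulr_ge0.
    apply: (@lip_abs_continuous _ _ (L + K)); first lra.
    by apply: lipW dL; lra.
  apply: aeS dd => s H /andP[h1 h2]; have [|y dy yC] := H; first by apply/andP; split; lra.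
  by exists y => //; rewrite (le_trans yC)// ler_wpM2l// sup_ge.
have : sup S <= sup S / 2.
  apply: sup_le_ub; first by case: hS.
  move=> _ [s /= + <-]; rewrite in_itv/= => /andP[h1 h2].
  have := dl p s (lexx _) h1 h2; rewrite dp subr0 => /le_trans; apply.
  have : (s - p) * (2 * (C + 1)) <= 1.
    rewrite -ler_pdivlMr ?mulr_gt0// div1r; lra.
  have : 0 <= s - p by lra.
  nra.
move=> hs s h1 h2; apply/eqP; rewrite -normr_le0.
by rewrite (le_trans (sup_ge s h1 h2))//; lra.
Qed.

End ode.

(** * Arzela-Ascoli for equi-Lipschitz curves *)

Lemma prod_nbhs (I : eqType) (T : topologicalType) (t : I)
    (z : prod_topology (fun _ : I => T)) (B : set T) : nbhs (z t) B ->
  nbhs z [set f : prod_topology (fun _ : I => T) | B (f t)].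
Proof. exact: (@proj_continuous I (fun=> T) t z). Qed.

(** Tychonoff's theorem gives a cluster point for pointwise convergence, and the common Lipschitz
    constant upgrades closeness on a finite grid to uniform closeness. No subsequence is extracted:
    the limit is approached for arbitrarily large indices, which is all that is used later. *)
Lemma ascoli_lip (R : realType) (V : normedModType R) (L M a b : R)
    (Z : nat -> R -> V) : proper_space V -> a <= b -> 0 <= L ->
  (forall k, lip L a b (Z k)) ->
  (forall k t, a <= t -> t <= b -> `|Z k t| <= M) ->
  exists z : R -> V, lip L a b z /\ forall e, 0 < e -> forall K, exists2 k,
    (K <= k)%N & forall t, a <= t -> t <= b -> `|Z k t - z t| <= e.
Proof.
move=> [cV _] ab L0 ZL ZM.
(* Freezing the curves outside [[a, b]] bounds them at every time, as the product of compact balls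
   requires. *)
pose cl t := Num.max a (Num.min b t).
have clE t : a <= t -> t <= b -> cl t = t.
  by move=> h1 h2; rewrite /cl (min_idPr h2) (max_idPr h1).
have cla t : a <= cl t by rewrite le_max lexx.
have clb t : cl t <= b by rewrite ge_max ab ge_min lexx.
pose Y : nat -> prod_topology (fun _ : R => V) := fun k t => Z k (cl t).
have cP : @compact (prod_topology (fun _ : R => V))
    [set f | forall t : R, [set x : V | `|x| <= M] (f t)].
  by apply: (@tychonoff _ _ (fun=> [set x : V | `|x| <= M])) => t; exact: cV.
have FP : (Y @ \oo) [set f | forall t : R, [set x : V | `|x| <= M] (f t)].
  by exists 0%N => // k _ /= t; apply: ZM.
have [z [zM clz]] := cP _ _ FP.
have fin n (t : 'I_n -> R) K e : 0 < e ->
    exists2 k, (K <= k)%N & forall i, `|Z k (cl (t i)) - z (t i)| < e.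
  move=> e0.
  have FK : (Y @ \oo) [set f | exists2 k, (K <= k)%N & f = Y k].
    by exists K => // k /= Kk; exists k.
  have Nz : nbhs (z : prod_topology (fun _ : R => V))
      [set f : prod_topology (fun _ : R => V) | forall i, `|f (t i) - z (t i)| < e].
    pose P i := [set f : prod_topology (fun _ : R => V) | ball (z (t i)) e (f (t i))].
    have -> : [set f : prod_topology (fun _ : R => V) |
        forall i, `|f (t i) - z (t i)| < e] = [set f | forall i, P i f].
      by apply/seteqP; split => f /= H i; have := H i;
        rewrite /P/= -ball_normE/= distrC.
    have H := @filter_forall _ _ P _ (@nbhs_filter (prod_topology (fun _ : R => V)) z).
    by apply: H => i; apply: prod_nbhs; exact: nbhsx_ballx.
  have [f [[k Kk ->] H]] := clz _ _ FK Nz.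
  by exists k.
have zL : lip L a b z.
  move=> r s ar rs sb; apply/ler_addgt0Pr => e e0.
  have e2 : 0 < e / 2 by rewrite divr_gt0.
  have [k _ H] := fin 2%N (fun i => if i == ord0 then r else s) 0%N _ e2.
  have := H ord0; rewrite eqxx clE//; last exact: (le_trans rs).
  have := H (lift ord0 ord0); rewrite /= clE//; last exact: (le_trans ar).
  have := ZL k r s ar rs sb.
  have -> : z s - z r = (Z k s - Z k r) + (- (Z k s - z s) + (Z k r - z r)) by lmod R.
  move=> h1 h2 h3; rewrite (le_trans (ler_normD _ _))// lerD//.
  by rewrite (le_trans (ler_normD _ _))// normrN; lra.
exists z; split => // e e0 K.
(* The mesh makes [L * d <= e / 4]. The curve, its limit and their gap at the nearest grid point on
   the left then contribute at most [e / 4] each. *)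
have [d d0 dE] : exists2 d, 0 < d & d * (4 * (L + 1)) = e.
  exists (e / (4 * (L + 1))); first by rewrite divr_gt0// mulr_gt0//; lra.
  by rewrite divfK// mulf_neq0//; lra.
pose n := Num.bound ((b - a) / d).
have nd : (b - a) / d < n%:R by apply: archi_boundP; rewrite divr_ge0 ?subr_ge0// ltW.
pose g (i : 'I_n) := a + d * i%:R.
have e4 : 0 < e / 4 by rewrite divr_gt0.
have [k Kk H] := fin _ g K _ e4.
exists k => // t at_ tb.
have [i [ga gt td]] : exists i : 'I_n, [/\ a <= g i, g i <= t & t - g i <= d].
  have td0 : 0 <= (t - a) / d by rewrite divr_ge0 ?subr_ge0// ltW.
  have /andP[h1 h2] := truncn_itv td0.
  have h3 : (Num.truncn ((t - a) / d) < n)%N.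
    rewrite -(ltr_nat R); apply: (le_lt_trans h1); apply: le_lt_trans nd.
    by rewrite ler_pM2r ?invr_gt0// lerB.
  exists (Ordinal h3); rewrite /g/=.
  move: h1 h2; rewrite ler_pdivlMr// ltr_pdivrMr// -[(Num.truncn _).+1%:R]natr1.
  move=> h1 h2; split; [|lra|lra].
  by rewrite lerDl mulr_ge0// ltW.
have := H i; rewrite clE//; last exact: (le_trans gt).
have -> : Z k t - z t = (Z k t - Z k (g i)) + ((Z k (g i) - z (g i)) + - (z t - z (g i))) by lmod R.
have h1 := ZL k _ _ ga gt tb; have h2 := zL _ _ ga gt tb.
have h3 : L * (t - g i) <= e / 4.
  by rewrite -dE; nra.
move=> h4; rewrite (le_trans (ler_normD _ _))//.
have := ler_normD (Z k (g i) - z (g i)) (- (z t - z (g i))); rewrite normrN; lra.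
Qed.

(** * Almost everywhere differentiability and primitives *)

Section clip.
Context {R : realType}.

Definition clip (a b t : R) : R := Num.max a (Num.min b t).

Lemma clipE a b t : a <= t -> t <= b -> clip a b t = t.
Proof. by move=> h1 h2; rewrite /clip (min_idPr h2) (max_idPr h1). Qed.

Lemma clip_ge a b t : a <= clip a b t.
Proof. by rewrite le_max lexx. Qed.

Lemma clip_le a b t : a <= b -> clip a b t <= b.
Proof. by move=> ab; rewrite ge_max ab ge_min lexx. Qed.

Lemma clip_nd a b s t : a <= b -> s <= t ->
  clip a b s <= clip a b t <= clip a b s + (t - s).
Proof.
move=> ab st; rewrite /clip.
by case: (leP b s) => h1; case: (leP b t) => h2; case: (leP a b) => h3;
   case: (leP a s) => h4; case: (leP a t) => h5; apply/andP; split; lra.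
Qed.

End clip.

Section lipschitz_derivative.
Context {R : realType}.
Local Notation mu := (@lebesgue_measure R).

(** A cover by half-open intervals has [F]-length at most [L] times its Lebesgue length. Comparing
    the two outer measures shows that Lebesgue null sets are null for [F]. *)
Lemma lebesgue_stieltjes_dominated (F : cumulative R R) (L : R) : 0 <= L ->
  (forall s t, s <= t -> F t - F s <= L * (t - s)) ->
  forall A, mu A = 0 -> lebesgue_stieltjes_measure F A = 0.
Proof.
move=> L0 FL A A0.
apply/eqP; rewrite eq_le; apply/andP; split; last exact: mu_ext_ge0.
apply/lee_addgt0Pr => e e0; rewrite add0e.
have d0 : 0 < e / (L + 1) by rewrite divr_gt0//; lra.
have muAE : mu A = ereal_inf [set (\sum_(k <oo) wlength idfun (C k))%E |
   C in @measurable_cover _ (ocitv_type R) A] by [].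
have : (mu A < (e / (L + 1))%:E)%E by rewrite A0 lte_fin.
rewrite {}muAE.
move=> /ereal_inf_lt[_ /= [C [mC CA] <-] Clt].
apply: (@le_trans _ _ (\sum_(k <oo) wlength F (C k))%E).
  have -> : lebesgue_stieltjes_measure F A =
      ereal_inf [set (\sum_(k <oo) wlength F (C k))%E |
        C in @measurable_cover _ (ocitv_type R) A] by [].
  set S := (X in ereal_inf X).
  have SC : S (\sum_(k <oo) wlength F (C k))%E by exists C.
  exact: (ereal_inf_lbound SC).
apply: (@le_trans _ _ (\sum_(k <oo) (L%:E * wlength idfun (C k)))%E).
  apply: lee_nneseries => [k _ _|k _]; first exact: wlength_ge0.
  have [[x y] _ <-] := mC k.
  rewrite !wlength_itv/= lte_fin; case: ltP => xy; last by rewrite mule0.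
  by rewrite -EFinM lee_fin FL// ltW.
rewrite nneseriesZl; last by move=> k _; exact: wlength_ge0.
apply: (@le_trans _ _ (L%:E * (e / (L + 1))%:E)%E).
  by rewrite lee_wpmul2l ?lee_fin// ltW.
rewrite -EFinM lee_fin mulrCA ler_piMr ?ltW// ltr_pdivrMr//; lra.
Qed.

Lemma monotone_lipschitz_derivative (F : R -> R) (L a b : R) : 0 <= L -> a < b ->
  (forall s t, s <= t -> 0 <= F t - F s <= L * (t - s)) ->
  exists2 v : R -> R, measurable_fun setT v &
    {ae mu, forall t, a <= t <= b -> hder (F : R -> R^o) t (v t)}.
Proof.
move=> L0 ab FL.
have Fnd : nondecreasing F.
  by move=> s t st; have /andP[+ _] := FL s t st; rewrite subr_ge0.
have Fc : continuous F.
  apply: (@lipschitz_continuous R R^o R^o L) => // s t.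
  wlog st : s t / s <= t.
    move=> H; case: (leP s t) => [|/ltW] st; first exact: H.
    by rewrite distrC (distrC s); apply: H.
  have /andP[h1 h2] := FL s t st.
  by rewrite distrC (distrC s) !ger0_norm// subr_ge0.
pose Fcum : cumulative R R := HB.pack F
  (isCumulative.Build R _ R F Fnd (right_continuousW Fc)).
pose nu : {measure set (measurableTypeR R) -> \bar R} :=
  lebesgue_stieltjes_measure Fcum.
have nuE x : a <= x -> nu `]a, x]%classic = (F x - F a)%:E.
  move=> ax; have E := @measurable_mu_extE _ _ _ (wlength Fcum) `]a, x]%classic
    (is_ocitv a x).
  by transitivity (wlength F `]a, x]%classic); [exact: E|exact: wlength_itv_bnd].
have nuab : (nu `]a, b]%classic < +oo)%E by rewrite nuE ?ltry// ltW.
have mD : measurable (`]a, b]%classic : set (measurableTypeR R)) by [].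
(* Restricting to []a, b]] makes the measure finite, so that its density is integrable on the whole
   line. *)
pose nuD : {finite_measure set (measurableTypeR R) -> \bar R} :=
  mfrestr mD nuab.
have dom : nuD `<< mu.
  move=> N N0 A mA AN; apply: (@lebesgue_stieltjes_dominated _ L) => //.
    by move=> s t st; have /andP[_] := FL s t st.
  by apply: N0; [exact: measurableI|move=> x [/AN]].
have [w [w0 wfin wint wE]] := radon_nikodym_sigma_finite dom.
have wEF : EFin \o (fine \o w) = w by apply/funext => x /=; rewrite fineK.
have FE x : a <= x -> x <= b ->
    F x = F a + (\int[mu]_(t in `]a, x]) (fine \o w) t)%R.
  move=> ax xb; apply/eqP; rewrite addrC -subr_eq; apply/eqP.
  apply: EFin_inj; rewrite -nuE// /Rintegral.
  have -> : (\int[mu]_(t in `]a, x]) ((fine \o w) t)%:E = nu `]a, x]%classic)%E.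
    transitivity (\int[mu]_(t in `]a, x]) w t)%E.
      by apply: eq_integral => t _; rewrite /= fineK.
    rewrite -wE// /nuD /= /mfrestr /mrestr; congr (nu _).
    apply/seteqP; split => t /=; rewrite !in_itv/=; first by move=> [].
    by move=> /andP[-> h]; rewrite h (le_trans h).
  by rewrite nuE.
have wint' : mu.-integrable setT (EFin \o (fine \o w)) by rewrite wEF.
have wloc : locally_integrable setT (fine \o w).
  by apply: open_integrable_locally => //; exact: openT.
have intw y : mu.-integrable [set` Interval (BRight a) (BRight y)] (EFin \o (fine \o w)).
  exact: (integrableS measurableT).
exists (fine \o w).
  by have /measurable_int/measurable_EFinP := wint'.
have := @FTC1 R (fine \o w) (BRight a) intw wloc.
move=> FT; apply: aeS (aeI FT (aeI (ae_neq a) (ae_neq b))).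
move=> x [H [xa xb]] /andP[ax xb'].
have {}ax : a < x by rewrite lt_neqAle eq_sym xa.
have {}xb : x < b by rewrite lt_neqAle xb.
have [|dG GE] := H; first by rewrite lte_fin.
pose G x := (\int[mu]_(t in `]a, x]) (fine \o w) t)%R.
have hG : hder (G : R -> R^o) x ((fine \o w) x).
  by apply/is_derive_hder; split => //; rewrite -derive1E.
have := hderD (hder_cst (F a : R^o) x) hG; rewrite add0r.
apply: (hder_eq ax xb) => s /ltW as_ /ltW sb.
by rewrite [RHS]FE.
Qed.

(* z + L t is monotone on [a, b]: its Lebesgue-Stieltjes measure has a
   Radon-Nikodym density, and the Lebesgue differentiation theorem applies. *)
Lemma lip_derivative (z : R -> R^o) (L a b : R) : 0 <= L -> a < b -> lip L a b z ->
  exists2 v : R -> R, measurable_fun setT v &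
    {ae mu, forall t, a <= t <= b -> hder z t (v t)}.
Proof.
move=> L0 ab zL; have ab' := ltW ab.
(* Clipping extends the curve by constants, so that [F] is monotone and [2 * L]-Lipschitz on the
   whole line, as a cumulative function must be defined there. The term [L * t] is subtracted from
   the derivative at the end. *)
pose F x := z (clip a b x) + L * clip a b x.
have [||s t st|w mw wF] := @monotone_lipschitz_derivative F (2 * L) a b.
- by rewrite mulr_ge0.
- by [].
- have /andP[h1 h2] := clip_nd ab' st.
  have := zL _ _ (clip_ge a b s) h1 (clip_le t ab').
  rewrite ler_norml /F => /andP[h3 h4].
  have : L * (clip a b t - clip a b s) <= L * (t - s) by rewrite ler_wpM2l//; lra.
  by move=> h5; apply/andP; split; lra.
exists (fun t => w t - L); first exact: measurable_funB.
apply: aeS (aeI wF (aeI (ae_neq a) (ae_neq b))).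
move=> x [H [xa xb]] axb; have Hx := H axb.
move/andP: axb => [ax xb'].
have {}ax : a < x by rewrite lt_neqAle eq_sym xa.
have {}xb : x < b by rewrite lt_neqAle xb.
have := hderD Hx (hder_scale (- L : R^o) x).
apply: (hder_eq ax xb) => s /ltW as_ /ltW sb.
rewrite /F clipE// [s *: _]mulrN; lra.
Qed.

End lipschitz_derivative.

Section primitive.
Context {R : realType}.
Local Notation mu := (@lebesgue_measure R).

(** Truncating [v] at height [M] changes it on a null set only, and makes the bound hold everywhere.
    Extended by zero, the truncation is integrable on the line and its indefinite integral is the
    primitive. *)
Lemma primitive_bounded (v : R -> R) (M a b : R) : a < b -> 0 <= M ->
  measurable_fun `[a, b] v -> {ae mu, forall t, a <= t <= b -> `|v t| <= M} ->
  exists P : R -> R^o, [/\ P a = 0, lip M a b P,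
    {ae mu, forall t, a <= t <= b -> hder P t (v t)} &
    (\int[mu]_(t in `[a, b]) (v t)%:E = (P b)%:E)%E].
Proof.
move=> ab M0 mv vM.
pose c t := Num.max (- M) (Num.min M (v t)).
have mc : measurable_fun `[a, b] c.
  by apply: measurable_maxr => //; apply: measurable_minr.
have cM t : `|c t| <= M.
  by rewrite ler_norml /c le_max lexx/= ge_max ge_min lexx/= andbT; lra.
have mab : measurable (`[a, b]%classic : set (measurableTypeR R)) by [].
pose w := c \_ `[a, b].
have wM t : `|w t| <= M.
  by rewrite /w patchE; case: ifP => _ //; rewrite normr0.
have ci : mu.-integrable `[a, b] (EFin \o c).
  apply: measurable_bounded_integrable => //.
    have : (mu `[a, b] < +oo)%E by rewrite lebesgue_measure_itv/= lte_fin ab ltry.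
    exact.
  by exists M; split => [|y My t _]; rewrite ?num_real//= (le_trans (cM t))// ltW.
have wi : mu.-integrable setT (EFin \o w).
  have := (@integrable_restrict _ _ _ mu `[a, b] mab setT measurableT (EFin \o c)).1.
  by rewrite setTI restrict_EFin; exact.
have wloc : locally_integrable setT w.
  by apply: open_integrable_locally => //; exact: openT.
have wiS (D : set R) : measurable D -> mu.-integrable D (EFin \o w).
  by move=> mD; exact: (integrableS measurableT).
have vw : {ae mu, forall t, a <= t <= b -> w t = v t}.
  apply: aeS vM => t H tab; rewrite /w patchE mem_set ?in_itv//.
  have := H tab; rewrite ler_norml => /andP[h1 h2].
  by rewrite /c (min_idPr h2) (max_idPr h1).
pose P x : R^o := (\int[mu]_(t in `]a, x]) w t)%R.
exists P; split.
- by rewrite /P set_itv_ge ?Rintegral_set0// bnd_simp ltxx.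
- move=> r s ar rs sb; rewrite /P.
  rewrite Rintegral_itvB//; last by exact: wiS.
  have mrs : measurable (`]r, s]%classic : set (measurableTypeR R)) by [].
  rewrite (le_trans (le_normr_Rintegral mrs (wiS _ mrs)))//.
  apply: (@le_trans _ _ (\int[mu]_(t in `]r, s]) cst M t)%R).
    apply: le_Rintegral => //.
      by have := integrable_norm (wiS _ mrs).
    apply: measurable_bounded_integrable => //.
      have : (mu `]r, s] < +oo)%E.
        by rewrite lebesgue_measure_itv/=; case: ifP; rewrite ltry.
      exact.
    by exists M; split => [|y My t _]; rewrite ?num_real//= ger0_norm// ltW.
  have muE : mu `]r, s] = (s - r)%:E.
    rewrite lebesgue_measure_itv/= lte_fin -EFinB; case: ltP => // sr.
    by congr EFin; lra.
  by rewrite Rintegral_cst// [X in fine X]muE.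
- have FT := @FTC1 R w (BRight a) (fun y => wiS _ (measurable_itv _)) wloc.
  apply: aeS (aeI (aeI FT vw) (ae_neq a)) => x [[H wv] xa] xab.
  have xa' : a < x by rewrite lt_neqAle eq_sym xa; case/andP: xab.
  have [|dG GE] := H; first by rewrite lte_fin.
  by apply/is_derive_hder; split => //; rewrite -derive1E [LHS]GE wv.
- transitivity (\int[mu]_(t in `[a, b]) (w t)%:E)%E.
    apply: ae_eq_integral => //.
    + exact/measurable_EFinP.
    + by have /measurable_int := wiS _ mab.
    + by apply: aeS vw => t H /=; rewrite in_itv/= => tab; rewrite H.
  rewrite -integral_itv_obnd_cbnd; last first.
    have mrs : measurable (`]a, b]%classic : set (measurableTypeR R)) by [].
    by have /measurable_int := wiS _ mrs.
  rewrite /P /Rintegral fineK//; apply: integrable_fin_num => //.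
  exact: wiS.
Qed.

End primitive.

(** * Measurability, blow-up of the barrier and essential bounds *)

Section measurability.
Context {R : realType}.
Local Notation mu := (@lebesgue_measure R).

(** Measurability is known coordinate by coordinate. The open set where [F] exceeds [c] is a
    countable union of boxes with rational centre and radius, whose preimages involve one coordinate
    at a time. *)
Lemma measurable_continuous_comp (d : nat) (F : 'cV[R]_d -> R) (D : set R)
    (u : R -> 'cV[R]_d) : measurable (D : set (measurableTypeR R)) ->
  continuous F -> (forall i, measurable_fun D (fun t => u t i 0)) ->
  measurable_fun D (fun t => F (u t)).
Proof.
move=> mD cF mu_.
apply: (measurability _ (RGenOInfty.measurableE R)) => // _ [_ [c ->] <-].
pose box (q : {ffun 'I_d -> rat}) (r : rat) : set 'cV[R]_d :=
  [set x | forall i, `|x i 0 - ratr (q i)| < ratr r].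
(* Only boxes contained in the superlevel set count; the preimage of a box is written as the
   complement of finitely many coordinate conditions. *)
pose E (qr : {ffun 'I_d -> rat} * rat) : set R :=
  if `[< forall x, box qr.1 qr.2 x -> c < F x >]
  then D `\` \bigcup_i (D `&` [set t | ratr qr.2 <= `|u t i 0 - ratr (qr.1 i)|])
  else set0.
have -> : D `&` (fun t => F (u t)) @^-1` `]c, +oo[%classic = \bigcup_qr E qr.
  apply/seteqP; split.
  - move=> t /= [Dt]; rewrite in_itv/= andbT => ct.
    have : nbhs (u t) [set x | c < F x].
      have := cF (u t); move/cvgrPdist_lt => /(_ (F (u t) - c)).
      rewrite subr_gt0 => /(_ ct); apply: filterS => x /=.
      by rewrite ltr_norml => /andP[_]; lra.
    move=> /nbhs_ballP[e /= e0 eF].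
    have e2 : 0 < e / 2 by rewrite divr_gt0.
    have [r /andP[r0 re]] : exists r : rat, 0 < (ratr r : R) < e / 2.
      by have [r h] := rat_in_itvoo e2; exists r; move: h; rewrite in_itv.
    have qP i : exists q : rat, `|u t i 0 - ratr q| < ratr r.
      have lt_u : u t i 0 - ratr r < u t i 0 + ratr r by lra.
      have [q] := rat_in_itvoo lt_u; rewrite in_itv/= => /andP[h1 h2].
      by exists q; rewrite ltr_norml; apply/andP; split; lra.
    have [q qE] := boolp.choice qP.
    exists ([ffun i => q i], r) => //; rewrite /E /=.
    case: asboolP => [_|]; last first.
      case=> x bx; apply: eF; rewrite -ball_normE/=.
      apply: (@le_lt_trans _ _ (2 * ratr r)); last lra.
      apply: mx_norm_le => [|i j]; first by rewrite mulr_ge0// ltW.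
      rewrite !mxE ord1.
      have := bx i; rewrite ffunE => h1; have h2 := qE i.
      have -> : u t i 0 - x i 0 = (u t i 0 - ratr (q i)) - (x i 0 - ratr (q i)) by lra.
      by rewrite (le_trans (ler_normB _ _))//; lra.
    split => //; move=> [i _ [_ /=]]; rewrite ffunE leNgt => /negP; apply; exact: qE.
  - move=> t [[q r] _]; rewrite /E /=; case: asboolP => // H [Dt nt]; split => //=.
    rewrite in_itv/= andbT; apply: H => i; rewrite ltNge; apply/negP => h.
    by apply: nt; exists i.
apply: countable_bigcupT_measurable; first exact: countableP.
move=> -[q r]; rewrite /E/=; case: ifP => _ //.
apply: measurableD => //; apply: fin_bigcup_measurable; first exact: finite_finset.
move=> i _.
have : measurable_fun D (fun t => `|u t i 0 - ratr (q i)|).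
  by apply: measurableT_comp => //; exact: measurable_funB.
move=> /(_ mD `[ratr r, +oo[%classic (measurable_itv _)).
congr (_ _); apply/seteqP; split => t /=; rewrite in_itv/= andbT//.
Qed.

Lemma lip_clip_continuous (V : normedModType R) (L a b : R) (z : R -> V) :
  0 <= L -> a <= b -> lip L a b z -> continuous (fun t : R => z (clip a b t)).
Proof.
move=> L0 ab zL; apply: (@lipschitz_continuous R R^o V L) => // s t.
wlog st : s t / t <= s.
  move=> H; case: (leP t s) => [|/ltW] st; first exact: H.
  by rewrite distrC (distrC s); apply: H.
have /andP[h1 h2] := clip_nd ab st.
rewrite (le_trans (zL _ _ (clip_ge _ _ _) h1 (clip_le _ ab)))//.
by rewrite ler_wpM2l// [leRHS]ger0_norm; lra.
Qed.

Lemma measurable_clip (a b : R) (k : R -> R) : a <= b ->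
  continuous (fun t : R => k (clip a b t)) -> measurable_fun `[a, b] k.
Proof.
move=> ab ck; have mk : measurable_fun setT (fun t : R => k (clip a b t)).
  exact: continuous_measurable_fun.
apply: (@eq_measurable_fun _ _ _ _ _ (fun t : R => k (clip a b t))).
  by move=> t; rewrite inE/= in_itv/= => /andP[h1 h2]; rewrite clipE.
exact: (measurable_funS measurableT).
Qed.

Lemma measurable_lip (V : normedModType R) (L a b : R) (z : R -> V) (F : V -> R) :
  0 <= L -> a <= b -> lip L a b z -> continuous F ->
  measurable_fun `[a, b] (fun t => F (z t)).
Proof.
move=> L0 ab zL cF; apply: measurable_clip => // t.
have cz := lip_clip_continuous L0 ab zL (x := t).
exact: (@continuous_comp _ _ _ (fun t : R => z (clip a b t)) F t cz (cF _)).
Qed.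

Lemma ae_exists (P : R -> Prop) (a b : R) : a < b ->
  {ae mu, forall t, P t} -> exists t, [/\ a < t, t < b & P t].
Proof.
move=> ab [A [mA A0 PA]]; apply: contrapT => H.
have : `]a, b[%classic `<=` A.
  move=> t /=; rewrite in_itv/= => /andP[h1 h2]; apply: PA => Pt.
  by apply: H; exists t.
move=> /(@subset_measure0 _ _ _ mu _ _ (measurable_itv _) mA) /(_ A0).
have muE : mu `]a, b[ = (b - a)%:E by rewrite lebesgue_measure_itv/= lte_fin ab EFinB.
by rewrite [X in X = _]muE => -[] /eqP; rewrite subr_eq0 gt_eqF.
Qed.

(** Every point is a limit of points of the full-measure set, which needs [a < b]; the Lipschitz
    bound carries the estimate over. *)
Lemma ae_le_lip (V : normedModType R) (N : V -> R) (C L a b c : R) (z : R -> V) :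
  seminorm N C -> 0 <= L -> a < b -> lip L a b z ->
  {ae mu, forall t, a <= t <= b -> N (z t) <= c} ->
  forall t, a <= t -> t <= b -> N (z t) <= c.
Proof.
move=> sN L0 ab zL zc t at_ tb; apply/ler_addgt0Pr => e e0.
have [C0 ND NZ NC] := sN.
have LC : 0 < C * L + 1 by have := mulr_ge0 C0 L0; lra.
pose d := e / (C * L + 1); have d0 : 0 < d by rewrite divr_gt0.
have [s [h1 h2 Ns]] : exists s, [/\ Num.max a (t - d) < s, s < Num.min b (t + d) &
    a <= s <= b -> N (z s) <= c].
  apply: ae_exists zc; rewrite gt_max !lt_min; apply/andP; split; apply/andP; split; lra.
move: h1 h2; rewrite gt_max lt_min => /andP[as_ ts] /andP[sb st].
have {}Ns : N (z s) <= c by apply: Ns; rewrite !ltW.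
have zst : `|z t - z s| <= L * d.
  case: (leP s t) => [|/ltW] hst.
    rewrite (le_trans (zL _ _ (ltW as_) hst tb))// ler_wpM2l//; lra.
  rewrite distrC (le_trans (zL _ _ at_ hst (ltW sb)))// ler_wpM2l//; lra.
have := seminorm_sub sN (z t) (z s); rewrite ler_norml => /andP[_ h].
have : C * `|z t - z s| <= C * (L * d) by rewrite ler_wpM2l.
have : C * L * d <= e by rewrite /d mulrCA ler_piMr ?ltW// ltr_pdivrMr//; lra.
lra.
Qed.

End measurability.

Section blowup.
Context {R : realType}.
Local Notation mu := (@lebesgue_measure R).

(* On each half [[r, (r+s)/2[] of [[r, s[] the integrand contributes a fixed
   positive amount. *)
Lemma integral_blowup (g : R -> \bar R) (K a s : R) : 0 < K -> a < s ->
  measurable_fun `[a, s[ g -> (forall t, a <= t -> t < s -> (0 <= g t)%E) ->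
  (forall t, a <= t -> t < s -> (((K * (s - t))^-1 - 1)%:E <= g t)%E) ->
  (\int[mu]_(t in `[a, s[) g t = +oo)%E.
Proof.
move=> K0 as_ mg g0 gK.
(* The term [s - r] pays for the [-1] of the integrand. Each step of the induction gains
   [(2 * K)^-1] on [[r, m[] and restarts from the midpoint [m]. *)
have lower k r : a <= r -> r < s ->
    ((k%:R * (2 * K)^-1 - (s - r))%:E <= \int[mu]_(t in `[r, s[) g t)%E.
  elim: k r => [|k IH] r ar rs.
    apply: (@le_trans _ _ 0%E); first by rewrite mul0r lee_fin; lra.
    apply: integral_ge0 => t /=; rewrite in_itv/= => /andP[h1 h2]; apply: g0 => //.
    exact: (le_trans ar).
  pose m := (r + s) / 2.
  have rm : r < m by rewrite /m; lra.
  have ms : m < s by rewrite /m; lra.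
  have -> : `[r, s[%classic = `[r, m[%classic `|` `[m, s[%classic.
    apply/seteqP; split => t /=; rewrite !in_itv/=.
      by case: (ltP t m) => tm /andP[h1 h2]; [left|right]; lra.
    by move=> [] /andP[h1 h2]; lra.
  have sub1 : `[r, m[ `<=` `[a, s[%classic.
    by move=> t /=; rewrite !in_itv/=; lra.
  have sub2 : `[m, s[ `<=` `[a, s[%classic.
    by move=> t /=; rewrite !in_itv/=; lra.
  rewrite ge0_integral_setU//=; last 3 first.
  - apply: measurable_funS mg => //; rewrite subUset; split => //.
  - by move=> t [/sub1|/sub2] /=; rewrite in_itv/= => /andP[h1 h2]; exact: g0.
  - apply/disj_set2P; rewrite -subset0 => t [] /=; rewrite !in_itv/=; lra.
  apply: (@le_trans _ _ (((2 * K)^-1 - (m - r))%:E + (k%:R * (2 * K)^-1 - (s - m))%:E)%E).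
    by rewrite -EFinD lee_fin -natr1 mulrDl mul1r; lra.
  apply: leeD; last by apply: IH => //; lra.
  have mrm : measurable (`[r, m[%classic : set (measurableTypeR R)) by [].
  (* On this half the integrand is at least its lower bound at [r]. The maximum with [0] keeps the
     constant integrand nonnegative when that bound is negative. *)
  apply: (@le_trans _ _ (\int[mu]_(t in `[r, m[) (Num.max 0 ((K * (s - r))^-1 - 1))%:E)%E).
    rewrite integral_cst//.
    have muE : (mu `[r, m[ = (m - r)%:E)%E.
      by rewrite lebesgue_measure_itv/= lte_fin rm EFinB.
    rewrite [X in (_ * X)%E]muE -EFinM lee_fin.
    apply: (@le_trans _ _ (((K * (s - r))^-1 - 1) * (m - r))); last first.
      by rewrite ler_wpM2r ?le_max ?lexx ?orbT//; lra.
    have -> : m - r = (s - r) / 2 by rewrite /m; lra.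
    suff -> : ((K * (s - r))^-1 - 1) * ((s - r) / 2) = (2 * K)^-1 - (s - r) / 2.
      by [].
    by field; apply/andP; split; lra.
  apply: ge0_le_integral => //.
  - by move=> t _; rewrite lee_fin le_max lexx.
  - by apply: measurable_funS mg.
  - move=> t /=; rewrite in_itv/= => /andP[h1 h2].
    have at_ : a <= t by lra.
    have ts : t < s by lra.
    rewrite EFin_max ge_max g0//= (le_trans _ (gK _ at_ ts))// lee_fin lerD2r.
    by rewrite lef_pV2 ?posrE ?mulr_gt0 ?subr_gt0// ler_pM2l//; lra.
apply/eqyP => A A0.
have K2 : 0 < 2 * K by rewrite mulr_gt0.
pose k := Num.bound ((A + (s - a)) * (2 * K)).
have kA : (A + (s - a)) * (2 * K) < k%:R.
  by apply: archi_boundP; rewrite mulr_ge0//; lra.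
apply: le_trans (lower k a (lexx _) as_); rewrite lee_fin.
by move: kA; rewrite -ltr_pdivlMr//; lra.
Qed.

End blowup.

Section escape.
Context {R : realType}.
Local Notation mu := (@lebesgue_measure R).

(** If [s] is the first time with [w >= 1], then [1 - w^2 <= 2 * (1 - w) <= 2 * L * (s - t)] before
    [s], and the barrier is not integrable up to [s]. The lower bound on [G] is required only where
    [w < 1], so [G] may be the positive part of a cost, or a lower limit of barriers whose value at
    contact is unknown. *)
Lemma funnel_escape (w : R -> R^o) (G : R -> \bar R) (L a b : R) : 0 <= L -> a <= b ->
  lip L a b w -> (forall t, a <= t -> t <= b -> 0 <= w t) -> w a < 1 ->
  measurable_fun `[a, b] G -> (forall t, a <= t -> t <= b -> (0 <= G t)%E) ->
  (forall t, a <= t -> t <= b -> w t < 1 ->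
     (((1 - w t ^+ 2)^-1 - 1)%:E <= G t)%E) ->
  (\int[mu]_(t in `[a, b]) G t < +oo)%E ->
  forall t, a <= t -> t <= b -> w t < 1.
Proof.
move=> L0 ab wL w0 wa mG G0 Gw Gfin t at_ tb; rewrite ltNge; apply/negP => wt.
pose S := [set x | [/\ a <= x, x <= b & 1 <= w x] ].
have St : S t by [].
have hS : has_inf S by split; [exists t|exists a => x []].
pose s := inf S.
have as_ : a <= s by apply: lb_le_inf; [exists t|move=> x []].
have st : s <= t by apply: inf_lbound => //; case: hS.
have sb : s <= b by exact: le_trans tb.
have ws : 1 <= w s.
  apply/ler_addgt0Pr => e e0; have L1 : 0 < L + 1 by lra.
  have [x [ax xb wx] xs] := inf_adherent (divr_gt0 e0 L1) hS.
  have sx : s <= x by apply: inf_lbound; [case: hS|].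
  have := wL s x as_ sx xb; rewrite ler_norml => /andP[_ h].
  have : L * (x - s) <= e.
    have : (x - s) * (L + 1) <= e by rewrite -ler_pdivlMr//; rewrite -/s in xs; lra.
    have : 0 <= x - s by lra.
    nra.
  lra.
have {}as_ : a < s by rewrite lt_neqAle as_ andbT; apply/eqP => E; move: ws; rewrite -E; lra.
have wlt x : a <= x -> x < s -> w x < 1.
  move=> ax xs; rewrite ltNge; apply/negP => wx.
  suff : s <= x by lra.
  by apply: inf_lbound; [case: hS|split => //; lra].
have : (\int[mu]_(t in `[a, s[) G t = +oo)%E.
  (* The [+ 1] keeps the constant positive when [L = 0]. *)
  apply: (@integral_blowup R G (2 * L + 1)) => //.
  - by lra.
  - by apply: measurable_funS mG => // x /=; rewrite !in_itv/=; lra.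
  - by move=> x ax xs; apply: G0; lra.
  - move=> x ax xs; have xb : x <= b by lra.
    have wx := wlt x ax xs; have wx0 := w0 x ax xb.
    apply: le_trans (Gw x ax xb wx); rewrite lee_fin lerD2r.
    have := wL x s ax (ltW xs) sb; rewrite ler_norml => /andP[_ h].
    have p1 : 0 < 1 - w x ^+ 2 by nra.
    have p2 : 0 < (2 * L + 1) * (s - x) by rewrite mulr_gt0//; lra.
    rewrite lef_pV2 ?posrE//; nra.
move=> E.
have : (\int[mu]_(t in `[a, s[) G t <= \int[mu]_(t in `[a, b]) G t)%E.
  apply: ge0_subset_integral => //.
  - by move=> x /=; rewrite in_itv/= => /andP[h1 h2]; exact: G0.
  - by move=> x /=; rewrite !in_itv/=; lra.
by rewrite E leye_eq => /eqP E'; rewrite E' ltxx in Gfin.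
Qed.

End escape.

Section inputs.
Context {R : realType}.
Local Notation mu := (@lebesgue_measure R).

(** The function whose essential supremum is taken vanishes outside [I], whence the condition
    [0 <= M]. *)
Lemma normoo_leP (W : Type) (N : W -> R) (I : set R) (w : R -> W) (M : R) : 0 <= M ->
  (normoo N I w <= M%:E)%E <-> {ae mu, forall t, I t -> N (w t) <= M}.
Proof.
move=> M0; split.
- move/ess_supP; apply: aeS => t; rewrite patchE => H It.
  by move: H; rewrite mem_set// lee_fin.
- move=> H; apply/ess_supP; apply: aeS H => t H; rewrite patchE.
  by case: ifP => [/set_mem It|_]; rewrite lee_fin//; exact: H.
Qed.

Lemma normoo_lty (W : Type) (N : W -> R) (I : set R) (w : R -> W) :
  (normoo N I w < +oo)%E -> exists2 M, 0 <= M & (normoo N I w <= M%:E)%E.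
Proof.
case: (normoo N I w) => [r _| |_] //; last by exists 0; rewrite ?leNye.
by exists `|r| => //; rewrite lee_fin ler_norm.
Qed.

Lemma mulmx_norm_le (n k p : nat) (A : 'M[R]_(n, k)) (B : 'M[R]_(k, p)) :
  `|A *m B| <= k%:R * `|A| * `|B|.
Proof.
apply: mx_norm_le => [|i j]; first by rewrite !mulr_ge0.
rewrite mxE (le_trans (ler_norm_sum _ _ _))//.
apply: (@le_trans _ _ (\sum_(l < k) `|A| * `|B|)).
  by apply: ler_sum => l _; rewrite normrM ler_pM// mx_coord_le.
by rewrite sumr_const card_ord -[leLHS]mulr_natl mulrA.
Qed.

Lemma control_field_regular (n m : nat) (f : 'cV[R]_n -> 'cV[R]_n)
    (g : 'cV[R]_n -> 'M[R]_(n, m)) (u : R -> 'cV[R]_m) (C a b : R) :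
  Ck 1 f -> Ck 1 g -> 0 <= C -> {ae mu, forall t, a <= t <= b -> `|u t| <= C} ->
  field_bounded (fun t x => f x + g x *m u t) a b /\
  field_lip (fun t x => f x + g x *m u t) a b.
Proof.
move=> fC gC C0 uC; have pV := @proper_cV R n; have [cV _] := pV.
split => r.
  have [F F0 fF] := continuous_bounded (cV r) (Ck1_continuous fC).
  have [G G0 gG] := continuous_bounded (cV r) (Ck1_continuous gC).
  exists (F + m%:R * G * C); first by rewrite addr_ge0// !mulr_ge0.
  apply: aeS uC => t ut tab x xr; rewrite (le_trans (ler_normD _ _))// lerD//; first exact: fF.
  rewrite (le_trans (mulmx_norm_le _ _))// ler_pM ?mulr_ge0//; last exact: ut.
  by rewrite ler_wpM2l//; exact: gG.
have [F F0 fF] := Ck1_lip r pV fC.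
have [G G0 gG] := Ck1_lip r pV gC.
exists (F + m%:R * G * C); first by rewrite addr_ge0// !mulr_ge0.
apply: aeS uC => t ut tab x y xr yr.
have -> : f x + g x *m u t - (f y + g y *m u t) =
    (f x - f y) + (g x *m u t - g y *m u t) by lmod R.
rewrite -mulmxBl.
rewrite (le_trans (ler_normD _ _))// mulrDl lerD//; first exact: fF.
rewrite (le_trans (mulmx_norm_le _ _))//.
apply: (@le_trans _ _ (m%:R * (G * `|x - y|) * C)).
  rewrite ler_pM ?mulr_ge0//; last exact: ut.
  by rewrite ler_wpM2l//; exact: gG.
by rewrite le_eqVlt; apply/orP; left; apply/eqP; ring.
Qed.

End inputs.

(** * The Byrnes-Isidori form *)

Section matrix_continuity.
Context {R : realType} {T : topologicalType}.

Lemma continuous_bigsum (I : Type) (r : seq I) (P : pred I) (F : I -> T -> R) :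
  (forall i, continuous (F i)) -> continuous (fun x => \sum_(i <- r | P i) F i x).
Proof.
move=> cF; elim: r => [|i r IH].
  under [X in continuous X]eq_fun do rewrite big_nil.
  by move=> x; exact: cvg_cst.
under [X in continuous X]eq_fun do rewrite big_cons.
by case: (P i) => // x; apply: (@cvgD _ R^o); [exact: cF|exact: IH].
Qed.

Lemma continuous_bigprod (I : Type) (r : seq I) (P : pred I) (F : I -> T -> R) :
  (forall i, continuous (F i)) -> continuous (fun x => \prod_(i <- r | P i) F i x).
Proof.
move=> cF; elim: r => [|i r IH].
  under [X in continuous X]eq_fun do rewrite big_nil.
  by move=> x; exact: cvg_cst.
under [X in continuous X]eq_fun do rewrite big_cons.
by case: (P i) => // x; apply: cvgM; [exact: cF|exact: IH].
Qed.

Lemma continuous_mx (k l : nat) (F : T -> 'M[R]_(k, l)) :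
  (forall i j, continuous (fun x => F x i j)) -> continuous F.
Proof.
move=> cF x; apply/cvgrPdist_le => e e0.
have H : \forall y \near x, forall ij : 'I_k * 'I_l, `|F x ij.1 ij.2 - F y ij.1 ij.2| <= e.
  apply: filter_forall => -[i j] /=.
  by have := cF i j x; move/cvgrPdist_le; apply.
apply: filterS H => y H; apply: mx_norm_le => [|i j]; first exact: ltW.
by rewrite !mxE; exact: (H (i, j)).
Qed.

Lemma continuous_entry (k l : nat) (F : T -> 'M[R]_(k, l)) i j :
  continuous F -> continuous (fun x => F x i j).
Proof.
move=> cF x; exact: (@continuous_comp _ _ _ F (fun M : 'M[R]_(k, l) => M i j) x
  (cF x) (@coord_continuous R k l i j _)).
Qed.

Lemma continuous_det (k : nat) (F : T -> 'M[R]_k) :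
  continuous F -> continuous (fun x => \det (F x)).
Proof.
move=> cF; rewrite /determinant; apply: continuous_bigsum => s x.
apply: cvgM; first exact: cvg_cst.
by apply: continuous_bigprod => i; exact: continuous_entry.
Qed.

Lemma continuous_mulmx (k l p : nat) (F : T -> 'M[R]_(k, l)) (G : T -> 'M[R]_(l, p)) :
  continuous F -> continuous G -> continuous (fun x => F x *m G x).
Proof.
move=> cF cG; apply: continuous_mx => i j.
under [X in continuous X]eq_fun do rewrite mxE.
by apply: continuous_bigsum => q x; apply: cvgM; exact: continuous_entry.
Qed.

(** By Cramer's rule the entries are cofactors divided by a determinant that never vanishes. *)
Lemma continuous_invmx (k : nat) (F : T -> 'M[R]_k) :
  continuous F -> (forall x, F x \in unitmx) -> continuous (fun x => invmx (F x)).
Proof.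
move=> cF uF; apply: continuous_mx => i j.
have -> : (fun x => invmx (F x) i j) = (fun x => (\det (F x))^-1 * cofactor (F x) j i).
  by apply/funext => x; rewrite /invmx uF !mxE.
move=> x; apply: cvgM.
  apply: cvgV; last exact: continuous_det.
  by have := uF x; rewrite unitmxE unitfE.
rewrite /cofactor; apply: cvgM; first exact: cvg_cst.
apply: (@continuous_det _ (fun x => row' j (col' i (F x)))).
apply: continuous_mx => i' j'.
under [X in continuous X]eq_fun do rewrite !mxE.
exact: continuous_entry.
Qed.

End matrix_continuity.

Section pairs.
Context {R : realType} {V W : normedModType R}.
Implicit Types (y : R -> V) (eta : R -> W).

Lemma fst_norm_le (v : V * W) : `|v.1| <= `|v|.
Proof. by rewrite prod_normE le_max lexx. Qed.

Lemma snd_norm_le (v : V * W) : `|v.2| <= `|v|.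
Proof. by rewrite prod_normE le_max lexx orbT. Qed.

Lemma pair_norm_le (v : V) (w : W) r : `|v| <= r -> `|w| <= r -> `|(v, w)| <= r.
Proof. by move=> vr wr; rewrite prod_normE ge_max vr. Qed.

Lemma hder_snd (z : R -> V * W) t v : hder z t v -> hder (fun s => (z s).2) t v.2.
Proof.
move=> hz e e0; have [d d0 D] := hz e e0; exists d => // s /D.
exact: le_trans (snd_norm_le (z s - z t - (s - t) *: v)).
Qed.

Lemma hder_pair y eta t v w : hder y t v -> hder eta t w ->
  hder (fun s => (y s, eta s)) t (v, w).
Proof.
move=> hy he e e0; have [d d0 D] := hy e e0; have [d' d'0 D'] := he e e0.
exists (Num.min d d'); first by rewrite lt_min d0.
move=> s; rewrite lt_min => /andP[/D h /D' h'].
exact: (pair_norm_le h h').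
Qed.

Lemma lip_fst (L a b : R) (z : R -> V * W) : lip L a b z -> lip L a b (fun s => (z s).1).
Proof.
by move=> zL r s ar rs sb; exact: le_trans (fst_norm_le (z s - z r)) (zL r s ar rs sb).
Qed.

Lemma lip_snd (L a b : R) (z : R -> V * W) : lip L a b z -> lip L a b (fun s => (z s).2).
Proof.
by move=> zL r s ar rs sb; exact: le_trans (snd_norm_le (z s - z r)) (zL r s ar rs sb).
Qed.

Lemma lip_pair (L L' a b : R) y eta : lip L a b y -> lip L' a b eta ->
  lip (Num.max L L') a b (fun s => (y s, eta s)).
Proof.
move=> yL eL r s ar rs sb; apply: (@pair_norm_le (y s - y r) (eta s - eta r)).
  by apply: lip_le yL r s ar rs sb; rewrite le_max lexx.
by apply: lip_le eL r s ar rs sb; rewrite le_max lexx orbT.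
Qed.

End pairs.

Lemma lip_Ck1_comp (R : realType) (V W : normedModType R) (F : V -> W) (L a b : R)
    (z : R -> V) : proper_space V -> Ck 1 F -> 0 <= L -> lip L a b z ->
  exists2 K, 0 <= K & lip K a b (F \o z).
Proof.
move=> pV CF L0 zL.
have [K K0 FK] := Ck1_lip (`|z a| + L * (b - a)) pV CF.
exists (K * L); first by rewrite mulr_ge0.
move=> r s ar rs sb; rewrite -mulrA (le_trans (FK _ _ _ _))//.
- by apply: (lip_bounded L0 zL) => //; exact: (le_trans rs).
- by apply: (lip_bounded L0 zL) => //; exact: (le_trans ar).
- by rewrite ler_wpM2l//; exact: zL.
Qed.

Lemma diff_idE (R : realType) (V : normedModType R) (x w : V) : 'd (@id V) x w = w.
Proof. by rewrite (diff_val (is_diff_def := is_diff_id x)). Qed.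

Section byrnes_isidori_form.
Context {R : realType} {n m : nat}.
Variables (f : 'cV[R]_n -> 'cV[R]_n) (g : 'cV[R]_n -> 'M[R]_(n, m))
  (h : 'cV[R]_n -> 'cV[R]_m) (nrm : forall d, 'cV[R]_d -> R).
Hypothesis nrm_norm : forall d, is_norm (@nrm d).
Arguments nrm : clear implicits.
Arguments nrm_norm : clear implicits.
Variables (Phi : 'cV[R]_n -> 'cV[R]_m * 'cV[R]_(n - m))
  (Psi : 'cV[R]_m * 'cV[R]_(n - m) -> 'cV[R]_n)
  (p : 'cV[R]_m * 'cV[R]_(n - m) -> 'cV[R]_m)
  (q : 'cV[R]_m * 'cV[R]_(n - m) -> 'cV[R]_(n - m)).
Hypothesis bi : byrnes_isidori f g h Phi Psi p q.
Local Notation mu := (@lebesgue_measure R).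

Lemma internal_field_regular (y : R -> 'cV[R]_m) (Y a b : R) :
  (forall t, a <= t -> t <= b -> `|y t| <= Y) ->
  field_bounded (fun t z => q (y t, z)) a b /\ field_lip (fun t z => q (y t, z)) a b.
Proof.
move=> yY; have [_ _ qC _ _] := bi.
have pVW := proper_prod (@proper_cV R m) (@proper_cV R (n - m)); have [cVW _] := pVW.
split => r.
  have [Q Q0 qQ] := continuous_bounded (cVW (Num.max Y r)) (Ck1_continuous qC).
  exists Q => //; apply: aeT => t /andP[at_ tb] z zr; apply: qQ.
  by apply: pair_norm_le; rewrite le_max ?yY// zr orbT.
have [L L0 qL] := Ck1_lip (Num.max Y r) pVW qC.
exists L => //; apply: aeT => t /andP[at_ tb] z z' zr zr'.
rewrite (le_trans (qL _ _ _ _))//.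
- by apply: pair_norm_le; rewrite le_max ?yY// zr' orbT.
- by apply: pair_norm_le; rewrite le_max ?yY// zr orbT.
- rewrite ler_wpM2l//; have -> : (y t, z) - (y t, z') = (0, z - z').
    by congr pair; rewrite /= subrr.
  by rewrite prod_normE/= normr0 ge_max normr_ge0 lexx.
Qed.

(** BIBS speaks of outputs on a half-line and gives an essential bound. The output is extended
    beyond [b] by its last value, and the bound becomes pointwise by continuity of the internal
    state. *)
Lemma bibs_solution (c0 c1 cy a b L : R) (y : R -> 'cV[R]_m) (eta0 : 'cV[R]_(n - m)) :
  (forall (t0 : R) (eta0 : 'cV[R]_(n - m)) (y : R -> 'cV[R]_m),
      0 <= t0 -> Loo_loc (nrm m) t0 y ->
      ((nrm (n - m)%N eta0)%:E + normoo (nrm m) `[t0, +oo[ y <= c0%:E)%E ->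
      exists2 eta : R -> 'cV[R]_(n - m),
        caratheodory (fun t z => q (y t, z)) t0 eta0 `[t0, +oo[ eta
        & (normoo (nrm (n - m)%N) `[t0, +oo[ eta <= c1%:E)%E) ->
  0 <= c1 -> 0 <= a -> a <= b -> 0 <= L -> lip L a b y ->
  (forall t, a <= t -> t <= b -> nrm m (y t) <= cy) ->
  nrm _ eta0 + cy <= c0 ->
  exists eta, [/\ lip_solution (fun t z => q (y t, z)) a b eta, eta a = eta0 &
    forall t, a <= t -> t <= b -> nrm _ (eta t) <= c1].
Proof.
move=> H c10 a0 ab L0 yL ycy etac.
have cy0 : 0 <= cy by apply: le_trans (ycy a (lexx _) ab); exact: is_norm_ge0.
pose ye t := y (clip a b t).
have yeE t : a <= t -> t <= b -> ye t = y t by move=> h1 h2; rewrite /ye clipE.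
have yecy t : nrm m (ye t) <= cy.
  by apply: ycy; [exact: clip_ge|exact: clip_le].
have yec : continuous ye by exact: lip_clip_continuous yL.
have ye_oo I : (normoo (nrm m) I ye <= cy%:E)%E.
  by apply/normoo_leP => //; apply: aeT.
have yeLoo : Loo_loc (nrm m) a ye.
  move=> b'; split; last by apply: le_lt_trans (ye_oo _) _; rewrite ltry.
  move=> i; apply: (measurable_funS measurableT) => //.
  by apply: continuous_measurable_fun; exact: continuous_entry yec.
have [|eta etaS etaoo] := H a eta0 ye a0 yeLoo.
  apply: (@le_trans _ _ ((nrm _ eta0)%:E + cy%:E)%E); last by rewrite -EFinD lee_fin.
  by rewrite leeD2l.
(* One more unit of time: an almost everywhere bound says nothing on the degenerate interval
   [a = b]. *)
have ab1 : a < b + 1 by lra.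
have [Y yY] : exists Y, forall t, a <= t -> t <= b + 1 -> `|ye t| <= Y.
  have [c c_gt0 cN] := is_norm_bound (nrm_norm m).
  by exists (c * cy) => t _ _; rewrite (le_trans (cN _))// ler_pM2l.
have [bF lF] := internal_field_regular yY.
have [etaL etad] : lip_solution (fun t z => q (ye t, z)) a (b + 1) eta.
  apply: (caratheodory_lip_solution (ltW ab1) _ bF etaS).
  by move=> t /=; rewrite !in_itv/= => /andP[-> _].
exists eta; split.
- apply: (@lip_solution_eq _ _ (fun t z => q (ye t, z)) _ _ _ eta) => //.
    apply: aeT => t /andP[h1 h2]; apply/funext => z; by rewrite yeE.
  by apply: (@lip_solutionW _ _ _ a (b + 1)) => //; lra.
- by have [_ ->] := etaS.
- have [K K0 eK] := etaL.
  have [C sN] := is_norm_seminorm (nrm_norm (n - m)).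
  move=> t at_ tb; apply: (ae_le_lip sN K0 ab1 eK _ at_); last lra.
  have /normoo_leP := etaoo; move=> /(_ c10); apply: aeS => s + /andP[as_ _].
  by apply; rewrite /= in_itv/= as_.
Qed.

(** The second component of the pushed-forward field is [q], whatever the input: it sees the
    trajectory only through its output. *)
Lemma internal_solution (u : R -> 'cV[R]_m) (x : R -> 'cV[R]_n) (a b : R) :
  lip_solution (fun t z => f z + g z *m u t) a b x ->
  lip_solution (fun t z => q (h (x t), z)) a b (fun t => (Phi (x t)).2).
Proof.
move=> [[L L0 xL] xd]; have [[PC _ PK _] _ _ Ph PE] := bi.
split.
  have [K K0 PL] := lip_Ck1_comp (@proper_cV R n) PC L0 xL.
  by exists K => //; exact: (lip_snd PL).
apply: aeS xd => t H tab; have {}H := H tab.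
have := hder_snd (hder_comp (PC.1 _) H); congr hder.
have := PE (Phi (x t)).1 (Phi (x t)).2 (u t).
by rewrite -surjective_pairing PK => -> /=; rewrite -Ph -surjective_pairing.
Qed.

Hypothesis rel_deg : forall x, Gamma g h x \in unitmx.

(** The input solving [p + Gamma u = v], under which the output equation reads [y' = v]. *)
Definition tracking_input (y v : R -> 'cV[R]_m) (eta : R -> 'cV[R]_(n - m)) (t : R) :=
  invmx (Gamma g h (Psi (y t, eta t))) *m (v t - p (y t, eta t)).

Lemma tracking_solution (y v : R -> 'cV[R]_m) (eta : R -> 'cV[R]_(n - m)) (a b L : R) :
  0 <= L -> lip L a b y -> {ae mu, forall t, a <= t <= b -> hder y t (v t)} ->
  lip_solution (fun t z => q (y t, z)) a b eta ->
  lip_solution (fun t z => f z + g z *m tracking_input y v eta t) a b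
    (fun t => Psi (y t, eta t)).
Proof.
move=> L0 yL yv [[K K0 eK] ed]; have [[PC QC PK QK] _ _ Ph PE] := bi.
split.
  have pVW := proper_prod (@proper_cV R m) (@proper_cV R (n - m)).
  have M0 : 0 <= Num.max L K by rewrite le_max L0.
  have [M M0' ML] := lip_Ck1_comp pVW QC M0 (lip_pair yL eK).
  by exists M.
apply: aeS (aeI yv ed) => t [Hy He] tab.
have := hder_comp (QC.1 _) (hder_pair (Hy tab) (He tab)); congr hder.
set x := Psi (y t, eta t).
have E := PE (y t) (eta t) (tracking_input y v eta t).
have E2 : p (y t, eta t) + Gamma g h x *m tracking_input y v eta t = v t.
  by rewrite /tracking_input -/x mulKVmx// addrC subrK.
move: E; rewrite -/x E2 => <-.
set w := f x + _.
have dP : differentiable Phi x by exact: PC.1.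
have dQ : differentiable Psi (Phi x) by exact: QC.1.
(* The normal form describes the image of the field under ['d Phi]. Differentiating
   [Psi \o Phi = id] brings it back to the original coordinates. *)
have E3 : 'd (Psi \o Phi) x w = w.
  have -> : Psi \o Phi = id by apply/funext => z /=; rewrite PK.
  exact: diff_idE.
have Px : Phi x = (y t, eta t) by exact: QK.
have D P : Phi x = P -> 'd Psi P ('d Phi x w) = w.
  move=> <-; have := E3; rewrite (diff_comp dP dQ) => {2}<-.
  by [].
exact: D.
Qed.

End byrnes_isidori_form.

Lemma hder_col (R : realType) (k : nat) (z v : R -> 'cV[R]_k) t :
  (forall i, hder (fun s => z s i 0 : R^o) t (v t i 0)) -> hder z t (v t).
Proof.
move=> H e e0.
have H' : \forall s \near t, forall i, `|z s i 0 - z t i 0 - (s - t) * v t i 0| <= e * `|s - t|.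
  apply: (@filter_forall _ _ (fun i => [set s | `|z s i 0 - z t i 0 - (s - t) * v t i 0| <= e * `|s - t|]) _ (nbhs_filter (t : R^o))) => i.
  have [d d0 D] := H i e e0.
  apply/nbhs_ballP; exists d => // s; rewrite /ball/= distrC; exact: D.
move/nbhs_ballP: H' => [d /= d0 D]; exists d => // s.
move=> st; have {}D : forall i : 'I_k, `|z s i 0 - z t i 0 - (s - t) * v t i 0| <= e * `|s - t|.
  by apply: D; rewrite /ball/= distrC.
apply: mx_norm_le => [|i j].
  by rewrite mulr_ge0// ltW.
by rewrite ord1 !mxE; exact: D.
Qed.

Lemma lip_coord (R : realType) (k : nat) (L a b : R) (z : R -> 'cV[R]_k) (i : 'I_k) :
  lip L a b z -> lip L a b (fun t => z t i 0 : R^o).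
Proof.
move=> zL r s ar rs sb; apply: le_trans (zL r s ar rs sb).
by have := mx_coord_le (z s - z r) i 0; rewrite !mxE.
Qed.

Arguments lip_coord {R k L a b z} i _ [r s].

Lemma lip_col_derivative (R : realType) (k : nat) (L a b : R) (z : R -> 'cV[R]_k) :
  0 <= L -> a < b -> lip L a b z ->
  exists v : R -> 'cV[R]_k, (forall i, measurable_fun setT (fun t => v t i 0)) /\
   {ae (@lebesgue_measure R), forall t, a <= t <= b -> hder z t (v t)}.
Proof.
move=> L0 ab zL.
have /boolp.choice[v vP] i : exists v : R -> R, measurable_fun setT v /\
    {ae (@lebesgue_measure R), forall t, a <= t <= b -> hder (fun t => z t i 0 : R^o) t (v t)}.
  by have [v] := lip_derivative L0 ab (lip_coord i zL); exists v.
exists (fun t => \col_i v i t); split.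
  by move=> i; under eq_fun do rewrite mxE; have [] := vP i.
have H : {ae (@lebesgue_measure R), forall t, forall i, a <= t <= b ->
    hder (fun t => z t i 0 : R^o) t (v i t)}.
  apply: (@filter_forall _ _ _ _ (ae_filter_ringOfSetsType (@lebesgue_measure R))) => i.
  by have [] := vP i.
apply: aeS H => t H tab; apply: (@hder_col _ _ _ (fun t => \col_i v i t)) => i.
by rewrite mxE; exact: H.
Qed.

(** * A bounded control that keeps the output in the funnel *)

Section funnel_control.
Context {R : realType} {n m : nat}.
Variables (f : 'cV[R]_n -> 'cV[R]_n) (g : 'cV[R]_n -> 'M[R]_(n, m))
  (h : 'cV[R]_n -> 'cV[R]_m) (nrm : forall d, 'cV[R]_d -> R).
Hypothesis nrm_norm : forall d, is_norm (@nrm d).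
Arguments nrm : clear implicits.
Arguments nrm_norm : clear implicits.
Variables (Phi : 'cV[R]_n -> 'cV[R]_m * 'cV[R]_(n - m))
  (Psi : 'cV[R]_m * 'cV[R]_(n - m) -> 'cV[R]_n)
  (p : 'cV[R]_m * 'cV[R]_(n - m) -> 'cV[R]_m)
  (q : 'cV[R]_m * 'cV[R]_(n - m) -> 'cV[R]_(n - m)).
Hypothesis bi : byrnes_isidori f g h Phi Psi p q.
Hypothesis bibs_q : bibs nrm q.
Hypothesis gC : Ck 1 g.
Hypothesis hC : Ck 2 h.
Hypothesis rel_deg : forall x, Gamma g h x \in unitmx.
Variables (phi : R -> R) (Lphi cphi : R).
Hypothesis Lphi0 : 0 <= Lphi.
Hypothesis cphi0 : 0 < cphi.
Hypothesis phi_ge : forall t, 0 <= t -> cphi <= phi t.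
Hypothesis phi_lip : forall a b, 0 <= a -> lip Lphi a b (phi : R -> R^o).
Variables (yref : R -> 'cV[R]_m) (Lref Yref : R).
Hypothesis Lref0 : 0 <= Lref.
Hypothesis yref_le : forall t, 0 <= t -> nrm m (yref t) <= Yref.
Hypothesis yref_lip : forall a b, 0 <= a -> lip Lref a b yref.
Local Notation mu := (@lebesgue_measure R).
Local Notation err t x := (h x - yref t).
Local Notation dist t x := (phi t * nrm m (err t x)).
Local Notation field u := (fun t x => f x + g x *m u t).

Let ybound := Yref + cphi^-1.

Lemma funnel_output_le t x : 0 <= t -> dist t x < 1 -> nrm m (h x) <= ybound.
Proof.
move=> t0 dx; have [_ _ ND] := nrm_norm m.
rewrite -[h x](subrK (yref t)) addrC (le_trans (ND _ _))// lerD ?yref_le//.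
rewrite -[leRHS]mul1r ler_pdivlMr// mulrC (le_trans _ (ltW dx))//.
by rewrite ler_wpM2r ?phi_ge// is_norm_ge0.
Qed.

Lemma ybound_gt0 : 0 < ybound.
Proof.
rewrite ltr_pwDr ?invr_gt0//.
by apply: le_trans (yref_le (lexx 0)); exact: is_norm_ge0.
Qed.

Lemma Gamma_continuous : continuous (Gamma g h).
Proof.
apply: continuous_mulmx; last exact: Ck1_continuous.
apply: continuous_mx => i j; rewrite /jac.
under [X in continuous X]eq_fun do rewrite mxE.
apply: continuous_entry; have [_ H] := hC; exact: Ck1_continuous (H _).
Qed.

(* The weighted error phi e is frozen at its initial value. *)
Lemma tracking_control (c1 : R) : 0 < c1 -> exists2 M, 0 < M &
  forall (a b : R) (x0 : 'cV[R]_n), 0 <= a -> a < b -> dist a x0 < 1 ->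
    nrm _ (Phi x0).2 <= c1 ->
  exists u x, [/\ lip_solution (field u) a b x, x a = x0,
    forall i, measurable_fun `[a, b] (fun t => u t i 0),
    {ae mu, forall t, a <= t <= b -> nrm m (u t) <= M} &
    forall t, a <= t -> t <= b -> dist t (x t) = dist a x0].
Proof.
move=> c10; have [[PC QC PK QK] pC qC Ph PE] := bi.
have c00 : 0 < c1 + ybound by rewrite addr_gt0// ybound_gt0.
have [c2 c20 H2] := bibs_q c00.
have [km km0 kmN] := is_norm_bound (nrm_norm m).
have [kn kn0 knN] := is_norm_bound (nrm_norm (n - m)).
(* A Lipschitz constant of [y = yref + w0 / phi]: the map [1 / phi] has constant [Lphi / cphi ^+ 2],
   and [|w0| <= km] because [w0] has [nrm]-length less than one. *)
pose Ly := Lref + Lphi / cphi ^+ 2 * km.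
have Ly0 : 0 <= Ly.
  by rewrite addr_ge0// !mulr_ge0 ?invr_ge0 ?exprn_ge0// ltW.
pose rho := Num.max (km * ybound) (kn * c2).
have pVW := proper_prod (@proper_cV R m) (@proper_cV R (n - m)); have [cVW _] := pVW.
have QCc : continuous Psi by exact: Ck1_continuous.
pose IG P := invmx (Gamma g h (Psi P)).
have IGc : continuous IG.
  apply: (@continuous_invmx R _ _ (fun P => Gamma g h (Psi P))) => // P.
  exact: (@continuous_comp _ _ _ Psi (Gamma g h) P (QCc _) (@Gamma_continuous _)).
have pc : continuous p by exact: Ck1_continuous.
have [G G0 GI] := continuous_bounded (cVW rho) IGc.
have [P P0 Pp] := continuous_bounded (cVW rho) pc.
have [C sN] := is_norm_seminorm (nrm_norm m); have [C0 ND NZ NC] := sN.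
(* The input is [Gamma^-1 (v - p)] at points [(y, eta)] of the ball of radius [rho], where [G] and
   [P] bound the inverse and [p], while [Ly] bounds [v]. Nothing here depends on [a], [b] or [x0];
   the [+ 1] gives positivity. *)
exists (C * (m%:R * G * (Ly + P)) + 1).
  by rewrite ltr_pwDr// !mulr_ge0// addr_ge0.
move=> a b x0 a0 ab dx0 ex0.
pose w0 := phi a *: err a x0.
have phia t : a <= t -> 0 < phi t.
  by move=> at_; apply: lt_le_trans cphi0 (phi_ge _); exact: le_trans at_.
have Nw0 : nrm m w0 = dist a x0.
  by rewrite NZ gtr0_norm// phia.
pose y t := yref t + (phi t)^-1 *: w0.
have ya : y a = h x0.
  by rewrite /y /w0 scalerA mulVf ?scale1r ?gt_eqF ?phia// addrC subrK.
have yE t : a <= t -> phi t * nrm m (y t - yref t) = dist a x0.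
  move=> at_; rewrite -Nw0 /y addrAC subrr add0r NZ normfV gtr0_norm ?phia//.
  by rewrite mulrA mulfV ?mul1r// gt_eqF// phia.
have Nw0_le : `|w0| <= km.
  by rewrite (le_trans (kmN _))// ler_piMr ?ltW// Nw0.
have yL : lip Ly a b y.
  move=> r s ar rs sb; have as_ := le_trans ar rs.
  have -> : y s - y r = (yref s - yref r) + ((phi s)^-1 - (phi r)^-1) *: w0.
    by rewrite /y; lmod R.
  rewrite (le_trans (ler_normD _ _))// mulrDl lerD ?(yref_lip _ a0 ar rs sb)//.
    by apply: (@yref_lip a b).
  rewrite normrZ mulrAC ler_pM//.
  have -> : (phi s)^-1 - (phi r)^-1 = (phi r - phi s) / (phi r * phi s).
    by field; rewrite !gt_eqF ?phia.
  rewrite normrM distrC mulrAC ler_pM ?normr_ge0//.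
    exact: (@phi_lip a b).
  rewrite normfV gtr0_norm; last by rewrite mulr_gt0// phia.
  rewrite lef_pV2 ?posrE ?mulr_gt0 ?phia ?exprn_gt0// expr2.
  by apply: ler_pM; rewrite ?(ltW cphi0)// phi_ge// (le_trans a0).
have yN t : a <= t -> t <= b -> nrm m (y t) <= ybound.
  move=> at_ _; rewrite /y (le_trans (ND _ _))// lerD//.
    by rewrite yref_le// (le_trans a0).
  rewrite NZ normfV gtr0_norm ?phia// -[leRHS]mulr1.
  apply: ler_pM; rewrite ?invr_ge0 ?is_norm_ge0 ?Nw0//.
  - by rewrite ltW// phia.
  - by rewrite lef_pV2 ?posrE ?phia// phi_ge// (le_trans a0).
  - exact: ltW.
have ex0c : nrm (n - m)%N (Phi x0).2 + ybound <= c1 + ybound by rewrite lerD2r.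
have [eta [etaS eta_a eta_le]] := bibs_solution nrm_norm bi H2 (ltW c20) a0 (ltW ab) Ly0 yL yN ex0c.
have [v [vm vd]] := lip_col_derivative Ly0 ab yL.
have xS := tracking_solution bi rel_deg Ly0 yL vd etaS.
set u := tracking_input g h Psi p y v eta in xS *.
exists u, (fun t => Psi (y t, eta t)); split => //.
- by rewrite ya eta_a -Ph -surjective_pairing PK.
- move=> i.
  have -> : (fun t => u t i 0) = (fun t => \sum_j
      IG (y t, eta t) i j * (v t j 0 - p (y t, eta t) j 0)).
    apply/funext => t; rewrite /u /tracking_input mxE; apply: eq_bigr => j _.
    by rewrite !mxE.
  have [[K K0 eK] _] := etaS.
  have yeL := lip_pair yL eK.
  have LK0 : 0 <= Num.max Ly K by rewrite le_max Ly0.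
  apply: measurable_sum => j; apply: measurable_funM.
    by apply: (measurable_lip (F := fun P => IG P i j) LK0 (ltW ab) yeL); exact: continuous_entry.
  apply: measurable_funB; first exact: (measurable_funS measurableT).
  by apply: (measurable_lip (F := fun P => p P j 0) LK0 (ltW ab) yeL); exact: continuous_entry.
- apply: aeS (aeI vd (aeI (ae_neq a) (ae_neq b))) => t [dv [ta tb]] /andP[at_ tb'].
  have yt : `|(y t, eta t)| <= rho.
    apply: pair_norm_le; rewrite le_max.
      by rewrite (le_trans (kmN _))// ler_pM2l// yN.
    by rewrite orbC (le_trans (knN _))// ler_pM2l// eta_le.
  have vL : `|v t| <= Ly.
    apply: (hder_bound (@normr_seminorm R _) _ _ yL); last by apply: dv; rewrite at_.
      by rewrite lt_neqAle eq_sym ta.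
    by rewrite lt_neqAle tb.
  apply: (@le_trans _ _ (C * (m%:R * G * (Ly + P)))); last by rewrite lerDl.
  rewrite (le_trans (NC _))// ler_wpM2l// /u /tracking_input.
  rewrite (le_trans (mulmx_norm_le _ _))// ler_pM ?mulr_ge0//.
    by rewrite ler_wpM2l//; exact: GI.
  by rewrite (le_trans (ler_normB _ _))// lerD//; exact: Pp.
- by move=> t at_ tb; rewrite -Ph QK yE.
Qed.

End funnel_control.

(** * The optimal control problem *)

Section curve_operations.
Context {R : realType}.

(** The pointwise converse of [ac_dominated]: one small step to the right of [t] turns an inequality
    between increments into one between derivatives. *)
Lemma hder_dominated (V : normedModType R) (N : V -> R) (C : R) (z : R -> V)
    (beta : R -> R^o) (t b a e : R) (w : V) : seminorm N C -> a < t -> t < e ->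
  (forall s, t <= s -> s <= e -> N (z s - z t) <= beta s - beta t) ->
  hder z t w -> hder beta t b -> N w <= b.
Proof.
move=> [C0 ND NZ NC] at_ te Nz hz hb; apply/ler_addgt0Pr => k k0.
have C1 : 0 < C + 1 by lra.
have k1 : 0 < k / (C + 1) by rewrite divr_gt0.
have [d d0 D] := hz _ k1; have [d' d'0 D'] := hb _ k1.
pose x := Num.min (Num.min d d' / 2) (e - t).
have m0 : 0 < Num.min d d' by rewrite lt_min d0.
have x0 : 0 < x by rewrite lt_min divr_gt0//= subr_gt0.
have xe : x <= e - t by rewrite ge_min lexx orbT.
have xm : x < Num.min d d'.
  have : x <= Num.min d d' / 2 by rewrite ge_min lexx.
  by lra.
move: xm; rewrite lt_min => /andP[xd xd'].
have := D (t + x); have := D' (t + x); rewrite addrAC subrr add0r gtr0_norm//.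
move=> /(_ xd'); rewrite ler_norml => /andP[_ h1] /(_ xd) h2.
have h3 : N (z (t + x) - z t) <= beta (t + x) - beta t by apply: Nz; lra.
have h4 : N (x *: w) <= x * b + k * x.
  have -> : x *: w = (z (t + x) - z t) + - (z (t + x) - z t - x *: w) by lmod R.
  apply: (le_trans (ND _ _)).
  have h5 : N (- (z (t + x) - z t - x *: w)) <= C * (k / (C + 1) * x).
    by rewrite (le_trans (NC _))// normrN ler_wpM2l.
  have h6 : (k / (C + 1)) * (C + 1) = k by rewrite divfK// gt_eqF.
  have h7 : beta (t + x) - beta t <= x * b + k / (C + 1) * x.
    by move: h1; rewrite -[x *: b]/(x * b); lra.
  nra.
by move: h4; rewrite NZ gtr0_norm// -(mulrC x) -mulrDr ler_pM2l.
Qed.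

Lemma lipD (V : normedModType R) (L K a b : R) (z w : R -> V) :
  lip L a b z -> lip K a b w -> lip (L + K) a b (fun t => z t + w t).
Proof.
move=> zL wK r s ar rs sb.
have -> : z s + w s - (z r + w r) = (z s - z r) + (w s - w r) by lmod R.
by rewrite (le_trans (ler_normD _ _))// mulrDl lerD//; [exact: zL|exact: wK].
Qed.

Lemma lipZ (V : normedModType R) (L k a b : R) (z : R -> V) :
  lip L a b z -> lip (`|k| * L) a b (fun t => k *: z t).
Proof.
move=> zL r s ar rs sb; rewrite -scalerBr normrZ -mulrA ler_wpM2l//; exact: zL.
Qed.

Lemma lip_scale (V : normedModType R) (c : V) a b : lip `|c| a b (fun t => t *: c).
Proof.
by move=> r s ar rs sb; rewrite -scalerBl normrZ mulrC ger0_norm// subr_ge0.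
Qed.

Lemma lip_mulmx (n k : nat) (A : 'M[R]_(n, k)) (L a b : R) (U : R -> 'cV[R]_k) :
  lip L a b U -> lip (k%:R * `|A| * L) a b (fun t => A *m U t).
Proof.
move=> UL r s ar rs sb; rewrite -mulmxBr (le_trans (mulmx_norm_le _ _))//.
by rewrite -[leRHS]mulrA ler_wpM2l ?mulr_ge0//; exact: UL.
Qed.

Lemma hder_mulmx (n k : nat) (A : 'M[R]_(n, k)) (U : R -> 'cV[R]_k) t v :
  hder U t v -> hder (fun t => A *m U t) t (A *m v).
Proof.
move=> hU e e0; have c0 : 0 < k%:R * `|A| + 1 by rewrite ltr_pwDr// mulr_ge0.
have [d d0 D] := hU _ (divr_gt0 e0 c0); exists d => // s /D h.
have -> : A *m U s - A *m U t - (s - t) *: (A *m v) =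
    A *m (U s - U t - (s - t) *: v).
  by rewrite !mulmxBr scalemxAr.
rewrite (le_trans (mulmx_norm_le _ _))//.
apply: (le_trans (ler_wpM2l _ h)); first by rewrite mulr_ge0.
rewrite mulrA ler_wpM2r// mulrCA ler_piMr ?ltW// ltr_pdivrMr// mul1r; lra.
Qed.

Lemma lip_col (k : nat) (L a b : R) (z : R -> 'cV[R]_k) : 0 <= L ->
  (forall i, lip L a b (fun t => z t i 0 : R^o)) -> lip L a b z.
Proof.
move=> L0 zL r s ar rs sb; apply: mx_norm_le => [|i j].
  by rewrite mulr_ge0// subr_ge0.
by rewrite ord1 !mxE; exact: zL.
Qed.

Lemma proper_R : proper_space R^o.
Proof.
split.
  move=> r; have -> : [set x : R^o | `|x| <= r] = `[- r, r]%classic.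
    by apply/seteqP; split => x /=; rewrite in_itv/= ler_norml.
  exact: segment_compact.
exists 1%N, (fun=> 1), (fun _ x => x); split => // v.
by rewrite big_ord1 [RHS]mulr1.
Qed.

Lemma lip_mul (L K A B a b : R) (z w : R -> R^o) : 0 <= L -> 0 <= K ->
  lip L a b z -> lip K a b w ->
  (forall t, a <= t -> t <= b -> `|z t| <= A) ->
  (forall t, a <= t -> t <= b -> `|w t| <= B) ->
  lip (A * K + L * B) a b (fun t => z t * w t : R^o).
Proof.
move=> L0 K0 zL wK zA wB r s ar rs sb.
have -> : z s * w s - z r * w r = z s * (w s - w r) + (z s - z r) * w r by ring.
rewrite (le_trans (ler_normD _ _))// !normrM.
have as_ := le_trans ar rs; have rb := le_trans rs sb.
have h1 := zL _ _ ar rs sb; have h2 := wK _ _ ar rs sb.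
have h3 := zA _ as_ sb; have h4 := wB _ ar rb.
have h5 : `|z s| * `|w s - w r| <= A * (K * (s - r)) by exact: ler_pM.
have h6 : `|z s - z r| * `|w r| <= L * (s - r) * B by exact: ler_pM.
lra.
Qed.

Lemma le_scaled_eps (x y c : R) : 0 <= c ->
  (forall e, 0 < e -> x <= y + e * c) -> x <= y.
Proof.
move=> c0 H; apply/ler_addgt0Pr => e e0; have c1 : 0 < c + 1 by lra.
apply: le_trans (H _ (divr_gt0 e0 c1)) _; rewrite lerD2l.
by rewrite mulrAC ler_pdivrMr// ler_wpM2l ?ltW//; lra.
Qed.

Lemma norm_lt_itv (a b s t : R) : `|s - t| < t - a -> `|s - t| < b - t ->
  a <= s /\ s <= b.
Proof. by rewrite !ltr_norml => /andP[? ?] /andP[? ?]; split; lra. Qed.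

(** The tangent line of [l * x ^+ 2] evaluated at its point of contact. *)
Lemma square_arith (l d al : R) :
  2 * l * d * d <= l * d ^+ 2 + al -> l * d ^+ 2 <= al.
Proof. by lra. Qed.

Lemma cost_arith (k l Nk Ns s r As Ar Bs Br e C : R) :
  k * Nk <= (s * l + Bs) - (r * l + Br) -> k * Ns <= k * (Nk + C * (2 * e)) ->
  `|Bs - As| <= e -> `|Br - Ar| <= e ->
  k * Ns <= (l * s + As) - (l * r + Ar) + e * (k * (C * 2) + 2).
Proof. by rewrite !ler_norml => ? ? /andP[? ?] /andP[? ?]; lra. Qed.

Lemma expansion_arith (X Y Z W D Lz e s r p q B : R) :
  X <= D * (e + Lz * (s - r)) * (s - r) -> Y <= Z + W -> Z <= p + q ->
  W <= B * (2 * e) -> p <= e -> q <= e ->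
  X + Y <= D * Lz * (s - r) ^+ 2 + e * (D * (s - r) + 2 + B * 2).
Proof. by rewrite expr2; lra. Qed.

Lemma hder_expansion_arith (X Y B u k S DL e : R) :
  X <= DL * S ^+ 2 -> DL * S ^+ 2 <= DL * (k * S) -> Y <= B * u ->
  B * u <= B * (k * S) -> 0 <= k * S -> k * (DL + B + 1) = e -> X + Y <= e * S.
Proof. by move=> ? ? ? ? ? <-; lra. Qed.

Lemma limn_einf_le (u : (\bar R)^nat) (c : R) :
  (forall e, 0 < e -> forall K, exists2 k, (K <= k)%N & (u k <= (c + e)%:E)%E) ->
  (limn_einf u <= c%:E)%E.
Proof.
move=> H; have -> : limn_einf u = limf_einf u \oo by [].
rewrite limf_einfE; apply: ge_ereal_sup => _ [V [K _ KV] <-].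
apply/lee_addgt0Pr => e e0; have [k Kk uk] := H e e0 K.
apply: le_trans uk; apply: ereal_inf_lbound; exists k => //; exact: KV.
Qed.

Lemma limn_einf_ge0 (u : (\bar R)^nat) : (forall k, (0 <= u k)%E) ->
  (0 <= limn_einf u)%E.
Proof.
move=> u0; have -> : limn_einf u = limf_einf u \oo by [].
rewrite limf_einfE; apply: (@le_trans _ _ (ereal_inf (u @` setT))).
  by apply: le_ereal_inf_tmp => _ [k _ <-].
by apply: ereal_sup_ubound; exists setT => //; exact: filterT.
Qed.

End curve_operations.

Section cost.
Context {R : realType} {n m : nat}.
Variables (N : 'cV[R]_m -> R) (f : 'cV[R]_n -> 'cV[R]_n)
  (g : 'cV[R]_n -> 'M[R]_(n, m)) (h : 'cV[R]_n -> 'cV[R]_m).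
Hypothesis nN : is_norm N.
Hypothesis fC : Ck 1 f.
Hypothesis gC : Ck 1 g.
Hypothesis hC : Ck 1 h.
Variables (phi : R -> R) (Lphi cphi : R).
Hypothesis Lphi0 : 0 <= Lphi.
Hypothesis cphi0 : 0 < cphi.
Hypothesis phi_ge : forall t, 0 <= t -> cphi <= phi t.
Hypothesis phi_lip : forall a b, 0 <= a -> lip Lphi a b (phi : R -> R^o).
Variables (yref : R -> 'cV[R]_m) (Lref : R).
Hypothesis Lref0 : 0 <= Lref.
Hypothesis yref_lip : forall a b, 0 <= a -> lip Lref a b yref.
Variables (lambda M T th : R) (xh : 'cV[R]_n).
Hypothesis lambda0 : 0 <= lambda.
Hypothesis M0 : 0 <= M.
Hypothesis T0 : 0 < T.
Hypothesis th0 : 0 <= th.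
Local Notation mu := (@lebesgue_measure R).
Local Notation I := (`[th, th + T]%classic : set R).
Local Notation dist t x := (phi t * N (h x - yref t)).
Local Notation field u := (fun t x => f x + g x *m u t).
Local Notation adm := (admissible N M T th).
Local Notation J u := (cost N f g h phi yref lambda T u th xh).
Local Notation sol u x := (lip_solution (field u) th (th + T) x).

Let thT : th < th + T. Proof. by rewrite ltrDl. Qed.

Lemma dist_ge0 t x : 0 <= t -> 0 <= dist t x.
Proof.
move=> t0; rewrite mulr_ge0 ?is_norm_ge0//.
by apply: le_trans (phi_ge t0); exact: ltW.
Qed.

Lemma lip_dist (x : R -> 'cV[R]_n) (L a b : R) : 0 <= a -> a <= b -> 0 <= L ->
  lip L a b x -> exists2 K, 0 <= K & lip K a b (fun t => dist t (x t) : R^o).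
Proof.
move=> a0 ab L0 xL; have [K K0 hK] := lip_Ck1_comp (@proper_cV R n) hC L0 xL.
have [C sN] := is_norm_seminorm nN; have [C0 _ _ NC] := sN.
have eL : lip (K + 1 * Lref) a b (fun t => h (x t) - yref t).
  have := lipD hK (lipZ (-1) (@yref_lip a b a0)).
  rewrite normrN normr1; congr lip; apply/funext => t /=.
  by rewrite scaleN1r.
rewrite mul1r in eL; have KL0 : 0 <= K + Lref by rewrite addr_ge0.
have NeL : lip (C * (K + Lref)) a b (fun t => N (h (x t) - yref t) : R^o).
  move=> r s ar rs sb; apply: le_trans (seminorm_sub sN _ _) _.
  by rewrite -mulrA ler_wpM2l//; exact: eL.
have CKL : 0 <= C * (K + Lref) by rewrite mulr_ge0.
have H1 := lip_bounded Lphi0 (@phi_lip a b a0).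
have H2 := lip_bounded CKL NeL.
have := lip_mul Lphi0 CKL (@phi_lip a b a0) NeL H1 H2.
set A := (X in lip X); exists A => //.
by rewrite /A addr_ge0// mulr_ge0// addr_ge0// ?mulr_ge0// ?subr_ge0.
Qed.

Lemma admissible_bound u : adm u ->
  exists2 C, 0 <= C & {ae mu, forall t, th <= t <= th + T -> `|u t| <= C}.
Proof.
move=> [_ uoo]; have uM := (normoo_leP N I u M0).1 uoo; have [c c0 cN] := is_norm_bound nN.
exists (c * M); first by rewrite mulr_ge0// ltW.
apply: aeS uM => t H tab; rewrite (le_trans (cN _))// ler_pM2l//.
by apply: H; rewrite /= in_itv.
Qed.

Lemma trajectory_lip_solution u x : adm u -> trajectory f g u th xh I x ->
  sol u x /\ x th = xh.
Proof.
move=> au tx; have [C C0 uC] := admissible_bound au.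
have [bF _] := control_field_regular fC gC C0 uC.
split; last by case: tx.
exact: (caratheodory_lip_solution (ltW thT) _ bF tx).
Qed.

Lemma lip_solution_trajectory u x : sol u x -> x th = xh ->
  trajectory f g u th xh I x.
Proof.
by move=> sx <-; exact: lip_solution_caratheodory (ltW thT) sx.
Qed.

(** The cost is defined through an arbitrarily chosen solution; uniqueness lets any solution at hand
    be used instead. *)
Lemma get_trajectory u x : adm u -> sol u x -> x th = xh ->
  forall t, th <= t -> t <= th + T -> get (trajectory f g u th xh I) t = x t.
Proof.
move=> au sx xth; have tx := lip_solution_trajectory sx xth.
have [C C0 uC] := admissible_bound au.
have [_ lF] := control_field_regular fC gC C0 uC.
have [sg gth] := trajectory_lip_solution au (getPex (ex_intro _ _ tx)).
by apply: (lip_solution_unique lF sg sx); rewrite gth xth.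
Qed.

Definition barrier (r : R) : R := (1 - r ^+ 2)^-1 - 1.

Lemma barrier_ge0 r : 0 <= r -> r < 1 -> 0 <= barrier r.
Proof.
move=> r0 r1; rewrite subr_ge0 -[leLHS]invr1 lef_pV2 ?posrE//; nra.
Qed.

Lemma stage_costE t x u : dist t x < 1 ->
  stage_cost N h phi yref lambda t x u =
  ((barrier (dist t x))%:E + (lambda * N u ^+ 2)%:E)%E.
Proof.
move=> dx; rewrite /stage_cost lt_eqF// -EFinD; congr EFin.
by rewrite /barrier exprMn.
Qed.

Lemma barrier_measurable (x : R -> 'cV[R]_n) (L : R) : 0 <= L ->
  lip L th (th + T) x -> (forall t, th <= t -> t <= th + T -> dist t (x t) < 1) ->
  measurable_fun I (fun t => barrier (dist t (x t))).
Proof.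
move=> L0 xL dx; have [K K0 wK] := lip_dist th0 (ltW thT) L0 xL.
apply: (measurable_clip (ltW thT) (k := fun t => barrier (dist t (x t)))).
have cw := lip_clip_continuous K0 (ltW thT) wK.
move=> t; apply: cvgB; last exact: cvg_cst.
have ht := clip_ge th (th + T) t; have tT := clip_le t (ltW thT).
apply: cvgV.
  have := dx _ ht tT; have := @dist_ge0 _ (x (clip th (th + T) t)) (le_trans th0 ht).
  by move=> h1 h2; rewrite gt_eqF//; nra.
apply: cvgB; first exact: cvg_cst.
by rewrite expr2; under [X in X @ _ --> _]eq_fun do rewrite expr2; apply: cvgM; exact: cw.
Qed.

Lemma input_cost_measurable u : adm u -> measurable_fun I (fun t => lambda * N (u t) ^+ 2).
Proof.
move=> [[mu_ _] _]; have [C sN] := is_norm_seminorm nN.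
apply: measurable_funM => //; apply: measurable_funX.
by apply: measurable_continuous_comp => //; exact: seminorm_continuous sN.
Qed.

(** Inside the funnel both parts of the stage cost are finite and nonnegative, so the integrand is
    quasi-integrable and the integral splits. *)
Lemma cost_inside u x : adm u -> sol u x -> x th = xh ->
  (forall t, th <= t -> t <= th + T -> dist t (x t) < 1) ->
  J u = (\int[mu]_(t in I) (barrier (dist t (x t)))%:E +
         \int[mu]_(t in I) (lambda * N (u t) ^+ 2)%:E)%E.
Proof.
move=> au sx xth dx; have [[L L0 xL] _] := sx.
have mb := barrier_measurable L0 xL dx.
have mc := input_cost_measurable au.
have ge t : I t -> get (trajectory f g u th xh I) t = x t.
  by rewrite /= in_itv/= => /andP[h1 h2]; exact: get_trajectory.
have zE t : I t -> stage_cost N h phi yref lambda t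
    (get (trajectory f g u th xh I) t) (u t) =
    ((barrier (dist t (x t)))%:E + (lambda * N (u t) ^+ 2)%:E)%E.
  by move=> It; rewrite ge// stage_costE//; move: It; rewrite /= in_itv/= => /andP[? ?]; exact: dx.
have b0 t : I t -> 0 <= barrier (dist t (x t)).
  rewrite /= in_itv/= => /andP[h1 h2]; apply: barrier_ge0; last exact: dx.
  by rewrite dist_ge0// (le_trans th0).
have c0 t : 0 <= lambda * N (u t) ^+ 2 by rewrite mulr_ge0// exprn_ge0// is_norm_ge0.
rewrite /cost asboolT.
  transitivity (\int[mu]_(t in I) ((barrier (dist t (x t)))%:E + (lambda * N (u t) ^+ 2)%:E))%E.
    by apply: eq_integral => t; rewrite inE => It; rewrite zE.
  have mb' : measurable_fun I (EFin \o (fun t => barrier (dist t (x t)))).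
    exact/measurable_EFinP.
  have mc' : measurable_fun I (EFin \o (fun t => lambda * N (u t) ^+ 2)).
    exact/measurable_EFinP.
  by rewrite ge0_integralD// => t _; rewrite lee_fin.
split; first by exists x; exact: lip_solution_trajectory.
have mz : measurable_fun I (fun t => stage_cost N h phi yref lambda t
    (get (trajectory f g u th xh I) t) (u t)).
  apply: (@eq_measurable_fun _ _ _ _ _ (fun t =>
     (barrier (dist t (x t)) + (lambda * N (u t) ^+ 2))%:E)).
    by move=> t; rewrite inE => It; rewrite zE.
  by apply/measurable_EFinP; exact: measurable_funD.
split => //; right.
rewrite integral0_eq ?ltry// => t It; rewrite funenegE zE// -EFinD -EFinN -EFin_max.
by congr EFin; apply/max_idPr; rewrite oppr_le0 addr_ge0// b0.
Qed.

(** The integrand can be negative beyond the funnel, so the escape argument is run on its positive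
    part. Were the integral of that part infinite, quasi-integrability would make the negative part
    finite and the total cost infinite. *)
Lemma cost_lty u : dist th xh < 1 -> adm u -> (J u < +oo)%E ->
  exists x, [/\ sol u x, x th = xh &
    forall t, th <= t -> t <= th + T -> dist t (x t) < 1].
Proof.
move=> dxh au; rewrite /cost; case: asboolP => // -[ne [mz qi]] fin.
set z := (fun t => stage_cost _ _ _ _ _ _ _ _) in mz qi fin.
set x := get _ in z mz qi fin *.
have [sx xth] := trajectory_lip_solution au (getPex ne).
exists x; split => //; have [[L L0 xL] _] := sx.
have [K K0 wK] := lip_dist th0 (ltW thT) L0 xL.
apply: (@funnel_escape R (fun t => dist t (x t)) (z ^\+)%E K th (th + T)) => //.
- exact: ltW.
- by move=> t h1 h2; rewrite dist_ge0// (le_trans th0).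
- by rewrite /x xth.
- exact: measurable_funepos.
- move=> t h1 h2 dx; rewrite funeposE le_max /z stage_costE//.
  by rewrite -EFinD lee_fin lerDl mulr_ge0// exprn_ge0// is_norm_ge0.
- case: qi => // zneg; rewrite ltNge leye_eq; apply/negP => /eqP zpos.
  move: fin; rewrite integralE zpos.
  have : (0 <= \int[mu]_(t in I) (z ^\- t))%E by apply: integral_ge0.
  move: zneg; case: (\int[mu]_(t in I) (z ^\- t))%E => //.
Qed.

Lemma input_primitive u (c : R) : 0 <= c -> adm u ->
  {ae mu, forall t, th <= t <= th + T -> `|u t| <= c} ->
  exists U : R -> 'cV[R]_m, [/\ U th = 0, lip c th (th + T) U &
    {ae mu, forall t, th <= t <= th + T -> hder U t (u t)}].
Proof.
move=> c0 [[mu_ _] _] uc.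
have /boolp.choice[P PP] i : exists P : R -> R^o, [/\ P th = 0, lip c th (th + T) P &
    {ae mu, forall t, th <= t <= th + T -> hder P t (u t i 0)}].
  have uci : {ae mu, forall t, th <= t <= th + T -> `|u t i 0| <= c}.
    by apply: aeS uc => t H tab; exact: le_trans (mx_coord_le _ _ _) (H tab).
  by have [P [P0 PL Pd _]] := primitive_bounded thT c0 (mu_ i) uci; exists P.
exists (fun t => \col_i P i t); split.
- by apply/colP => i; rewrite !mxE; have [] := PP i.
- apply: lip_col => // i; have [_ + _] := PP i.
  by congr lip; apply/funext => t; rewrite mxE.
- have H : {ae mu, forall t, forall i, th <= t <= th + T -> hder (P i) t (u t i 0)}.
    apply: (@filter_forall _ _ _ _ (ae_filter_ringOfSetsType mu)) => i.
    by have [] := PP i.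
  apply: aeS H => t H tab; apply: (@hder_col _ _ _ u) => i.
  have := H i tab; congr hder; apply/funext => s; by rewrite mxE.
Qed.

Lemma input_cost_primitive u : adm u ->
  exists A : R -> R^o, [/\ A th = 0, lip (lambda * M ^+ 2) th (th + T) A,
    {ae mu, forall t, th <= t <= th + T -> hder A t (lambda * N (u t) ^+ 2)} &
    (\int[mu]_(t in I) (lambda * N (u t) ^+ 2)%:E = (A (th + T))%:E)%E].
Proof.
move=> au; have lM0 : 0 <= lambda * M ^+ 2 by rewrite mulr_ge0// exprn_ge0.
apply: (primitive_bounded thT lM0 (input_cost_measurable au)).
have [_ uoo] := au; have uM := (normoo_leP N I u M0).1 uoo.
apply: aeS uM => t H tab; have N0 : 0 <= N (u t) by exact: is_norm_ge0.
rewrite ger0_norm; last by rewrite mulr_ge0// exprn_ge0.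
by rewrite ler_wpM2l// lerXn2r ?nnegrE//; apply: H; rewrite /= in_itv.
Qed.

(* Limits of trajectories are identified without weak convergence, by passing
   to the limit in first-order expansions of the state in terms of the
   increments of the primitive of the input. *)
Lemma trajectories_compact (u : nat -> R -> 'cV[R]_m) (x : nat -> R -> 'cV[R]_n)
    (rho : R) :
  (forall k, adm (u k)) -> (forall k, sol (u k) (x k)) -> (forall k, x k th = xh) ->
  (forall k t, th <= t -> t <= th + T -> `|x k t| <= rho) ->
  exists (us : R -> 'cV[R]_m) (xs : R -> 'cV[R]_n) (A : nat -> R) (As : R),
  [/\ adm us, sol us xs /\ xs th = xh,
    forall k, (\int[mu]_(t in I) (lambda * N (u k t) ^+ 2)%:E = (A k)%:E)%E,
    (\int[mu]_(t in I) (lambda * N (us t) ^+ 2)%:E <= As%:E)%E &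
    forall e, 0 < e -> forall K, exists2 k, (K <= k)%N &
      `|A k - As| <= e /\
      forall t, th <= t -> t <= th + T -> `|x k t - xs t| <= e].
Proof.
move=> uA xS x_th x_rho.
have [c c0 cN] := is_norm_bound nN.
have [C sN] := is_norm_seminorm nN; have [C0 ND NZ NC] := sN.
have [Cu Cu0 CuE] : exists2 Cu, 0 <= Cu & Cu = c * M.
  by exists (c * M); rewrite ?mulr_ge0// ltW.
have uM k : {ae mu, forall t, th <= t <= th + T -> N (u k t) <= M}.
  have [_ uoo] := uA k; have := (normoo_leP N I (u k) M0).1 uoo.
  by apply: aeS => t H tab; apply: H; rewrite /= in_itv.
have uC k : {ae mu, forall t, th <= t <= th + T -> `|u k t| <= Cu}.
  apply: aeS (uM k) => t H tab.
  by rewrite CuE (le_trans (cN _))// ler_pM2l// H.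
have pV := @proper_cV R n; have [cV _] := pV.
have [F F0 fF] := continuous_bounded (cV rho) (Ck1_continuous fC).
have [G G0 gG] := continuous_bounded (cV rho) (Ck1_continuous gC).
pose Lx := F + m%:R * G * Cu.
have Lx0 : 0 <= Lx by rewrite addr_ge0// !mulr_ge0.
have xL k : lip Lx th (th + T) (x k).
  have [[L L0 xkL] xkd] := xS k.
  apply: ac_lip => //; first exact: lip_abs_continuous xkL.
  apply: aeS (aeI xkd (uC k)) => t [H1 H2] tab.
  exists (f (x k t) + g (x k t) *m u k t); first exact: H1.
  have xt : `|x k t| <= rho by case/andP: tab => ? ?; exact: x_rho.
  rewrite (le_trans (ler_normD _ _))// lerD//; first exact: fF.
  rewrite (le_trans (mulmx_norm_le _ _))// ler_pM ?mulr_ge0//; last exact: H2.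
  by rewrite ler_wpM2l//; exact: gG.
have /boolp.choice[U UP] k := input_primitive Cu0 (uA k) (uC k).
have /boolp.choice[A AP] k := input_cost_primitive (uA k).
pose LA := lambda * M ^+ 2.
have LA0 : 0 <= LA by rewrite mulr_ge0// exprn_ge0.
(* State, input primitive and cost primitive are packed together, so that one application of
   [ascoli_lip] provides a common index for all three. *)
pose Z k t : 'cV[R]_n * ('cV[R]_m * R^o) := (x k t, (U k t, A k t)).
pose LZ := Num.max Lx (Num.max Cu LA).
have LZ0 : 0 <= LZ by rewrite le_max Lx0.
have ZL k : lip LZ th (th + T) (Z k).
  apply: lip_pair => //; apply: lip_pair; first by have [] := UP k.
  by have [] := AP k.
pose bZ := Num.max rho (Num.max (Cu * T) (LA * T)).
have Zb k t : th <= t -> t <= th + T -> `|Z k t| <= bZ.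
  move=> h1 h2; apply: pair_norm_le.
    by rewrite le_max x_rho.
  rewrite le_max; apply/orP; right; apply: pair_norm_le; rewrite le_max.
    have [U0 UL _] := UP k; have := lip_bounded Cu0 UL h1 h2.
    by rewrite U0 normr0 add0r (addrC th) addrK => ->.
  have [A0 AL _ _] := AP k; have := lip_bounded LA0 AL h1 h2.
  by rewrite A0 normr0 add0r (addrC th) addrK => ->; rewrite orbT.
have [z [zL zlim]] := ascoli_lip
  (proper_prod (@proper_cV R n) (proper_prod (@proper_cV R m) (@proper_R R)))
  (ltW thT) LZ0 ZL Zb.
pose xs t := (z t).1; pose Us t := (z t).2.1; pose As t : R^o := (z t).2.2.
have xsL : lip LZ th (th + T) xs by exact: lip_fst zL.
have UsL : lip LZ th (th + T) Us by exact: (lip_fst (lip_snd zL)).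
have AsL : lip LZ th (th + T) As by exact: (lip_snd (lip_snd zL)).
have lim e : 0 < e -> forall K, exists2 k, (K <= k)%N &
    forall t, th <= t -> t <= th + T -> [/\ `|x k t - xs t| <= e,
      `|U k t - Us t| <= e & `|A k t - As t| <= e].
  move=> e0 K; have [k Kk H] := zlim e e0 K; exists k => // t h1 h2.
  have := H t h1 h2 => Ht; split.
  - exact: le_trans (fst_norm_le (Z k t - z t)) Ht.
  - exact: le_trans (fst_norm_le (Z k t - z t).2) (le_trans (snd_norm_le _) Ht).
  - exact: le_trans (snd_norm_le (Z k t - z t).2) (le_trans (snd_norm_le _) Ht).
have xs_th : xs th = xh.
  apply/eqP; rewrite -subr_eq0 -normr_le0; apply/(@le_scaled_eps _ _ _ 1) => // e e0.
  have [k _ H] := lim e e0 0%N; have [h1 _ _] := H th (lexx _) (ltW thT).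
  by rewrite add0r mulr1 distrC -(x_th k).
(* The constraint is carried as a slope bound in the norm [N] itself; passing through the sup norm
   would lose a factor and violate the bound [M]. *)
have UsN r s : th <= r -> r <= s -> s <= th + T -> N (Us s - Us r) <= M * s - M * r.
  move=> tr rs sT; apply: (@le_scaled_eps _ _ _ (C * 2)); first by rewrite mulr_ge0.
  move=> e e0; have [k _ H] := lim e e0 0%N.
  have tsr := le_trans tr rs; have rsT := le_trans rs sT.
  have [_ h1 _] := H s tsr sT; have [_ h2 _] := H r tr rsT.
  have [U0 UL Ud] := UP k.
  have h3 : N (U k s - U k r) <= M * s - M * r.
    have cL : lip `|M : R^o| r s (fun t => M * t : R^o).
      by move=> p q _ pq _; rewrite -mulrBr normrM [`|q - p|]ger0_norm// subr_ge0.
    apply: (ac_dominated sN rs (beta := fun t => M * t : R^o)).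
    - by apply: (lip_abs_continuous Cu0); exact: lipW UL.
    - by apply: (lip_abs_continuous _ cL).
    - apply: aeS (aeI Ud (uM k)) => t [H1 H2] /andP[h4 h5].
      have tab : th <= t <= th + T by rewrite (le_trans tr h4) (le_trans h5 sT).
      exists (u k t), M; split; [exact: H1| |exact: H2].
      move=> d d0; exists 1 => // p _.
      have -> : M * p - M * t - (p - t) *: (M : R^o) = 0 by rewrite [(p - t) *: _]mulrC; ring.
      by rewrite normr0 mulr_ge0// ltW.
  have -> : Us s - Us r = (U k s - U k r) + (- (U k s - Us s) + (U k r - Us r)) by lmod R.
  rewrite (le_trans (ND _ _))// lerD// (le_trans (NC _))// mulrCA ler_wpM2l//.
  by rewrite (le_trans (ler_normD _ _))// normrN ?mulr_natl ?mulr_natr mulr2n lerD.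
(* Tangent lines of the square: lambda N u ^ 2 >= 2 lambda d N u - lambda d ^ 2,
   an inequality that passes to the limit and is optimal at d = N u. *)
have UsA d r s : 0 <= d -> th <= r -> r <= s -> s <= th + T ->
    2 * lambda * d * N (Us s - Us r) <= (lambda * d ^+ 2 * s + As s) - (lambda * d ^+ 2 * r + As r).
  move=> d0 tr rs sT.
  have k0 : 0 <= 2 * lambda * d by rewrite !mulr_ge0.
  apply: (@le_scaled_eps _ _ _ (2 * lambda * d * (C * 2) + 2)).
    by rewrite addr_ge0// !mulr_ge0.
  move=> e e0; have [k _ H] := lim e e0 0%N.
  have tsr := le_trans tr rs; have rsT := le_trans rs sT.
  have [_ h1 a1] := H s tsr sT; have [_ h2 a2] := H r tr rsT.
  have [U0 UL Ud] := UP k; have [A0 AL Ad _] := AP k.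
  pose Nd v := 2 * lambda * d * N v.
  have sNd : seminorm Nd (2 * lambda * d * C).
    split.
    - by rewrite mulr_ge0.
    - by move=> v v'; rewrite /Nd -mulrDr ler_wpM2l.
    - by move=> q v; rewrite /Nd NZ mulrCA.
    - by move=> v; rewrite /Nd -[leRHS]mulrA ler_wpM2l.
  have h3 : Nd (U k s - U k r) <= (s *: (lambda * d ^+ 2 : R^o) + A k s) -
      (r *: (lambda * d ^+ 2 : R^o) + A k r).
    have bL := lipD (@lip_scale _ R^o (lambda * d ^+ 2) th (th + T)) AL.
    apply: (ac_dominated sNd rs (beta := fun t => t *: (lambda * d ^+ 2 : R^o) + A k t)).
    - by apply: (lip_abs_continuous Cu0); exact: lipW UL.
    - apply: lip_abs_continuous (lipW tr sT bL); by rewrite addr_ge0.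
    - apply: aeS (aeI Ud Ad) => t [H1 H2] /andP[h4 h5].
      have tab : th <= t <= th + T by rewrite (le_trans tr h4) (le_trans h5 sT).
      exists (u k t), (lambda * d ^+ 2 + lambda * N (u k t) ^+ 2); split; first exact: H1.
        by apply: hderD; [exact: hder_scale|exact: H2].
      rewrite /Nd -subr_ge0.
      have -> : lambda * d ^+ 2 + lambda * N (u k t) ^+ 2 - 2 * lambda * d * N (u k t) =
        lambda * (d - N (u k t)) ^+ 2 by ring.
      by rewrite mulr_ge0// sqr_ge0.
  have h4 : N (Us s - Us r) <= N (U k s - U k r) + C * (2 * e).
    have -> : Us s - Us r = (U k s - U k r) + (- (U k s - Us s) + (U k r - Us r)) by lmod R.
    rewrite (le_trans (ND _ _))// lerD2l (le_trans (NC _))// ler_wpM2l//.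
    by rewrite (le_trans (ler_normD _ _))// normrN ?mulr_natl ?mulr_natr mulr2n lerD.
  have h5 := ler_wpM2l k0 h4.
  move: h3; rewrite /Nd -![_ *: (_ : R^o)]/(_ * _).
  move=> h3; exact: (cost_arith h3 h5 a1 a2).
have [Gf Gf0 fL] := Ck1_lip (Num.max rho (`|xh| + LZ * T)) pV fC.
have [Gg Gg0 gL] := Ck1_lip (Num.max rho (`|xh| + LZ * T)) pV gC.
have xs_le t : th <= t -> t <= th + T -> `|xs t| <= `|xh| + LZ * T.
  move=> h1 h2; have := lip_bounded LZ0 xsL h1 h2.
  by rewrite xs_th (addrC th) addrK.
pose D := Gf + m%:R * Gg * Cu.
have D0 : 0 <= D by rewrite addr_ge0// !mulr_ge0.
(* The coefficients are frozen at [xs o]. The remainder [y] has derivative [(f (x k t) - f (xs o)) +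
   (g (x k t) - g (xs o)) *m u k t], of order [e + LZ * (s - r)], whence a quadratic error once [e]
   tends to zero. Leaving [o] free covers base points at either end of the interval. *)
have expansion r s o : th <= r -> r <= o -> o <= s -> s <= th + T ->
    `|(xs s - xs r) - (s - r) *: f (xs o) - g (xs o) *m (Us s - Us r)|
      <= D * LZ * (s - r) ^+ 2.
  move=> tr ro os sT; have rs := le_trans ro os.
  have to_ := le_trans tr ro; have oT := le_trans os sT.
  have tsr := le_trans tr rs; have rsT := le_trans rs sT.
  set B := g (xs o); set b0 := f (xs o).
  apply: (@le_scaled_eps _ _ _ (D * (s - r) + 2 + m%:R * `|B| * 2)).
    by rewrite !addr_ge0// !mulr_ge0// subr_ge0.
  move=> e e0; have [k _ H] := lim e e0 0%N.
  have [h1 h2 _] := H s tsr sT; have [h3 h4 _] := H r tr rsT.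
  have [U0 UL Ud] := UP k; have [_ xd] := xS k.
  pose y t := x k t + (t *: (- b0) + (- B) *m U k t).
  have yL : lip (Lx + (`|- b0| + m%:R * `|- B| * Cu)) th (th + T) y.
    by apply: lipD => //; apply: lipD; [exact: lip_scale|exact: lip_mulmx].
  have y_lip : lip (D * (e + LZ * (s - r))) r s y.
    have eL0 : 0 <= D * (e + LZ * (s - r)).
      by rewrite mulr_ge0// addr_ge0 ?(ltW e0)// mulr_ge0// subr_ge0.
    apply: ac_lip => //.
      apply: lip_abs_continuous (lipW tr sT yL).
      by rewrite !addr_ge0// !mulr_ge0.
    apply: aeS (aeI (aeI xd Ud) (uC k)) => t [[H1 H2] H3] /andP[h5 h6].
    have tt := le_trans tr h5; have tT := le_trans h6 sT.
    have tab : th <= t <= th + T by rewrite tt.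
    exists (f (x k t) + g (x k t) *m u k t + (- b0 + (- B) *m u k t)).
      apply: hderD; first exact: H1.
      by apply: hderD; [exact: hder_scale|apply: hder_mulmx; exact: H2].
    have -> : f (x k t) + g (x k t) *m u k t + (- b0 + (- B) *m u k t) =
        (f (x k t) - b0) + (g (x k t) - B) *m u k t.
      by rewrite mulmxDl; move: (g (x k t) *m u k t) ((- B) *m u k t) => q1 q2; lmod R.
    have xkt : `|x k t| <= Num.max rho (`|xh| + LZ * T) by rewrite le_max x_rho.
    have xso : `|xs o| <= Num.max rho (`|xh| + LZ * T) by rewrite le_max xs_le// orbT.
    have dx : `|x k t - xs o| <= e + LZ * (s - r).
      have -> : x k t - xs o = (x k t - xs t) + (xs t - xs o) by rewrite addrA subrK.
      rewrite (le_trans (ler_normD _ _))// lerD//; first by have [] := H t tt tT.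
      case: (leP o t) => [|/ltW] ot.
        by rewrite (le_trans (xsL _ _ to_ ot tT))// ler_wpM2l// lerB.
      by rewrite distrC (le_trans (xsL _ _ tt ot oT))// ler_wpM2l// lerB.
    apply: (@le_trans _ _ (D * `|x k t - xs o|)); last by rewrite ler_wpM2l.
    rewrite (le_trans (ler_normD _ _))// /D mulrDl lerD//; first exact: fL.
    rewrite (le_trans (mulmx_norm_le _ _))//.
    apply: (@le_trans _ _ (m%:R * (Gg * `|x k t - xs o|) * Cu)).
      rewrite ler_pM ?mulr_ge0//; last exact: H3.
      by rewrite ler_wpM2l//; exact: gL.
    by rewrite le_eqVlt; apply/orP; left; apply/eqP; ring.
  have h5 := y_lip r s (lexx _) rs (lexx _).
  have -> : xs s - xs r - (s - r) *: b0 - B *m (Us s - Us r) =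
    (y s - y r) + ((- (x k s - xs s) + (x k r - xs r)) +
      B *m ((U k s - Us s) - (U k r - Us r))).
    rewrite /y !mulmxBr !mulNmx.
    move: (B *m Us s) (B *m Us r) (B *m U k s) (B *m U k r) => q1 q2 q3 q4.
    lmod R.
  rewrite (le_trans (ler_normD _ _))//.
  have h6 := ler_normD (- (x k s - xs s) + (x k r - xs r)) (B *m ((U k s - Us s) - (U k r - Us r))).
  have h7 := ler_normD (- (x k s - xs s)) (x k r - xs r); rewrite normrN in h7.
  have h8 := mulmx_norm_le B ((U k s - Us s) - (U k r - Us r)).
  have h9 := ler_normB (U k s - Us s) (U k r - Us r).
  have mB0 : 0 <= m%:R * `|B| by rewrite mulr_ge0.
  have h10 : m%:R * `|B| * `|U k s - Us s - (U k r - Us r)| <= m%:R * `|B| * (2 * e).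
    by rewrite ler_wpM2l// (le_trans h9)// mulr_natl mulr2n lerD.
  exact: (expansion_arith h5 h6 h7 (le_trans h8 h10) h1 h3).
have [us [usm usd]] := lip_col_derivative LZ0 thT UsL.
have [al alm ald] := lip_derivative LZ0 thT AsL.
have us_ae : {ae mu, forall t, th <= t <= th + T ->
   [/\ N (us t) <= M, lambda * N (us t) ^+ 2 <= al t &
      hder xs t (f (xs t) + g (xs t) *m us t)] }.
  apply: aeS (aeI (aeI usd ald) (aeI (ae_neq th) (ae_neq (th + T)))).
  move=> t [[Hu Ha] [t1 t2]] tab; have {}Hu := Hu tab; have {}Ha := Ha tab.
  have [tt tT] : th < t /\ t < th + T.
    by case/andP: tab => h1 h2; rewrite !lt_neqAle h1 h2 eq_sym t1 t2.
  split.
  - have dM : hder (fun s => M * s : R^o) t M.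
      move=> d d0; exists 1 => // p _.
      have -> : M * p - M * t - (p - t) *: (M : R^o) = 0 by rewrite [(p - t) *: _]mulrC; ring.
      by rewrite normr0 mulr_ge0// ltW.
    apply: (hder_dominated sN tt tT _ Hu dM) => s ts sT.
    by apply: UsN => //; exact: ltW.
  - pose d := N (us t); have d0 : 0 <= d by exact: is_norm_ge0.
    have k0 : 0 <= 2 * lambda * d by rewrite !mulr_ge0.
    have sNd : seminorm (fun v => 2 * lambda * d * N v) (2 * lambda * d * C).
      split.
      - by rewrite mulr_ge0.
      - by move=> v v'; rewrite -mulrDr ler_wpM2l.
      - by move=> q v; rewrite NZ mulrCA.
      - by move=> v; rewrite -[leRHS]mulrA ler_wpM2l.
    have db : hder (fun s => s *: (lambda * d ^+ 2 : R^o) + As s) t (lambda * d ^+ 2 + al t).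
      by apply: hderD => //; exact: hder_scale.
    have : 2 * lambda * d * N (us t) <= lambda * d ^+ 2 + al t.
      apply: (hder_dominated sNd tt tT _ Hu db) => s ts sT.
      have := UsA d t s d0 (ltW tt) ts sT.
      by rewrite -![_ *: (_ : R^o)]/(_ * _) (mulrC s) (mulrC t).
    exact: square_arith.
  - set B := g (xs t); set b0 := f (xs t) => e e0.
    (* For [|s - t| < k] the quadratic remainder costs at most [D * LZ * k * |s - t|], and the
       expansion of [Us] costs [m * |B| * k * |s - t|]; [k] is chosen so that the sum stays below
       [e * |s - t|]. *)
    have c10 : 0 < D * LZ + m%:R * `|B| + 1.
      by rewrite ltr_pwDr// addr_ge0// !mulr_ge0.
    have e1 := divr_gt0 e0 c10; have [d d0 dU] := Hu _ e1.
    have e1E : (e / (D * LZ + m%:R * `|B| + 1)) * (D * LZ + m%:R * `|B| + 1) = e.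
      by rewrite divfK// gt_eqF.
    move: (e / _) e1 e1E dU => k k0 kE dU.
    exists (Num.min (Num.min d k) (Num.min (t - th) (th + T - t))).
      by rewrite !lt_min d0 k0 !subr_gt0 tt.
    move=> s; rewrite !lt_min => /andP[/andP[/dU h1 h2] /andP[h3 h4]].
    have [ths sT] : th <= s /\ s <= th + T.
      exact: norm_lt_itv h3 h4.
    have E : `|(xs s - xs t) - (s - t) *: b0 - B *m (Us s - Us t)| <= D * LZ * `|s - t| ^+ 2.
      case: (leP t s) => [|/ltW] ts.
        rewrite ger0_norm ?subr_ge0//.
        exact: (@expansion t s t (ltW tt) (lexx _) ts sT).
      have -> : xs s - xs t - (s - t) *: b0 - B *m (Us s - Us t) =
          - (xs t - xs s - (t - s) *: b0 - B *m (Us t - Us s)).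
        by rewrite !mulmxBr; move: (B *m Us s) (B *m Us t) => q1 q2; lmod R.
      rewrite normrN (distrC s) ger0_norm ?subr_ge0//.
      exact: (@expansion s t t ths ts (lexx _) (ltW tT)).
    have -> : xs s - xs t - (s - t) *: (b0 + B *m us t) =
        (xs s - xs t - (s - t) *: b0 - B *m (Us s - Us t)) +
        B *m (Us s - Us t - (s - t) *: us t).
      rewrite !mulmxBr -scalemxAr.
      by move: (B *m Us s) (B *m Us t) (B *m us t) => q1 q2 q3; lmod R.
    rewrite (le_trans (ler_normD _ _))//.
    have h5 := mulmx_norm_le B (Us s - Us t - (s - t) *: us t).
    have mB0 : 0 <= m%:R * `|B| by rewrite mulr_ge0.
    have h6 := ler_wpM2l mB0 h1.
    have h7 : D * LZ * `|s - t| ^+ 2 <= D * LZ * (k * `|s - t|).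
      by rewrite ler_wpM2l ?mulr_ge0// expr2 ler_wpM2r// ltW.
    have h8 : 0 <= k * `|s - t| by rewrite mulr_ge0// ltW.
    exact: (hder_expansion_arith E h7 h5 h6 h8 kE).
have usA : adm us.
  have us_oo : (normoo N I us <= M%:E)%E.
    apply/normoo_leP => //; apply: aeS us_ae => t H; rewrite /= in_itv/= => tab.
    by have [] := H tab.
  split => //; split; last by apply: le_lt_trans us_oo _; rewrite ltry.
  by move=> i; exact: (measurable_funS measurableT).
exists us, xs, (fun k => A k (th + T)), (As (th + T)); split => //.
- split => //; split; first by exists LZ.
  by apply: aeS us_ae => t H tab; have [] := H tab.
- by move=> k; have [] := AP k.
- have [P [P0 PL Pd ->]] := input_cost_primitive usA.
  have As0 : As th = 0.
    apply/eqP; rewrite -normr_le0; apply/(@le_scaled_eps _ _ _ 1) => // e e0.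
    have [k _ H] := lim e e0 0%N; have [_ _ h1] := H th (lexx _) (ltW thT).
    have [A0 _ _ _] := AP k.
    by rewrite add0r mulr1; move: h1; rewrite A0 sub0r normrN.
  rewrite lee_fin -subr_ge0.
  have zero_sN : seminorm (fun v : R^o => `|v|) 1 by exact: normr_seminorm.
  have bL := lipD AsL (lipZ (-1) PL).
  have bL0 : 0 <= LZ + `|-1| * LA by rewrite addr_ge0// mulr_ge0.
  (* Applied to the zero curve, the principle says that [As - P], whose derivative is almost
     everywhere nonnegative, does not decrease. *)
  have := @ac_dominated R R^o _ _ (fun=> 0) (fun t => As t + (-1) *: P t) th (th + T)
    zero_sN (ltW thT).
  rewrite subrr normr0 As0 P0 scaler0 addr0 subr0 scaleN1r; apply.
  + by move=> e e0; exists 1 => // k p0 q0 _ _ _; rewrite big1// => i _; rewrite subrr normr0.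
  + exact: lip_abs_continuous bL.
  + apply: aeS (aeI (aeI Pd ald) us_ae) => t [[H1 H2] H3] tab.
    exists 0, (al t + (-1) *: (lambda * N (us t) ^+ 2)); split.
    * exact: hder_cst.
    * by apply: hderD; [exact: H2|exact: hderZ (H1 tab)].
    * by rewrite normr0 scaleN1r subr_ge0; have [] := H3 tab.
- move=> e e0 K; have [k Kk H] := lim e e0 K; exists k => //; split.
    by have [] := H (th + T) (ltW thT) (lexx _).
  by move=> t h1 h2; have [] := H t h1 h2.
Qed.

Lemma minimizer_exists (rho : R) : dist th xh < 1 ->
  (forall u x, adm u -> sol u x -> x th = xh ->
    (forall t, th <= t -> t <= th + T -> dist t (x t) < 1) ->
    forall t, th <= t -> t <= th + T -> `|x t| <= rho) ->
  (exists2 u0, adm u0 & (J u0 < +oo)%E) ->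
  exists v, ocp_solution N f g h phi yref lambda M T th xh v.
Proof.
move=> dxh bound [u0 u0A u0J].
have mI : measurable (I : set (measurableTypeR R)) by [].
have bar0 x t : th <= t -> dist t x < 1 -> 0 <= barrier (dist t x).
  by move=> h1 h2; apply: barrier_ge0 => //; rewrite dist_ge0// (le_trans th0).
(* A finite cost forces the trajectory inside the funnel, where the integrand is nonnegative; the
   infimum is therefore a real number. *)
have J0 v : adm v -> (0 <= J v)%E.
  move=> vA; case: (eqVneq (J v) +oo%E) => [->//|]; rewrite -ltey => vJ.
  have [x [xS xth dx]] := cost_lty dxh vA vJ.
  rewrite (cost_inside vA xS xth dx); apply: adde_ge0; apply: integral_ge0 => t /=.
    by rewrite in_itv/= => /andP[h1 h2]; rewrite lee_fin bar0// dx.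
  by move=> _; rewrite lee_fin mulr_ge0// exprn_ge0// is_norm_ge0.
pose j := ereal_inf [set J v | v in adm].
have j0 : (0 <= j)%E by apply: le_ereal_inf_tmp => _ [v vA <-]; exact: J0.
have jJ v : adm v -> (j <= J v)%E by move=> vA; apply: ereal_inf_lbound; exists v.
have [r jE] : exists r : R, j = r%:E.
  by move: j0 (le_lt_trans (jJ _ u0A) u0J); clearbody j; clear jJ; case: j => // r _ _; exists r.
have inv0 k : 0 < k.+1%:R^-1 :> R by rewrite invr_gt0.
have /boolp.choice[ux uxP] k : exists ux : (R -> 'cV[R]_m) * (R -> 'cV[R]_n),
    [/\ adm ux.1, (J ux.1 < (r + k.+1%:R^-1)%:E)%E, sol ux.1 ux.2, ux.2 th = xh &
      forall t, th <= t -> t <= th + T -> dist t (ux.2 t) < 1].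
  have : (j < (r + k.+1%:R^-1)%:E)%E by rewrite jE lte_fin ltrDl.
  move=> /ereal_inf_lt[_ [v vA <-] vJ].
  have [|x [xS xth dx]] := cost_lty dxh vA; first by apply: lt_trans vJ _; rewrite ltry.
  by exists (v, x).
pose u k := (ux k).1; pose x k := (ux k).2.
have [us [xs [A [As [usA [xsS xsth] AE AsE lim]]]]] :=
    trajectories_compact (u := u) (x := x) (rho := rho)
     (fun k => let: And5 h _ _ _ _ := uxP k in h)
     (fun k => let: And5 _ _ h _ _ := uxP k in h)
     (fun k => let: And5 _ _ _ h _ := uxP k in h)
     (fun k => let: And5 h1 _ h3 h4 h5 := uxP k in bound _ _ h1 h3 h4 h5).
have /boolp.choice[ka kaP] i : exists k, [/\ (i <= k)%N, `|A k - As| <= i.+1%:R^-1 &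
    forall t, th <= t -> t <= th + T -> `|x k t - xs t| <= i.+1%:R^-1].
  by have [k ik [h1 h2]] := lim _ (inv0 i) i; exists k.
pose H i t := (barrier (dist t (x (ka i) t)))%:E.
have mH i : measurable_fun I (H i).
  have [_ _ [[L L0 xL] _] _ dx] := uxP (ka i).
  by apply/measurable_EFinP; exact: (barrier_measurable L0 xL dx).
have H0 i t : I t -> (0 <= H i t)%E.
  rewrite /= in_itv/= => /andP[h1 h2]; have [_ _ _ _ dx] := uxP (ka i).
  rewrite lee_fin; apply: bar0; [exact: h1|exact: dx].
(* The barrier cost is the total cost minus the input cost: the former exceeds the infimum [r] by at
   most [i.+1%:R^-1], the latter falls short of [As] by at most the same amount, whence the factor
   2. *)
have intH i : (\int[mu]_(t in I) H i t <= (r - As + 2 * i.+1%:R^-1)%:E)%E.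
  have [uA uJ uS uth dx] := uxP (ka i); have [ik h1 _] := kaP i.
  move: uJ; rewrite (cost_inside uA uS uth dx) -/(u _) AE.
  have [->|] := eqVneq (\int[mu]_(t in I) H i t)%E +oo%E; first by [].
  have : (0 <= \int[mu]_(t in I) H i t)%E by apply: integral_ge0 => t It; exact: H0.
  rewrite -/(x _) -/(H i); move: (\int[mu]_(t in I) H i t)%E => [s| |]//= _ _.
  rewrite -EFinD lte_fin lee_fin => h2.
  have h3 : (ka i).+1%:R^-1 <= i.+1%:R^-1 :> R by rewrite lef_pV2 ?posrE// ler_nat ltnS.
  move: h1; rewrite ler_norml => /andP[h1 _].
  by move: h2 h3 h1; move: (_^-1) (_^-1) => q1 q2 /= ? ? ?; lra.
pose Hs t := limn_einf (H^~ t).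
have intHs : (\int[mu]_(t in I) Hs t <= (r - As)%:E)%E.
  apply: (le_trans (fatou mu mI mH H0)); apply: limn_einf_le => e e0 K.
  pose k := maxn K (Num.bound (2 / e)); exists k; first exact: leq_maxl.
  apply: (le_trans (intH k)); rewrite lee_fin lerD2l ler_pdivrMr//.
  rewrite mulrC -ler_pdivrMr// ltW//; apply: (lt_le_trans (archi_boundP _)).
    by rewrite divr_ge0// ltW.
  by rewrite ler_nat (leq_trans (leq_maxr K _)).
have Hs0 t : I t -> (0 <= Hs t)%E.
  by move=> It; apply: limn_einf_ge0 => k; exact: H0.
have HsE t : th <= t -> t <= th + T -> dist t (xs t) < 1 ->
    Hs t = (barrier (dist t (xs t)))%:E.
  move=> h1 h2 dx; apply: (cvg_limn_einf_sup _).1.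
  apply: cvg_EFin; first exact: nearW.
  have xcv : x (ka i) t @[i --> \oo] --> xs t.
    apply/cvgrPdist_le => e e0; near=> i.
    have [_ _ H1] := kaP i; rewrite distrC (le_trans (H1 t h1 h2))//.
    rewrite ltW//; near: i; exact: near_infty_natSinv_lt (PosNum e0).
  have [C sN] := is_norm_seminorm nN.
  have hc : h (x (ka i) t) @[i --> \oo] --> h (xs t).
    by apply: continuous_cvg xcv; exact: Ck1_continuous.
  have ec : h (x (ka i) t) - yref t @[i --> \oo] --> h (xs t) - yref t.
    by apply: cvgB hc _; exact: cvg_cst.
  have nc : N (h (x (ka i) t) - yref t) @[i --> \oo] --> N (h (xs t) - yref t).
    by apply: continuous_cvg ec; exact: seminorm_continuous sN _.
  have dc : dist t (x (ka i) t) @[i --> \oo] --> dist t (xs t).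
    by apply: cvgM nc; exact: cvg_cst.
  apply: cvgB; last exact: cvg_cst.
  apply: cvgV.
    have := @dist_ge0 _ (xs t) (le_trans th0 h1).
    by move=> h3; rewrite gt_eqF//; nra.
  apply: cvgB; first exact: cvg_cst.
  rewrite [X in _ --> X]expr2.
  by under eq_fun do rewrite expr2; apply: cvgM; exact: dc.
have mHs : measurable_fun I Hs.
  by apply: measurableT_comp => //; apply: measurable_fun_limn_esup => i; exact: measurableT_comp.
(* A uniform limit of trajectories inside the funnel could touch its boundary. [Hs] has a finite
   integral by Fatou and equals the barrier wherever the limit is inside, so [funnel_escape]
   excludes contact. *)
have dxs : forall t, th <= t -> t <= th + T -> dist t (xs t) < 1.
  have [[L L0 xL] _] := xsS; have [K K0 wK] := lip_dist th0 (ltW thT) L0 xL.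
  apply: (@funnel_escape R (fun t => dist t (xs t)) Hs K th (th + T)) => //.
  - exact: ltW.
  - by move=> t h1 h2; rewrite dist_ge0// (le_trans th0).
  - by rewrite xsth.
  - by move=> t h1 h2; apply: Hs0; rewrite /= in_itv/= h1.
  - by move=> t h1 h2 dx; rewrite HsE.
  - by apply: le_lt_trans intHs _; rewrite ltry.
exists us; split => // v vA.
apply: le_trans (jJ _ vA); rewrite jE (cost_inside usA xsS xsth dxs).
have -> : r%:E = ((r - As)%:E + As%:E)%E by rewrite -EFinD subrK.
apply: leeD => //; apply: le_trans intHs.
rewrite le_eqVlt; apply/orP; left; apply/eqP; apply: eq_integral => t.
by rewrite inE /= in_itv/= => /andP[h1 h2]; rewrite HsE// dxs.
Unshelve. all: by end_near. Qed.

End cost.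

(** * The closed loop *)

Section receding_horizon.
Context {R : realType} {n m : nat}.
Variables (N : 'cV[R]_m -> R) (f : 'cV[R]_n -> 'cV[R]_n)
  (g : 'cV[R]_n -> 'M[R]_(n, m)) (h : 'cV[R]_n -> 'cV[R]_m).
Hypothesis nN : is_norm N.
Hypothesis fC : Ck 1 f.
Hypothesis gC : Ck 1 g.
Variables (phi : R -> R) (yref : R -> 'cV[R]_m) (lambda M delta T t0 : R)
  (x0 : 'cV[R]_n).
Hypothesis M0 : 0 <= M.
Hypothesis delta0 : 0 < delta.
Hypothesis deltaT : delta <= T.
Hypothesis t00 : 0 <= t0.
Local Notation mu := (@lebesgue_measure R).
Local Notation dist t x := (phi t * N (h x - yref t)).
Local Notation field u := (fun t x => f x + g x *m u t).
Local Notation adm := (admissible N M T).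
Local Notation J u := (cost N f g h phi yref lambda T u).
Local Notation ocp := (ocp_solution N f g h phi yref lambda M T).
Local Notation sam := (sample delta t0).
Local Notation ufb := (@u_fmpc R m delta t0).
Local Notation loop := (closed_loop N f g h phi yref lambda M delta T t0 x0).

(* P bounds the internal state; it is derived from the whole past of the
   trajectory since t0, not from one sampling time to the next. *)
Variable P : 'cV[R]_n -> Prop.
Hypothesis dist_x0 : dist t0 x0 < 1.
Hypothesis P_invariant : forall u x b, t0 <= b -> lip_solution (field u) t0 b x ->
  x t0 = x0 -> (forall t, t0 <= t -> t <= b -> dist t (x t) < 1) ->
  forall t, t0 <= t -> t <= b -> P (x t).
Hypothesis cost_lty_inside : forall th xh u, 0 <= th -> dist th xh < 1 -> adm th u ->
  (J u th xh < +oo)%E -> exists x, [/\ lip_solution (field u) th (th + T) x,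
    x th = xh & forall t, th <= t -> t <= th + T -> dist t (x t) < 1].
Hypothesis feasible_control : forall th xh, 0 <= th -> dist th xh < 1 -> P xh ->
  exists2 u0, adm th u0 & (J u0 th xh < +oo)%E.
Hypothesis solvable : forall th xh, 0 <= th -> dist th xh < 1 -> P xh ->
  exists v, ocp th xh v.

Lemma sample0 : sam 0%N = t0.
Proof. by rewrite /sample mul0r addr0. Qed.

Lemma sampleS k : sam k.+1 = sam k + delta.
Proof. by rewrite /sample -natr1 mulrDl mul1r addrA. Qed.

Lemma le_sample j k : (j <= k)%N -> sam j <= sam k.
Proof. by move=> jk; rewrite lerD2l ler_wpM2r ?ler_nat// ltW. Qed.

Lemma sample_ge k : t0 <= sam k.
Proof. by rewrite -[leLHS]sample0 le_sample. Qed.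

Lemma sample_ge0 k : 0 <= sam k.
Proof. exact: le_trans t00 (sample_ge k). Qed.

Lemma sample_inj_le j k : sam j <= sam k -> (j <= k)%N.
Proof. by rewrite lerD2l ler_pM2r// ler_nat. Qed.

Lemma truncn_sample k t : sam k <= t -> t < sam k.+1 ->
  Num.truncn ((t - t0) / delta) = k.
Proof.
move=> h1 h2; apply/eqP; rewrite truncn_eq.
  rewrite ler_pdivlMr// ltr_pdivrMr//; move: h1 h2; rewrite /sample.
  by move=> h1 h2; apply/andP; split; lra.
rewrite divr_ge0// ?(ltW delta0)// subr_ge0.
exact: le_trans (sample_ge k) h1.
Qed.

Lemma sampleP t : t0 <= t -> exists k, sam k <= t /\ t < sam k.+1.
Proof.
move=> tt; exists (Num.truncn ((t - t0) / delta)).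
have /truncn_itv : 0 <= (t - t0) / delta.
  by rewrite divr_ge0// ?subr_ge0// ltW.
rewrite ler_pdivlMr// ltr_pdivrMr// /sample => /andP[h1 h2].
by split; lra.
Qed.

Lemma u_fmpcE us k t : sam k <= t -> t < sam k.+1 -> ufb us t = us k t.
Proof. by move=> h1 h2; rewrite /u_fmpc (truncn_sample h1 h2). Qed.

Lemma u_fmpc_bound us k : (forall j, (j < k)%N -> adm (sam j) (us j)) ->
  {ae mu, forall t, t0 <= t <= sam k -> N (ufb us t) <= M}.
Proof.
move=> usA.
have H j : {ae mu, forall t, (j < k)%N -> sam j <= t <= sam j + T -> N (us j t) <= M}.
  have [jk|kj] := ltnP j k; last by apply: aeT => t.
  have [_ uoo] := usA j jk.
  have := (normoo_leP N `[sam j, sam j + T]%classic (us j) M0).1 uoo.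
  by apply: aeS => t Ht _ ht; apply: Ht; rewrite /= in_itv.
(* At [t = sam k] the feedback already reads [us k], about which nothing is assumed; this single
   time is discarded. *)
apply: aeS (aeI (ae_bigI H) (ae_neq (sam k))) => t [Ht tk] /andP[h1 h2].
have {}h2 : t < sam k by rewrite lt_neqAle tk.
have [j [h3 h4]] := sampleP h1; rewrite (u_fmpcE _ h3 h4).
apply: Ht; first by rewrite ltnNge; apply/negP => /le_sample; lra.
rewrite h3/= (le_trans (ltW h4))// sampleS lerD2l; exact: deltaT.
Qed.

Lemma fmpc_lip_solution us x I k : `[t0, sam k]%classic `<=` I ->
  trajectory f g (ufb us) t0 x0 I x ->
  (forall j, (j < k)%N -> adm (sam j) (us j)) ->
  lip_solution (field (ufb us)) t0 (sam k) x.
Proof.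
move=> sI tx usA; have [c c0 cN] := is_norm_bound nN.
have uc : {ae mu, forall t, t0 <= t <= sam k -> `|ufb us t| <= c * M}.
  apply: aeS (u_fmpc_bound usA) => t H ht.
  by rewrite (le_trans (cN _))// ler_pM2l// H.
have cM0 : 0 <= c * M by rewrite mulr_ge0// ltW.
have [bF _] := control_field_regular fC gC cM0 uc.
exact: (caratheodory_lip_solution (sample_ge k) sI bF tx).
Qed.

Lemma adm_field_lip th u : adm th u -> field_lip (field u) th (th + T).
Proof.
move=> uA; have [C C0 uC] := admissible_bound nN M0 uA.
by have [] := control_field_regular fC gC C0 uC.
Qed.

(** Induction on the sampling times. Staying inside so far gives [P] at [sam j], hence a control of
    finite cost, hence a minimizer of finite cost, whose prediction stays inside over the horizon.
    As [delta <= T], uniqueness identifies the run with that prediction up to the next sample. *)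
Lemma fmpc_inside us x k : lip_solution (field (ufb us)) t0 (sam k) x -> x t0 = x0 ->
  (forall j, (j < k)%N -> ocp (sam j) (x (sam j)) (us j)) ->
  forall t, t0 <= t -> t <= sam k -> dist t (x t) < 1.
Proof.
move=> xS x_t0 usO.
suff H j : (j <= k)%N -> forall t, t0 <= t -> t <= sam j -> dist t (x t) < 1.
  exact: H.
elim: j => [_ t h1 h2|j IH jk t h1 h2].
  have -> : t = t0 by apply/eqP; rewrite eq_le h1 -[leRHS]sample0 h2.
  by rewrite x_t0.
have {}IH := IH (ltnW jk).
have [tj|jt] := leP t (sam j); first exact: IH.
have jT : sam j.+1 <= sam j + T by rewrite sampleS lerD2l.
have Sj : lip_solution (field (ufb us)) t0 (sam j) x.
  by apply: lip_solutionW xS => //; apply: le_sample; exact: ltnW.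
have dj : dist (sam j) (x (sam j)) < 1 by apply: IH => //; exact: sample_ge.
have Pj : P (x (sam j)).
  exact: (P_invariant (sample_ge j) Sj x_t0 IH (sample_ge j) (lexx _)).
have [u0 u0A u0J] := feasible_control (sample_ge0 j) dj Pj.
have [uA uO] := usO j jk.
have [z [zS zj dz]] := cost_lty_inside (sample_ge0 j) dj uA (le_lt_trans (uO _ u0A) u0J).
have -> : x t = z t.
  have lF := adm_field_lip uA.
  apply: (@lip_solution_unique _ _ (field (us j)) (sam j) (sam j.+1)) => //; last exact: ltW.
  - move=> r; have [L L0 H] := lF r; exists L => //.
    by apply: aeS H => s Hs /andP[s1 s2]; apply: Hs; rewrite s1 (le_trans s2).
  - have : lip_solution (field (ufb us)) (sam j) (sam j.+1) x.
      by apply: lip_solutionW xS; [exact: sample_ge|exact: le_sample].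
    apply: lip_solution_eq => //.
    apply: aeS (ae_neq (sam j.+1)) => s sj /andP[s1 s2]; apply/funext => y.
    by rewrite (@u_fmpcE _ j)// lt_neqAle sj.
  - exact: lip_solutionW zS.
by apply: dz; [exact: ltW|exact: le_trans jT].
Qed.

Lemma loop_ocp us x k : loop `[t0, sam k]%classic us x ->
  forall j, (j < k)%N -> ocp (sam j) (x (sam j)) (us j).
Proof.
move=> [_ H] j jk; apply: H; rewrite /= in_itv/= sample_ge/=; exact: le_sample.
Qed.

Lemma loop_lip_solution us x k : loop `[t0, sam k]%classic us x ->
  lip_solution (field (ufb us)) t0 (sam k) x /\ x t0 = x0.
Proof.
move=> L; have [tx _] := L; split; last by case: tx.
apply: (fmpc_lip_solution _ tx) => // j jk.
by have [] := loop_ocp L jk.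
Qed.

(** The prediction generated by [v] exists on the whole horizon because its cost is finite; it is
    glued to the past at [sam k]. *)
Lemma loop_extend us x k v : loop `[t0, sam k]%classic us x ->
  ocp (sam k) (x (sam k)) v ->
  exists2 x' : R -> 'cV[R]_n,
    loop `[t0, sam k.+1]%classic (fun j => if j == k then v else us j) x'
    & forall t, t0 <= t <= sam k -> x' t = x t.
Proof.
move=> L vO; have [xS x_t0] := loop_lip_solution L.
have usO := loop_ocp L.
have dx := fmpc_inside xS x_t0 usO.
have dk : dist (sam k) (x (sam k)) < 1 by apply: dx => //; exact: sample_ge.
have Pk : P (x (sam k)) by exact: (P_invariant (sample_ge k) xS x_t0 dx (sample_ge k) (lexx _)).
have [u0 u0A u0J] := feasible_control (sample_ge0 k) dk Pk.
have [vA vopt] := vO.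
have [z [zS zk dz]] := cost_lty_inside (sample_ge0 k) dk vA (le_lt_trans (vopt _ u0A) u0J).
have kk : sam k <= sam k.+1 by exact: le_sample.
pose us' j := if j == k then v else us j.
pose x' t := if t <= sam k then x t else z t.
have x'E t : t <= sam k -> x' t = x t by rewrite /x' => ->.
exists x'; last by move=> t /andP[_]; exact: x'E.
have S1 : lip_solution (field (ufb us')) t0 (sam k) x'.
  apply: lip_solution_eq xS; first by move=> t _ tk; rewrite x'E.
  apply: aeS (ae_neq (sam k)) => t tk /andP[h1 h2]; apply/funext => y.
  have {}h2 : t < sam k by rewrite lt_neqAle tk.
  have [j [h3 h4]] := sampleP h1; rewrite !(u_fmpcE _ h3 h4) /us'.
  by case: eqP => // jk; move: (le_lt_trans h3 h2); rewrite jk ltxx.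
have S2 : lip_solution (field (ufb us')) (sam k) (sam k.+1) x'.
  have : lip_solution (field v) (sam k) (sam k.+1) z.
    by apply: lip_solutionW zS => //; rewrite sampleS lerD2l.
  apply: lip_solution_eq.
    move=> t kt _; rewrite /x'; case: ifP => // tk.
    have -> : t = sam k by apply/eqP; rewrite eq_le tk.
    exact: zk.
  apply: aeS (ae_neq (sam k.+1)) => t tk /andP[h1 h2]; apply/funext => y.
  by rewrite (@u_fmpcE _ k)// ?lt_neqAle ?tk// /us' eqxx.
split.
  have <- : x' t0 = x0 by rewrite x'E ?sample_ge.
  apply: lip_solution_caratheodory; first exact: sample_ge.
  exact: lip_solution_glue (sample_ge k) kk S1 S2.
move=> j; rewrite /= in_itv/= => /andP[_ /sample_inj_le jk].
rewrite x'E; last exact: le_sample.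
rewrite /us'; case: eqP => [->//|/eqP jk'].
by apply: usO; rewrite ltn_neqAle jk'.
Qed.

Lemma fmpc_feasible : feasible N f g h phi yref lambda M delta T t0 x0.
Proof.
move=> k us x L; have [xS x_t0] := loop_lip_solution L.
have dx := fmpc_inside xS x_t0 (loop_ocp L).
split; last by move=> v; exact: loop_extend.
apply: solvable; first exact: sample_ge0.
  by apply: dx => //; exact: sample_ge.
exact: (P_invariant (sample_ge k) xS x_t0 dx (sample_ge k) (lexx _)).
Qed.

(** Dependent choice over finite runs, each extending the previous one; the global run is read off
    along the diagonal. *)
Lemma fmpc_global_solution : exists us x, loop `[t0, +oo[%classic us x.
Proof.
pose state := ((nat -> R -> 'cV[R]_m) * (R -> 'cV[R]_n))%type.
pose good k (s : state) := loop `[t0, sam k]%classic s.1 s.2.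
pose succ k (s s' : state) := [/\ good k.+1 s', forall j, (j < k)%N -> s'.1 j = s.1 j
  & forall t, t0 <= t <= sam k -> s'.2 t = s.2 t].
have next k s : exists s', good k s -> succ k s s'.
  have [G|nG] := pselect (good k s); last by exists s.
  have [[v vO] H] := fmpc_feasible G; have [x' L x'E] := H v vO.
  exists (fun j => if j == k then v else s.1 j, x') => _; split => //=.
  by move=> j jk; rewrite ltn_eqF.
have /boolp.choice[F FP] : forall ks : nat * state, exists s', good ks.1 ks.2 -> succ ks.1 ks.2 s'.
  by move=> [k s]; exact: next.
pose s0 : state := (fun _ _ => 0, fun _ => x0).
pose S := fix S k := if k is k'.+1 then F (k', S k') else s0.
(* On the degenerate interval at [t0] the differential equation is required almost everywhere on one
   point, so a constant curve qualifies. *)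
have good0 : good 0%N s0.
  split; last first.
    move=> k; rewrite sample0 /= in_itv/= => /andP[_]; rewrite -[X in _ <= X]sample0.
    by move/sample_inj_le.
  rewrite sample0; have -> : x0 = s0.2 t0 by [].
  apply: lip_solution_caratheodory => //; split.
    by exists 0 => // r s _ _ _; rewrite subrr normr0 mul0r.
  apply: aeS (ae_neq t0) => t tt /andP[h1 h2].
  by case/negP: tt; rewrite eq_le h1 h2.
have goodS k : good k (S k) by elim: k => //= k IH; have [] := FP (k, S k) IH.
have succS k : succ k (S k) (S k.+1) by apply: (FP (k, S k)); exact: goodS.
clearbody S.
(* The [j]-th input is fixed from stage [j + 1] on, and [x t] is read at a stage whose run already
   covers [t]. *)
pose us j := (S j.+1).1 j.
pose x t := (S (Num.truncn ((t - t0) / delta)).+1).2 t.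
have usE j k : (j < k)%N -> (S k).1 j = us j.
  elim: k => // k IH; rewrite ltnS leq_eqVlt => /predU1P[->//|jk].
  by have [_ H _] := succS k; rewrite H// IH.
have xE1 i k t : (k <= i)%N -> t0 <= t <= sam k -> (S i).2 t = (S k).2 t.
  move=> + tk; elim: i => [|i IH]; first by rewrite leqn0 => /eqP ->.
  rewrite leq_eqVlt => /predU1P[->//|]; rewrite ltnS => ki.
  have [_ _ H] := succS i; rewrite H ?IH//; case/andP: tk => -> /= tk.
  exact: le_trans tk (le_sample ki).
have xE k t : t0 <= t <= sam k -> (S k).2 t = x t.
  move=> tk; have /andP[h1 h2] := tk; have [i [h3 h4]] := sampleP h1.
  rewrite /x (truncn_sample h3 h4).
  have [ik|ki] := leqP i.+1 k; first by apply: xE1 => //; rewrite h1 ltW.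
  by apply/esym; apply: xE1 => //; exact: ltnW.
have xS k : lip_solution (field (ufb us)) t0 (sam k) x.
  have [SS _] := loop_lip_solution (goodS k).
  apply: lip_solution_eq SS; first by move=> t h1 h2; rewrite xE// h1.
  apply: aeS (ae_neq (sam k)) => t tk /andP[h1 h2]; apply/funext => y.
  have {}h2 : t < sam k by rewrite lt_neqAle tk.
  have [j [h3 h4]] := sampleP h1; rewrite !(u_fmpcE _ h3 h4) usE//.
  by rewrite ltnNge; apply/negP => /le_sample; lra.
exists us, x; split.
- split.
  + by rewrite /= in_itv/= lexx.
  + have [_ x_t0] := loop_lip_solution (goodS 0%N).
    by rewrite -(xE 0%N)// sample0 !lexx.
  + move=> a b sub; have [ab|ba] := leP a b; last first.
      move=> e e0; exists 1 => // l p q pq _ _.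
      by rewrite big1// => i _; have [h1 h2 h3] := pq i; lra.
    have at_ : t0 <= a.
      have : `[t0, +oo[%classic a by apply: sub; rewrite /= in_itv/= lexx.
      by rewrite /= in_itv/= andbT.
    have [k [_ bk]] := sampleP (le_trans at_ ab).
    have [[L L0 xL] _] := xS k.+1.
    by apply: (@lip_abs_continuous _ _ L) => //; apply: lipW xL => //; exact: ltW.
  + have H k : {ae mu, forall t, t0 <= t <= sam k ->
        hder x t (f (x t) + g (x t) *m ufb us t)} by have [] := xS k.
    apply: aeS (ae_bigI H) => t Ht; rewrite /= in_itv/= andbT => tt.
    have [k [_ tk]] := sampleP tt; apply/is_derive_hder; apply: (Ht k.+1).
    by rewrite tt ltW.
- move=> k _; have := loop_ocp (goodS k.+1) (ltnSn k).
  by rewrite (usE _ _ (ltnSn k)) (xE k.+1 (sam k))// sample_ge le_sample.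
Qed.

Lemma fmpc_properties us x : loop `[t0, +oo[%classic us x ->
  {ae mu, forall t, t0 <= t -> N (ufb us t) <= M} /\
  forall t, t0 <= t -> dist t (x t) < 1.
Proof.
move=> [tx usO].
have {}usO j : ocp (sam j) (x (sam j)) (us j).
  by apply: usO; rewrite /= in_itv/= sample_ge.
have usA j : adm (sam j) (us j) by have [] := usO j.
split.
  have H k : {ae mu, forall t, t0 <= t <= sam k -> N (ufb us t) <= M}.
    exact: u_fmpc_bound.
  apply: aeS (ae_bigI H) => t Ht tt; have [k [_ tk]] := sampleP tt.
  by apply: (Ht k.+1); rewrite tt ltW.
move=> t tt; have [k [_ tk]] := sampleP tt.
have x_t0 : x t0 = x0 by case: tx.
have xS : lip_solution (field (ufb us)) t0 (sam k.+1) x.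
  apply: (fmpc_lip_solution _ tx) => // s; rewrite /= !in_itv/= andbT.
  by case/andP.
apply: (fmpc_inside xS x_t0) => //; exact: ltW.
Qed.

End receding_horizon.

(** * Bounds for funnel functions and reference signals *)

Section funnel_functions.
Context {R : realType}.

Lemma W1oo_lip (z : R -> R) : W1oo z ->
  exists2 L, 0 <= L & forall a b, 0 <= a -> lip L a b (z : R -> R^o).
Proof.
move=> [_ _ [L zL]]; exists L.
  by have := zL 1 0 ler01 (lexx _); rewrite subr0 normr1 mulr1; exact: le_trans.
move=> a b a0 r s ar rs _; rewrite -[s - r]ger0_norm ?subr_ge0//.
by apply: zL; rewrite (le_trans a0)// (le_trans ar).
Qed.

Lemma W1oo_bounded (z : R -> R) : W1oo z ->
  exists2 C, 0 <= C & forall t, 0 <= t -> `|z t| <= C.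
Proof.
move=> zW; have [L L0 zL] := W1oo_lip zW.
have [[_ /normoo_lty[C C0 /(normoo_leP _ _ _ C0) zC]] _ _] := zW.
exists C => // t t0; have t1 : 0 < t + 1 by rewrite ltr_wpDl.
apply: (@ae_le_lip _ _ (fun x : R^o => `|x|) 1 L 0 (t + 1)) => //.
- exact: (@normr_seminorm R R^o).
- exact: zL.
- by apply: aeS zC => s H /andP[s0 _]; apply: H; rewrite /= in_itv/= s0.
- by rewrite lerDl.
Qed.

Lemma W1oo_vec_lip (m : nat) (z : R -> 'cV[R]_m) : W1oo_vec z ->
  exists2 L, 0 <= L & forall a b, 0 <= a -> lip L a b z.
Proof.
move=> zW.
have /boolp.choice[L LP] i : exists L, 0 <= L /\
    forall a b, 0 <= a -> lip L a b (fun t => z t i 0 : R^o).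
  by have [L L0 H] := W1oo_lip (zW i); exists L.
have L0 : 0 <= \sum_i L i by apply: sumr_ge0 => i _; have [] := LP i.
exists (\sum_i L i) => // a b a0; apply: lip_col => // i.
have [_ /(_ a b a0) H] := LP i; apply: lip_le H.
rewrite (bigD1 i)//= lerDl; apply: sumr_ge0 => j _; by have [] := LP j.
Qed.

Lemma W1oo_vec_bounded (m : nat) (z : R -> 'cV[R]_m) : W1oo_vec z ->
  exists2 C, 0 <= C & forall t, 0 <= t -> `|z t| <= C.
Proof.
move=> zW.
have /boolp.choice[C CP] i : exists C, 0 <= C /\ forall t, 0 <= t -> `|z t i 0| <= C.
  by have [C C0 H] := W1oo_bounded (zW i); exists C.
have C0 : 0 <= \sum_i C i by apply: sumr_ge0 => i _; have [] := CP i.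
exists (\sum_i C i) => // t t0; apply: mx_norm_le => // i j.
have [_ /(_ _ t0)] := CP i; rewrite ord1 => /le_trans; apply.
rewrite (bigD1 i)//= lerDl; apply: sumr_ge0 => k _; by have [] := CP k.
Qed.

Lemma funnel_function_ge (phi : R -> R) : funnel_function phi ->
  exists2 c, 0 < c & forall t, 0 <= t -> c <= phi t.
Proof.
move=> [_ phi0]; exists (inf (phi @` `[0, +oo[)) => // t t0.
apply: inf_lbound; last by exists t => //=; rewrite in_itv/= t0.
(* The infimum of a set without one is [0] by convention, so its positivity implies that it is a
   genuine lower bound. *)
have [[_ //]|ni] := pselect (has_inf (phi @` `[0, +oo[)).
by rewrite inf_out// ltxx in phi0.
Qed.

End funnel_functions.

(** * Choice of the constants and proof of the theorem *)

Section funnel_mpc.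
Context {R : realType} {n m : nat}.
Variables (nrm : forall d, 'cV[R]_d -> R).
Hypothesis nrm_norm : forall d, is_norm (@nrm d).
Arguments nrm : clear implicits.
Arguments nrm_norm : clear implicits.
Variables (f : 'cV[R]_n -> 'cV[R]_n) (g : 'cV[R]_n -> 'M[R]_(n, m))
  (h : 'cV[R]_n -> 'cV[R]_m).
Variables (Phi : 'cV[R]_n -> 'cV[R]_m * 'cV[R]_(n - m))
  (Psi : 'cV[R]_m * 'cV[R]_(n - m) -> 'cV[R]_n)
  (p : 'cV[R]_m * 'cV[R]_(n - m) -> 'cV[R]_m)
  (q : 'cV[R]_m * 'cV[R]_(n - m) -> 'cV[R]_(n - m)).
Hypothesis bi : byrnes_isidori f g h Phi Psi p q.
Hypothesis fC : Ck 1 f.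
Hypothesis gC : Ck 1 g.
Hypothesis hC : Ck 1 h.
Variables (phi : R -> R) (Lphi cphi : R).
Hypothesis Lphi0 : 0 <= Lphi.
Hypothesis cphi0 : 0 < cphi.
Hypothesis phi_ge : forall t, 0 <= t -> cphi <= phi t.
Hypothesis phi_lip : forall a b, 0 <= a -> lip Lphi a b (phi : R -> R^o).
Variables (yref : R -> 'cV[R]_m) (Lref Yref : R).
Hypothesis Lref0 : 0 <= Lref.
Hypothesis yref_le : forall t, 0 <= t -> nrm m (yref t) <= Yref.
Hypothesis yref_lip : forall a b, 0 <= a -> lip Lref a b yref.
Local Notation mu := (@lebesgue_measure R).
Local Notation dist t x := ((phi t * nrm m (h x - yref t))%R).
Local Notation field u := (fun t x => f x + g x *m u t).
Local Notation ybound := (Yref + cphi^-1).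

(** The internal state of a run solves the internal dynamics driven by its own output, which is
    bounded by the funnel; uniqueness identifies it with the solution that BIBS bounds. *)
Lemma internal_bounded (c0 c1 a b : R) (u : R -> 'cV[R]_m) (x : R -> 'cV[R]_n) :
  (forall (t0 : R) (eta0 : 'cV[R]_(n - m)) (y : R -> 'cV[R]_m),
      0 <= t0 -> Loo_loc (nrm m) t0 y ->
      ((nrm (n - m)%N eta0)%:E + normoo (nrm m) `[t0, +oo[ y <= c0%:E)%E ->
      exists2 eta : R -> 'cV[R]_(n - m),
        caratheodory (fun t z => q (y t, z)) t0 eta0 `[t0, +oo[ eta
        & (normoo (nrm (n - m)%N) `[t0, +oo[ eta <= c1%:E)%E) ->
  0 <= c1 -> 0 <= a -> a <= b -> lip_solution (field u) a b x ->
  (forall t, a <= t -> t <= b -> dist t (x t) < 1) ->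
  nrm _ (Phi (x a)).2 + ybound <= c0 ->
  forall t, a <= t -> t <= b -> nrm _ (Phi (x t)).2 <= c1.
Proof.
move=> H c10 a0 ab xS dx etac t at_ tb.
have [[L L0 xL] _] := xS.
have [K K0 hxL] := lip_Ck1_comp (@proper_cV R n) hC L0 xL.
have hx s : a <= s -> s <= b -> nrm m (h (x s)) <= ybound.
  move=> as_ sb; apply: (funnel_output_le nrm_norm cphi0 phi_ge yref_le (t := s)).
    exact: le_trans as_.
  exact: dx.
have [eta [etaS etaa etac1]] := bibs_solution nrm_norm bi H c10 a0 ab K0 hxL hx etac.
have hxn s : a <= s -> s <= b -> `|h (x s)| <= `|h (x a)| + K * (b - a).
  exact: (lip_bounded K0 hxL).
have [_ lF] := internal_field_regular bi hxn.
have E := lip_solution_unique lF (internal_solution bi xS) etaS (esym etaa) at_ tb.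
by rewrite /= in E; rewrite E; exact: etac1.
Qed.

Lemma state_bounded (c : R) : exists rho, forall x,
  nrm m (h x) <= ybound -> nrm _ (Phi x).2 <= c -> `|x| <= rho.
Proof.
have [[_ QC PK _] _ _ Ph _] := bi.
have [km km0 kmN] := is_norm_bound (nrm_norm m).
have [kn kn0 knN] := is_norm_bound (nrm_norm (n - m)).
have [cVW _] := proper_prod (@proper_cV R m) (@proper_cV R (n - m)).
have [rho _ Qrho] := continuous_bounded (cVW (Num.max (km * ybound) (kn * c)))
  (Ck1_continuous QC).
exists rho => x hx etax; rewrite -(PK x); apply: Qrho.
rewrite /= (surjective_pairing (Phi x)) Ph; apply: pair_norm_le; rewrite le_max.
  by rewrite (le_trans (kmN _))// ler_pM2l.
by rewrite orbC (le_trans (knN _))// ler_pM2l.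
Qed.

Hypothesis bibs_q : bibs nrm q.
Hypothesis hC2 : Ck 2 h.
Hypothesis rel_deg : forall x, Gamma g h x \in unitmx.
Variable lambda : R.
Hypothesis lambda0 : 0 <= lambda.

(** With the weighted error frozen the barrier is constant in time, so it costs a finite multiple of
    [T]. *)
Lemma funnel_control_cost (c1 : R) : 0 < c1 -> exists2 M, 0 < M &
  forall T th xh, 0 < T -> 0 <= th -> dist th xh < 1 -> nrm _ (Phi xh).2 <= c1 ->
  exists2 u, admissible (nrm m) M T th u &
    (cost (nrm m) f g h phi yref lambda T u th xh < +oo)%E.
Proof.
move=> c10.
have [M M0 HM] := tracking_control nrm_norm bi bibs_q gC hC2 rel_deg Lphi0 cphi0
  phi_ge phi_lip Lref0 yref_le yref_lip c10.
exists M => // T th xh T0 th0 dxh eta_xh.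
have thT : th < th + T by rewrite ltrDl.
have [u [x [xS xth mu_ uM dx]]] := HM th (th + T) xh th0 thT dxh eta_xh.
have uoo : (normoo (nrm m) `[th, (th + T)%R]%classic u <= M%:E)%E.
  by apply/normoo_leP; [exact: ltW|apply: aeS uM => t H; rewrite /= in_itv/=].
have uA : admissible (nrm m) M T th u.
  by split => //; split => //; apply: le_lt_trans uoo _; rewrite ltry.
exists u => //.
rewrite (cost_inside (nrm_norm m) fC gC hC Lphi0 cphi0 phi_ge phi_lip Lref0 yref_lip
  lambda0 (ltW M0) T0 th0 uA xS xth); last by move=> t h1 h2; rewrite dx.
have [A [_ _ _ ->]] := input_cost_primitive (nrm_norm m) lambda0 (ltW M0) T0 uA.
rewrite (@eq_integral _ _ _ mu `[th, (th + T)%R]%classic (fun _ => (barrier (dist th xh))%:E)); last first.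
  by move=> t; rewrite inE/= in_itv/= => /andP[h1 h2]; rewrite dx.
rewrite integral_cst//.
have muE : (mu `[th, (th + T)%R]%classic = T%:E)%E.
  by rewrite lebesgue_measure_itv/= lte_fin thT -EFinB addrAC subrr add0r.
by rewrite [X in (_ * X)%E]muE -EFinM -EFinD ltry.
Qed.

Lemma fmpc_bound (t0 : R) (B : set 'cV[R]_n) : 0 <= t0 -> bounded_set B ->
  B `<=` funnel_domain (nrm m) h phi yref t0 ->
  exists2 M, 0 < M & forall delta T, 0 < delta -> delta <= T -> forall x0, B x0 ->
  [/\ feasible (nrm m) f g h phi yref lambda M delta T t0 x0,
      (exists us x, closed_loop (nrm m) f g h phi yref lambda M delta T t0 x0
         `[t0, +oo[ us x)
    & forall us x, closed_loop (nrm m) f g h phi yref lambda M delta T t0 x0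
        `[t0, +oo[ us x ->
      {ae mu, forall t, t0 <= t -> nrm m (u_fmpc delta t0 us t) <= M} /\
      forall t, t0 <= t -> dist t (x t) < 1].
Proof.
move=> t00 B_bounded B_sub.
have yb0 : 0 < ybound := ybound_gt0 nrm_norm cphi0 yref_le.
have [C [C0 CB]] : exists C, 0 <= C /\ forall x, B x -> nrm _ (Phi x).2 <= C.
  have [r r0 rB] := pinfty_ex_gt0 B_bounded.
  have [[PC _ _ _] _ _ _ _] := bi.
  have [c c0 cP] := continuous_bounded (@cV_ball_compact R n r) (Ck1_continuous PC).
  have [k [k0 _ _ kN]] := is_norm_seminorm (nrm_norm (n - m)).
  exists (k * c); split; first by rewrite mulr_ge0.
  move=> x Bx; rewrite (le_trans (kN _))// ler_wpM2l// (le_trans (snd_norm_le _))//.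
  by apply: cP; exact: rB.
have Cy0 : 0 < C + ybound by rewrite ltr_wpDl.
(* [c1] bounds the internal state along every run from [B], hence at each sampling time. [c2] bounds
   it along any prediction that starts below [c1] and stays in the funnel; it yields the radius
   [rho] used for compactness. *)
have [c1 c10 H1] := bibs_q Cy0.
have c1y0 : 0 < c1 + ybound by rewrite addr_gt0.
have [c2 c20 H2] := bibs_q c1y0.
have [M M0 HM] := funnel_control_cost c10.
exists M => // delta T delta0 deltaT x0 Bx0.
have T0 : 0 < T by exact: lt_le_trans deltaT.
have M0' := ltW M0.
pose P x := nrm _ (Phi x).2 <= c1.
have P_inv u x b : t0 <= b -> lip_solution (field u) t0 b x -> x t0 = x0 ->
    (forall t, t0 <= t -> t <= b -> dist t (x t) < 1) ->
    forall t, t0 <= t -> t <= b -> P (x t).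
  move=> t0b xS xt0 dx; apply: (internal_bounded H1 (ltW c10) t00 t0b xS dx).
  by rewrite xt0 lerD2r CB.
have lty th xh u : 0 <= th -> dist th xh < 1 -> admissible (nrm m) M T th u ->
    (cost (nrm m) f g h phi yref lambda T u th xh < +oo)%E ->
    exists x, [/\ lip_solution (field u) th (th + T) x,
    x th = xh & forall t, th <= t -> t <= th + T -> dist t (x t) < 1].
  move=> th0 dxh uA; exact: (cost_lty (nrm_norm m) fC gC hC Lphi0 cphi0 phi_ge phi_lip
    Lref0 yref_lip lambda0 M0' T0 th0 dxh uA).
have ctrl th xh : 0 <= th -> dist th xh < 1 -> P xh ->
    exists2 u, admissible (nrm m) M T th u &
    (cost (nrm m) f g h phi yref lambda T u th xh < +oo)%E.
  by move=> th0 dxh Pxh; exact: HM.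
have [rho Hrho] := state_bounded c2.
have solv th xh : 0 <= th -> dist th xh < 1 -> P xh ->
    exists v, ocp_solution (nrm m) f g h phi yref lambda M T th xh v.
  move=> th0 dxh Pxh.
  apply: (@minimizer_exists R n m (nrm m) f g h (nrm_norm m) fC gC hC phi Lphi cphi
    Lphi0 cphi0 phi_ge phi_lip yref Lref Lref0 yref_lip lambda M T th xh lambda0 M0' T0
    th0 rho dxh); last exact: ctrl.
  move=> u x _ xS xth dx t h1 h2; apply: Hrho.
    apply: (funnel_output_le nrm_norm cphi0 phi_ge yref_le (t := t)); last exact: dx.
    exact: le_trans h1.
  apply: (internal_bounded H2 (ltW c20) th0 _ xS dx) => //.
    by rewrite lerDl ltW.
  by rewrite xth lerD2r.
have dx0 : dist t0 x0 < 1 by exact: B_sub.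
split.
- exact: (fmpc_feasible (nrm_norm m) fC gC M0' delta0 deltaT t00 dx0 P_inv lty ctrl solv).
- exact: (fmpc_global_solution (nrm_norm m) fC gC M0' delta0 deltaT t00 dx0 P_inv lty
    ctrl solv).
- move=> us x; exact: (fmpc_properties (nrm_norm m) fC gC M0' delta0 deltaT t00 dx0 P_inv
    lty ctrl).
Qed.

End funnel_mpc.

Theorem theorem2p10 (R : realType)
    (nrm : forall d : nat, 'cV[R]_d -> R)
    (nrm_norm : forall d : nat, is_norm (nrm d))
    (n m : nat)
    (f : 'cV[R]_n -> 'cV[R]_n) (g : 'cV[R]_n -> 'M[R]_(n, m))
    (h : 'cV[R]_n -> 'cV[R]_m)
    (sys : system_class f g h nrm)
    (phi : R -> R) (phi_funnel : funnel_function phi)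
    (yref : R -> 'cV[R]_m) (yref_W1oo : W1oo_vec yref)
    (lambda : R) (lambda_ge0 : 0 <= lambda)
    (t0 : R) (t0_ge0 : 0 <= t0)
    (B : set 'cV[R]_n) (B_bounded : bounded_set B)
    (B_sub : B `<=` funnel_domain (nrm m) h phi yref t0) :
  exists2 M : R, 0 < M &
    forall delta T : R, 0 < delta -> delta <= T ->
    forall x0 : 'cV[R]_n, B x0 ->
    [/\ feasible (nrm m) f g h phi yref lambda M delta T t0 x0,
        (exists (us : nat -> R -> 'cV[R]_m) (x : R -> 'cV[R]_n),
           closed_loop (nrm m) f g h phi yref lambda M delta T t0 x0
             `[t0, +oo[ us x)
      & forall (us : nat -> R -> 'cV[R]_m) (x : R -> 'cV[R]_n),
          closed_loop (nrm m) f g h phi yref lambda M delta T t0 x0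
            `[t0, +oo[ us x ->
          {ae (@lebesgue_measure R), forall t, t0 <= t ->
             nrm m (u_fmpc delta t0 us t) <= M} /\
          (forall t, t0 <= t ->
             funnel (nrm m) phi (t, h (x t) - yref t) /\
             nrm m (h (x t) - yref t) <= (phi t)^-1)].
Proof.
have [fC gC hC2 rel_deg _ _ [Phi [Psi [p [q [bi bibs_q]]]]]] := sys.
have [Lphi Lphi0 phi_lip] := W1oo_lip phi_funnel.1.
have [cphi cphi0 phi_ge] := funnel_function_ge phi_funnel.
have [Lref Lref0 yref_lip] := W1oo_vec_lip yref_W1oo.
have [C C0 yrefC] := W1oo_vec_bounded yref_W1oo.
have [k [k0 _ _ kN]] := is_norm_seminorm (nrm_norm m).
have yref_le t : 0 <= t -> nrm m (yref t) <= k * C.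
  by move=> t_ge0; rewrite (le_trans (kN _))// ler_wpM2l// yrefC.
have [M M0 HM] := fmpc_bound nrm_norm bi fC gC (Ck2_Ck1 hC2) Lphi0 cphi0 phi_ge phi_lip
  Lref0 yref_le yref_lip bibs_q hC2 rel_deg lambda_ge0 t0_ge0 B_bounded B_sub.
exists M => // delta T delta0 deltaT x0 Bx0.
have [feas sol prop] := HM delta T delta0 deltaT x0 Bx0.
split => // us x loop; have [uM dx] := prop us x loop; split => // t t0t.
have t_ge0 : 0 <= t by exact: le_trans t0t.
have phit : 0 < phi t by exact: lt_le_trans (phi_ge t t_ge0).
split; first by split => //=; exact: dx.
by rewrite -[leRHS]mul1r ler_pdivlMr// mulrC ltW// dx.
Qed.
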